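(* There exist bounds $B(n,D)$, depending only on $n,D$, and $C(n,D,H)$, depending only on $n,D,H$, such that for every $(D,H)$-type ideal $I$ of $\overline{\mathbb Q}[X_1,\dots,X_n]$: $I$ is prime if and only if $1\notin I$ and, for all $f,g\in\overline{\mathbb Q}[X_1,\dots,X_n]$ of degree less than $B(n,D)$ and height less than $C(n,D,H)$, $fg\in I$ implies $f\in I$ or $g\in I$.
   Context: $\overline{\mathbb Q}$ is the field of algebraic numbers. For $\alpha\in\overline{\mathbb Q}$ of degree $d$ with minimal polynomial $a_d\prod_{j}(X-\alpha_j)\in\mathbb Z[X]$ (primitive, integer coefficients), its Mahler measure is $M(\alpha)=|a_d|\prod_{|\alpha_j|\ge1}|\alpha_j|$ and its logarithmic height is $h(\alpha)=\frac{1}{d}\log M(\alpha)$. The height of a polynomial $\sum_\alpha a_\alpha X^\alpha\in\overline{\mathbb Q}[X_1,\dots,X_n]$ is $\max_\alpha h(a_\alpha)$. An ideal $I$ of $\overline{\mathbb Q}[X_1,\dots,X_n]$ is of $(D,H)$-type if it is generated by polynomials each of total degree at most $D$ and height at most $H$. *)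

(* Defs.v *)
(* MathComp world, with MathComp-Analysis for the real numbers and [ln]. *)
From HB Require Import structures.
From mathcomp Require Import all_boot all_order all_algebra all_field.
From mathcomp Require Import boolp classical_sets reals exp.
From mathcomp Require Import mpoly.

Set Implicit Arguments.
Unset Strict Implicit.
Unset Printing Implicit Defensive.

Import Order.TTheory GRing.Theory Num.Theory.

Local Open Scope classical_set_scope.
Local Open Scope ring_scope.

(* The absolute value of [algC] takes its values in [algC] itself. This is the
   same number as an element of [R], given by its rational Dedekind cut. *)
Definition algC_abs (R : realType) (z : algC) : R :=
  sup [set ratr q | q in [set q : rat | ratr q <= `|z|]].

(* The primitive polynomial of Z[X], with positive leading coefficient, that is
   proportional to the monic minimal polynomial [minCpoly z]: [minCpolyP]
   provides the latter over Q, and [rat_poly_scale] clears denominators. *)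
Definition int_minpoly (z : algC) : {poly int} :=
  zprimitive (tag (rat_poly_scale (s2val (minCpolyP z)))).

Definition conjugates (z : algC) : seq algC :=
  sval (closed_field_poly_normal (minCpoly z)).

Definition alg_degree (z : algC) : nat := (size (minCpoly z)).-1.

Definition mahler (R : realType) (z : algC) : R :=
  `|lead_coef (int_minpoly z)|%:~R *
  \prod_(w <- conjugates z | 1 <= `|w|) algC_abs R w.

Definition height (R : realType) (z : algC) : R :=
  ln (mahler R z) / (alg_degree z)%:R.

(* The default value 0 is the height of the coefficients outside the support,
   and heights are nonnegative, so this is the maximum over all monomials. *)
Definition mpheight (R : realType) (n : nat) (p : {mpoly algC[n]}) : R :=
  \big[Num.max/0]_(m <- msupp p) height R p@_m.

(* [msize] is the total degree plus one, except that [msize 0 = 0]; hence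
   [totdeg 0 = 0]. *)
Definition totdeg (n : nat) (p : {mpoly algC[n]}) : nat := (msize p).-1.

Definition ideal_gen (A : comNzRingType) (S : set A) : set A :=
  [set p | exists s : seq (A * A),
     (forall c, c \in s -> S c.2) /\ p = \sum_(c <- s) c.1 * c.2].

(* [idealr_closed] includes [1 \notin I]. *)
Definition prime_ideal (A : comNzRingType) (I : {pred A}) : Prop :=
  idealr_closed I /\ prime_idealr_closed I.

Definition DH_type (R : realType) (n D : nat) (H : R)
    (I : {pred {mpoly algC[n]}}) : Prop :=
  exists S : set {mpoly algC[n]},
    (forall p, S p -> (totdeg p <= D)%N /\ mpheight R p <= H) /\
    (forall p, p \in I <-> ideal_gen S p).

(* Main.v *)
(* Degrees. By Hermann's theorem, linear systems over K[X_1, ..., X_n] have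
   solutions of bounded degree. Suppose that primality of I holds for products of
   elements of small degree. Eliminate variables one at a time, as long as I
   contains a nonzero polynomial of small degree in the remaining variables: the
   quotient by I stays a finitely presented module, with bounded data, over a
   polynomial ring in fewer variables. In the end this ring S injects in small
   degree, the quotient becomes over Frac S a finite algebra, and by Gauss's
   lemma the test applied to factors of small degree shows that each small
   element has an irreducible minimal polynomial over Frac S. A zero divisor
   would produce a nonzero radical of the trace form, hence one of small degree;
   but the radical contains no invertible element in characteristic 0. So the
   algebra is a domain, and elements of S can be cancelled modulo I by the test.

   Heights. If the test fails for some f, g of bounded degree, normalize a
   coefficient of f and of g modulo I to 1: the existence of such a pair is a
   system of polynomial equations with coefficients of bounded height, so by an
   effective Nullstellensatz it also has a solution of bounded height. This uses
   only that sums, products, inverses and roots of numbers of bounded height have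
   bounded height, which all follow from one estimate for the Mahler measure of a
   root of a polynomial. *)

(* The delicate point is uniformity: no bound may depend on the ideal, on the number of its
   generators, or on the degree of the number field of the coefficients. Generators of bounded
   degree lie in a space of fixed dimension and a spanning family can be picked among them, so a
   fixed number of original generators suffices and heights are untouched. Every lemma chooses its
   constants before the ideal; intermediate objects (generators of a syzygy module, index set of a
   presentation) must therefore have a size fixed in advance, which explains the padding by zeros
   and by powers of a variable. Presentations record relations and not only generators, because each
   later search for a small witness (annihilator, minimal polynomial, kernel vector) selects a small
   generator of some module of relations. Infinitely many numbers have bounded height when their
   degree is free, so heights cannot be handled by finiteness: they enter through closure properties
   uniform in the degree. The degree part mentions no heights, which keeps the degree bound
   independent of H. *)
Require Import Defs.
From HB Require Import structures.
From mathcomp Require Import all_boot all_order all_algebra all_field.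
From mathcomp Require Import boolp classical_sets reals sequences exp.
From mathcomp Require Import perm fraction generic_quotient mpoly zify ring.

Set Implicit Arguments.
Unset Strict Implicit.
Unset Printing Implicit Defensive.

Import Order.TTheory GRing.Theory Num.Theory.

Local Open Scope ring_scope.

(** * Degrees and the last variable *)

Section MSize.
Variables (K : fieldType) (n : nat).
Implicit Types p q : {mpoly K[n]}.

Lemma msize_leP p d :
  reflect (forall m, (d <= mdeg m)%N -> p@_m = 0) (msize p <= d)%N.
Proof.
apply: (iffP idP) => [le_pd m le_dm | h].
  by apply/eqP; rewrite mcoeff_eq0; apply/msize_mdeg_ge/(leq_trans le_pd).
rewrite msizeE; apply/bigmax_leqP_seq => m m_p _; rewrite ltnNge.
by apply: contraL m_p => le_dm; rewrite -mcoeff_eq0 h.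
Qed.

Lemma msizeD_le p q d : (msize p <= d)%N -> (msize q <= d)%N ->
  (msize (p + q) <= d)%N.
Proof.
by move=> hp hq; apply: leq_trans (mmeasureD_le _ _ _) _; rewrite geq_max hp.
Qed.

Lemma msizeN_le p d : (msize p <= d)%N -> (msize (- p) <= d)%N.
Proof. by rewrite mmeasureN. Qed.

Lemma msizeM_leD p q d e : (msize p <= d)%N -> (msize q <= e)%N ->
  (msize (p * q) <= d + e)%N.
Proof.
have [->|p0] := eqVneq p 0; first by rewrite mul0r msize0.
have [->|q0] := eqVneq q 0; first by rewrite mulr0 msize0.
move=> hp hq; rewrite msizeM //; apply: leq_trans (leq_pred _) _.
exact: leq_add.
Qed.

Lemma msizeZ_leq p c d : (msize p <= d)%N -> (msize (c *: p) <= d)%N.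
Proof. by move=> h; apply: leq_trans (msizeZ_le _ _) h. Qed.

Lemma msize_sum_le (I : Type) (r : seq I) (P : pred I)
    (F : I -> {mpoly K[n]}) d :
  (forall i, P i -> (msize (F i) <= d)%N) ->
  (msize (\sum_(i <- r | P i) F i) <= d)%N.
Proof.
move=> h; apply: (big_ind (fun p => (msize p <= d)%N)) => //.
  by rewrite msize0.
by move=> p q; apply: msizeD_le.
Qed.

Lemma msizeC_le (c : K) : (msize (c%:MP : {mpoly K[n]}) <= 1)%N.
Proof. by rewrite mmeasureC; case: eqP. Qed.

Lemma msizeX_le p d k : (msize p <= d)%N -> (msize (p ^+ k) <= 1 + k * d)%N.
Proof.
move=> h; elim: k => [|k IHk]; first by rewrite expr0 msize1.
by rewrite exprS mulSn addnCA; apply: msizeM_leD.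
Qed.

Lemma msize_prod_le (I : Type) (r : seq I) (P : pred I)
    (F : I -> {mpoly K[n]}) d :
  (forall i, P i -> (msize (F i) <= d)%N) ->
  (msize (\prod_(i <- r | P i) F i) <= 1 + size r * d)%N.
Proof.
move=> h; elim: r => [|i r IHr] /=; first by rewrite big_nil msize1.
rewrite big_cons; case: ifP => Pi.
  by rewrite mulSn addnCA; apply: msizeM_leD => //; apply: h.
by apply: leq_trans IHr _; rewrite leq_add2l leq_mul2r leqnSn orbT.
Qed.

End MSize.

Section LastVariable.
Variables (K : fieldType) (n : nat).

Definition mnmrcons (m : 'X_{1..n}) (i : nat) : 'X_{1..n.+1} :=
  [multinom [tuple of rcons m i]].

Local Notation widen := (widen_ord (leqnSn _)).

Lemma mnmrcons_widen m i (j : 'I_n) : mnmrcons m i (widen j) = m j.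
Proof.
rewrite multinomE (tnth_nth 0%N) /= nth_rcons size_tuple ltn_ord.
by rewrite -tnth_nth.
Qed.

Lemma mnmrcons_max m i : mnmrcons m i ord_max = i.
Proof.
by rewrite multinomE (tnth_nth 0%N) /= nth_rcons size_tuple ltnn eqxx.
Qed.

Lemma mnmrconsP (m : 'X_{1..n.+1}) :
  m = mnmrcons [multinom m (widen i) | i < n] (m ord_max).
Proof.
apply/mnmP => i; case: (unliftP ord_max i) => [j|] ->.
  have -> : lift ord_max j = widen j.
    by apply/val_inj; rewrite /= /bump leqNgt ltn_ord.
  by rewrite mnmrcons_widen mnmE.
by rewrite mnmrcons_max.
Qed.

Lemma mdeg_rcons m i : mdeg (mnmrcons m i) = (mdeg m + i)%N.
Proof.
rewrite !mdegE big_ord_recr /= mnmrcons_max; congr (_ + _)%N.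
by apply: eq_bigr => j _; rewrite mnmrcons_widen.
Qed.

Lemma mnmrcons_inj m m' i i' :
  (mnmrcons m i == mnmrcons m' i') = (m == m') && (i == i').
Proof.
apply/eqP/andP => [/mnmP h | [/eqP-> /eqP-> //]]; split; apply/eqP.
  by apply/mnmP => j; move: (h (widen j)); rewrite !mnmrcons_widen.
by move: (h ord_max); rewrite !mnmrcons_max.
Qed.

Lemma muni_coef (p : {mpoly K[n.+1]}) i m :
  ((muni p)`_i)@_m = p@_(mnmrcons m i).
Proof.
rewrite muniE coef_sum [in RHS](mpolyE p) !raddf_sum /=.
apply: eq_bigr => m' _.
have -> : (p@_m' *: 'X_[m'])@_(mnmrcons m i) =
    p@_m' * (([multinom m' (widen i) | i < n] == m) && (m' ord_max == i))%:R.
  by rewrite mcoeffZ mcoeffX {2}[m']mnmrconsP mnmrcons_inj.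
rewrite coefZ coefXn [i == _]eq_sym.
by case: (_ == i); rewrite ?andbT ?andbF ?mulr1 ?mulr0 ?mcoeff0 // mcoeffZ mcoeffX.
Qed.

Lemma muni_inj : injective (@muni n K).
Proof.
move=> p q e; apply/mpolyP => m; rewrite [m]mnmrconsP -!muni_coef.
by rewrite e.
Qed.

Lemma muni_mwiden (p : {mpoly K[n]}) : muni (mwiden p) = p%:P.
Proof.
elim/mpolyind: p => [|c m p _ _ IHp]; first by rewrite mwiden0 muni0.
rewrite mwidenD mwidenZ mwidenX muniD muniZ IHp polyCD; congr (_ + _).
rewrite -mul_mpolyC polyCM -mul_polyC; congr (_ * _).
apply/polyP => i; apply/mpolyP => m'; rewrite muni_coef mcoeffX coefC.
have -> : mnmwiden m = mnmrcons m 0 by [].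
by rewrite mnmrcons_inj [0%N == i]eq_sym; case: (i == _);
  rewrite ?andbT ?andbF ?mcoeffX ?mcoeff0.
Qed.

Lemma muniX_max : muni ('X_ord_max : {mpoly K[n.+1]}) = 'X.
Proof.
apply/polyP => i; apply/mpolyP => m; rewrite muni_coef mcoeffX coefX.
have -> : (U_(ord_max) = mnmrcons 0 1)%MM.
  apply/mnmP => j; rewrite mnm1E; case: (unliftP ord_max j) => [k|] ->.
    have -> : lift ord_max k = widen k.
      by apply/val_inj; rewrite /= /bump leqNgt ltn_ord.
    rewrite mnmrcons_widen mnm0E; case: eqP => // /(congr1 val) /= e.
    by move: (ltn_ord k); rewrite -e ltnn.
  by rewrite mnmrcons_max eqxx.
rewrite mnmrcons_inj [1%N == i]eq_sym; case: (i == _).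
  by rewrite andbT mcoeff1 eq_sym.
by rewrite andbF mcoeff0.
Qed.

Lemma mmultiK : cancel (@mmulti n K) (@muni n K).
Proof.
move=> p; rewrite /mmulti raddf_sum /= -[RHS]coefK poly_def.
apply: eq_bigr => i _; rewrite rmorphM rmorphXn /= muni_mwiden muniX_max.
by rewrite mul_polyC.
Qed.

Lemma muni_eq0 (p : {mpoly K[n.+1]}) : (muni p == 0) = (p == 0).
Proof.
by rewrite -[X in _ == X](muni0 n K) (inj_eq muni_inj).
Qed.

(** [msize] is the degree plus one, so the truncated difference [d - i] is also right for [i >= d],
    where it forces the coefficient to vanish. *)
Lemma msize_muniP (p : {mpoly K[n.+1]}) d :
  reflect (forall i, (msize (muni p)`_i <= d - i)%N) (msize p <= d)%N.
Proof.
apply: (iffP (msize_leP _ _)) => h => [i|m le_dm].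
  apply/msize_leP => m; rewrite leq_subLR => le_dm.
  by rewrite muni_coef h // mdeg_rcons addnC.
rewrite [m]mnmrconsP -muni_coef; move: le_dm; rewrite {1}[m]mnmrconsP.
rewrite mdeg_rcons addnC -leq_subLR => le_dm.
by have /msize_leP-> := h (m ord_max).
Qed.

Lemma size_muni (p : {mpoly K[n.+1]}) : (size (muni p) <= msize p)%N.
Proof.
apply/leq_sizeP => j le_pj; apply/eqP.
have /msize_muniP/(_ j) := leqnn (msize p).
move: le_pj; rewrite -subn_eq0 => /eqP->.
by rewrite leqn0 mmeasure_poly_eq0.
Qed.

Lemma msize_muni_coef (p : {mpoly K[n.+1]}) i :
  (msize (muni p)`_i <= msize p)%N.
Proof.
by have /msize_muniP/(_ i)/leq_trans := leqnn (msize p); apply; apply: leq_subr.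
Qed.

Lemma msize_mmulti (p : {poly {mpoly K[n]}}) d :
  (forall i, msize p`_i <= d - i)%N -> (msize (mmulti p) <= d)%N.
Proof. by move=> h; apply/msize_muniP => i; rewrite mmultiK. Qed.

Lemma msize_mmulti_le (p : {poly {mpoly K[n]}}) d k :
  (forall i, msize p`_i <= d)%N -> (size p <= k)%N ->
  (msize (mmulti p) <= d + k)%N.
Proof.
move=> h hk; apply: msize_mmulti => i; case: (ltnP i k) => ik.
  by rewrite (leq_trans (h i)) // -addnBA ?leq_addr // ltnW.
by rewrite nth_default ?msize0 // (leq_trans hk).
Qed.

End LastVariable.

(** * Generators taken from a bounded family *)

Section FiniteSpan.
Variable K : fieldType.

(** A maximal free family inside [V] spans it. The nonzero rows are members of [V], not combinations
    of members, so whatever defines [V] (being a relation, having small height) survives the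
    selection. *)
Lemma span_finite N (V : 'rV[K]_N -> Prop) :
  exists A : 'M[K]_N, (forall i, row i A = 0 \/ V (row i A)) /\
    (forall v, V v -> (v <= A)%MS).
Proof.
pose P r := `[< exists A : 'M[K]_(r, N), row_free A /\ forall i, V (row i A) >].
have P0 : exists r, P r.
  exists 0%N; apply/asboolP; exists 0; split; last by case.
  by rewrite /row_free mxrank0.
have PN r : P r -> (r <= N)%N.
  by move=> /asboolP[A [/eqP eA _]]; move: (rank_leq_col A); rewrite eA.
case: (ex_maxnP P0 PN) => r /asboolP[A [freeA VA]] maxr.
(* Zero rows pad the family to [N] vectors, a number independent of [V]. *)
pose B : 'M[K]_N := \matrix_(i < N) if insub (val i) is Some j then row j A else 0.
have rN : (r <= N)%N by apply: PN; apply/asboolP; exists A.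
exists B; split=> [i|v Vv].
  by rewrite rowK; case: insub => [j|]; [right; apply: VA | left].
have AB : (A <= B)%MS.
  apply/row_subP => j; have := row_sub (widen_ord rN j) B.
  rewrite rowK /=; case: insubP => [k _ ek|]; last by rewrite ltn_ord.
  by have -> : k = j by apply: val_inj.
apply: submx_trans AB.
apply: contraT => vA; have : P r.+1.
  apply/asboolP; exists (col_mx v A : 'M_(1 + r, N)); split.
    have eR : \rank (col_mx v A) = \rank (v + A)%MS by rewrite addsmxE.
    have lt_A : (\rank A < \rank (v + A)%MS)%N.
      apply: rank_ltmx; rewrite /ltmx addsmxSr /=; apply: contra vA.
      by apply: submx_trans; apply: addsmxSl.
    rewrite (eqP freeA) -eR in lt_A.
    by rewrite /row_free eqn_leq lt_A andbT; apply: (rank_leq_row (col_mx v A)).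
  move=> i; case: (@splitP 1 r i) => j e.
    have -> : i = lshift r j by apply: val_inj.
    by rewrite (_ : row _ _ = v) //; apply: etrans (rowKu j v A) (row_id _ _).
  have -> : i = rshift 1 j by apply: val_inj.
  by rewrite (_ : row _ _ = row j A) //; apply: rowKd.
by move/maxr; rewrite ltnn.
Qed.

(** Families of polynomials of size at most [E] are identified with their coefficient vectors; [t]
    counts the coefficients, so it is known before [V]. *)
Lemma bounded_span n (I : finType) E : exists t,
  forall V : (I -> {mpoly K[n]}) -> Prop,
  (forall v, V v -> forall i, (msize (v i) <= E)%N) ->
  exists W : 'I_t -> I -> {mpoly K[n]},
    (forall l, V (W l) \/ (forall i, W l i = 0)) /\
    (forall v, V v -> exists c : 'I_t -> K,
       forall i, v i = \sum_l c l *: W l i).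
Proof.
pose T : finType := (I * 'X_{1..n < E})%type; exists #|T| => V bV.
pose enc (v : I -> {mpoly K[n]}) : 'rV[K]_#|T| :=
  \row_(j < #|T|) let x : T := enum_val j in (v x.1)@_(x.2).
pose dec (w : 'rV[K]_#|T|) (i : I) : {mpoly K[n]} :=
  \sum_(m : 'X_{1..n < E}) w 0 (enum_rank (i, m)) *: 'X_[m].
have encK v : V v -> forall i, dec (enc v) i = v i.
  move=> Vv i; rewrite [RHS](mpolywE (bV v Vv i)); apply: eq_bigr => m _.
  by rewrite mxE enum_rankK.
pose V' w := exists2 v, V v & w = enc v.
have [A [A1 A2]] := span_finite V'.
pose W l := if pselect (V' (row l A)) is left h then s2val (cid2 h)
            else fun=> 0.
have WE l i : W l i = dec (row l A) i.
  rewrite /W; case: pselect => [h|nV].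
    by case: (cid2 h) => v Vv e; rewrite /= e encK.
  case: (A1 l) => // ->; rewrite /dec big1 // => m _.
  by rewrite mxE scale0r.
exists W; split=> [l|v Vv].
  rewrite /W; case: pselect => [h|]; last by right.
  by left; case: (cid2 h).
have /submxP[D eD] := A2 (enc v) (ex_intro2 _ _ v Vv erefl).
exists (D 0) => i; rewrite -(encK v Vv) eD /dec.
under [RHS]eq_bigr do rewrite WE /dec scaler_sumr.
rewrite exchange_big; apply: eq_bigr => m _ /=.
rewrite mxE scaler_suml; apply: eq_bigr => l _.
by rewrite mxE scalerA.
Qed.

End FiniteSpan.

Section Degree.
Variable K : fieldType.

(** Here degrees add exactly, whereas [msizeM_leD] loses one. The sharp form serves where degrees
    must not grow: substitutions and monic division. *)
Lemma msizeM_deg n (p q : {mpoly K[n]}) d e :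
  (msize p <= d.+1)%N -> (msize q <= e.+1)%N -> (msize (p * q) <= (d + e).+1)%N.
Proof.
have [->|p0] := eqVneq p 0; first by rewrite mul0r msize0.
have [->|q0] := eqVneq q 0; first by rewrite mulr0 msize0.
by move=> hp hq; rewrite msizeM // -ltnS prednK ?addn_gt0 ?lt0n
  ?mmeasure_poly_eq0 ?p0 // -addnS -addSn leq_add.
Qed.

End Degree.

(** * Linear changes of coordinates *)

Section Change.
Variable K : numFieldType.

Lemma rmorph_mpoly_ext n (S : comNzRingType)
    (f g : {rmorphism {mpoly K[n]} -> S}) :
  (forall c, f c%:MP = g c%:MP) -> (forall i, f 'X_i = g 'X_i) -> f =1 g.
Proof.
move=> hC hX p; rewrite (mpolyE p) !rmorph_sum; apply: eq_bigr => m _.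
rewrite -mul_mpolyC !rmorphM /= hC; congr (_ * _).
rewrite mpolyXE_id !rmorph_prod; apply: eq_bigr => i _.
by rewrite !rmorphXn /= hX.
Qed.

Lemma msize_mmap n k (h : 'I_n -> {mpoly K[k]}) p :
  (forall i, msize (h i) <= 2)%N ->
  (msize (mmap (@mpolyC k K) h p) <= msize p)%N.
Proof.
move=> hh; rewrite /mmap big_seq; apply: msize_sum_le => m m_p.
apply: leq_trans (_ : msize (mmap1 h m) <= _)%N.
  by rewrite mul_mpolyC msizeZ_le.
apply: leq_trans (msize_mdeg_lt m_p); rewrite mdegE /mmap1.
apply: (big_rec2 (fun (q : {mpoly K[k]}) d => (msize q <= d.+1)%N)).
  by rewrite msize1.
move=> i d q _ qd; apply: msizeM_deg => //.
elim: (m i) => [|e IHe]; first by rewrite expr0 msize1.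
by rewrite exprS; apply: (msizeM_deg (d := 1) (e := e)).
Qed.

Lemma meval_muni n (v : 'I_n.+1 -> K) p :
  meval v p = (map_poly (meval (v \o widen_ord (leqnSn n))) (muni p)).[v ord_max].
Proof.
pose g : {rmorphism _ -> K} := horner_eval (v ord_max) \o
  map_poly (meval (v \o widen_ord (leqnSn n))) \o @muni n K.
have /= -> // : meval v p = g p.
have ext := @rmorph_mpoly_ext n.+1 K (meval v) g.
apply: ext => [c|i] /=.
  by rewrite muniC map_polyC /= mevalC mevalC /horner_eval hornerC.
case: (unliftP ord_max i) => [j|] ->; last first.
  by rewrite muniX_max map_polyX /horner_eval hornerX mevalXU.
have -> : lift ord_max j = widen_ord (leqnSn n) j.
  by apply/val_inj; rewrite /= /bump leqNgt ltn_ord.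
have -> : 'X_(widen_ord (leqnSn n) j) = mwiden ('X_j : {mpoly K[n]}).
  by rewrite mwidenX mnmwiden1.
by rewrite muni_mwiden map_polyC /horner_eval hornerC /= mwidenX mnmwiden1 !mevalXU.
Qed.

Lemma poly_nat_nonroot (p : {poly K}) : p != 0 ->
  exists k : nat, p.[k%:R] != 0.
Proof.
move=> p0; apply: contrapT => h.
have hr k : root p k%:R.
  by apply/rootP/eqP/negPn/negP => hk; apply: h; exists k.
pose rs : seq K := [seq k%:R | k <- iota 0 (size p)].
have : (size rs < size p)%N.
  apply: max_poly_roots => //; first by apply/allP => _ /mapP[k _ ->].
  rewrite map_inj_uniq ?iota_uniq // => i j /eqP.
  by rewrite eqr_nat => /eqP.
by rewrite size_map size_iota ltnn.
Qed.

Lemma mpoly_nat_nonroot n (p : {mpoly K[n]}) : p != 0 ->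
  exists v : 'I_n -> nat, meval (fun i => (v i)%:R) p != 0.
Proof.
elim: n => [|n IHn] in p *.
  move=> p0; exists (fun=> 0%N).
  have e : p = (p@_0)%:MP.
    apply/mpolyP => m; rewrite mcoeffC.
    have -> : m = 0%MM by apply/mnmP; case.
    by rewrite eqxx mulr1.
  by rewrite e mevalC; apply: contra p0 => /eqP e0; rewrite e e0 mpolyC0.
rewrite -muni_eq0 -lead_coef_eq0 => /IHn[v hv].
pose w i := (v i)%:R : K.
have q0 : map_poly (meval w) (muni p) != 0.
  apply: contra hv => /eqP/(congr1 (fun q : {poly K} => q`_(size (muni p)).-1)).
  by rewrite coef_map coef0 /= => ->.
have [k hk] := poly_nat_nonroot q0.
exists (fun i => if unlift ord_max i is Some j then v j else k).
rewrite meval_muni unlift_none; apply: contra hk => /eqP <-; apply/eqP.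
congr (_.[_]); apply: eq_map_poly => q; apply: meval_eq => i /=.
have -> : widen_ord (leqnSn n) i = lift ord_max i.
  by apply/val_inj; rewrite /= /bump leqNgt ltn_ord.
by rewrite liftK.
Qed.

(** The last variable is rescaled as well, so that setting the other variables to zero afterwards
    amounts to substituting the point [l] times the last variable. *)
Definition shear n (l : 'I_n.+1 -> K) : {mpoly K[n.+1]} -> {mpoly K[n.+1]} :=
  mmap (@mpolyC n.+1 K) (fun i => if i == ord_max then l ord_max *: 'X_ord_max
                         else 'X_i + l i *: 'X_ord_max).

HB.instance Definition _ n l := GRing.RMorphism.on (@shear n l).

Lemma shearC n l c : @shear n l c%:MP = c%:MP.
Proof. by rewrite /shear mmapC. Qed.

Lemma shearX n (l : 'I_n.+1 -> K) i : shear l 'X_i =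
  if i == ord_max then l ord_max *: 'X_ord_max else 'X_i + l i *: 'X_ord_max.
Proof. by rewrite /shear mmapX mmap1U. Qed.

Lemma shearZ n l c p : @shear n l (c *: p) = c *: shear l p.
Proof. by rewrite -!mul_mpolyC rmorphM /= shearC. Qed.

Lemma msize_shear n l p : (msize (@shear n l p) <= msize p)%N.
Proof.
apply: msize_mmap => i; case: eqP => _.
  by rewrite msizeZ_leq // msizeX mdeg1.
by rewrite msizeD_le ?msizeZ_leq // msizeX mdeg1.
Qed.

Definition shear_inv n (l : 'I_n.+1 -> K) i : K :=
  if i == ord_max then (l ord_max)^-1 else - l i / l ord_max.

Lemma shear_invK n l : l ord_max != 0 ->
  cancel (@shear n l) (shear (shear_inv l)).
Proof.
move=> l0; pose g : {rmorphism _ -> _} := shear (shear_inv l) \o @shear n l.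
have ext := @rmorph_mpoly_ext n.+1 _ g (idfun : {rmorphism _ -> _}).
apply: ext => [c|i] /=; first by rewrite !shearC.
rewrite shearX; case: eqP => [->|/eqP ni].
  by rewrite shearZ shearX eqxx /shear_inv eqxx scalerA mulfV // scale1r.
rewrite rmorphD /= shearZ !shearX eqxx (negbTE ni) /shear_inv eqxx (negbTE ni).
by rewrite scalerA -addrA -scalerDl mulNr addNr scale0r addr0.
Qed.

Lemma shearK n l : l ord_max != 0 ->
  cancel (shear (shear_inv l)) (@shear n l).
Proof.
move=> l0; pose l' := shear_inv l.
have l'0 : l' ord_max != 0 by rewrite /l' /shear_inv eqxx invr_eq0.
suff e : shear (shear_inv l') =1 @shear n l.
  by move=> p; rewrite -[LHS]e; apply: shear_invK.
have ext := @rmorph_mpoly_ext n.+1 _ (shear (shear_inv l')) (shear l).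
apply: ext => [c|i] /=; rewrite ?shearC // !shearX /l' /shear_inv eqxx.
case: eqP => // _; first by rewrite invrK.
by rewrite invrK !mulNr opprK divfK.
Qed.

(** The coefficient in question is the top-degree form of [p] evaluated at [l]; in characteristic 0
    this form is nonzero at some point with natural coordinates. *)
Lemma shear_monic n (p : {mpoly K[n.+1]}) : p != 0 ->
  exists l, l ord_max != 0 /\ exists2 c, c != 0 &
    (muni (shear l p))`_(msize p).-1 = c%:MP.
Proof.
move=> p0; set d := (msize p).-1.
have ep : msize p = d.+1 by rewrite prednK // lt0n mmeasure_poly_eq0.
pose top : {mpoly K[n.+1]} := \sum_(m <- msupp p | mdeg m == d) p@_m *: 'X_[m].
have top0 : top != 0.
  apply: contraNneq p0 => t0.
  have : (msize p <= d)%N.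
    apply/msize_leP => m; rewrite leq_eqVlt => /orP[/eqP em|lt_dm].
      have /(congr1 (mcoeff m)) := t0; rewrite mcoeff0 raddf_sum /=.
      have [m_p|/memN_msupp_eq0->//] := boolP (m \in msupp p).
      rewrite big_mkcond (bigD1_seq m) ?msupp_uniq //= -em eqxx mcoeffZ mcoeffX.
      rewrite eqxx mulr1 big1 ?addr0 // => m' /negbTE nm'.
      by case: eqP => // _; rewrite mcoeffZ mcoeffX nm' mulr0.
    by have /msize_leP/(_ m) := leqnn (msize p); rewrite ep; apply.
  by rewrite ep ltnn.
(* The extra factor keeps [l ord_max] nonzero, which makes the shear invertible. *)
have : top * 'X_ord_max != 0 :> {mpoly K[n.+1]}.
  by rewrite mulf_neq0 // -(mmeasure_poly_eq0 mdeg) msizeX.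
case/mpoly_nat_nonroot => v; rewrite mevalM mevalXU mulf_eq0 negb_or.
set l := fun i => (v i)%:R : K; case/andP => vtop vmax.
exists l; split=> //; exists (meval l top) => //.
set q := shear l p.
have -> : (muni q)`_d = (((muni q)`_d)@_0)%:MP.
  apply: msize1_polyC.
  have /msize_muniP/(_ d) := msize_shear l p.
  by rewrite ep subSn // subnn.
congr _%:MP.
(* Shearing and then killing all variables but the last is the same as substituting [l i] times ['X]
   directly. *)
pose g1 : {rmorphism _ -> {poly K}} :=
  map_poly (mcoeff 0) \o @muni n K \o shear l.
pose h i : {poly K} := l i *: 'X.
pose g2 : {rmorphism _ -> {poly K}} := mmap (@polyC K) h.
have e : g1 p = g2 p.
  apply: rmorph_mpoly_ext => [c|i] /=.
    by rewrite shearC muniC map_polyC /= mcoeffC eqxx mulr1 mmapC.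
  rewrite mmapX mmap1U shearX /h.
  case: eqP => [->|/eqP ni].
    rewrite muniZ muniX_max -mul_polyC rmorphM /= map_polyC map_polyX.
    by rewrite /= mcoeffC eqxx mulr1 mul_polyC.
  case: (unliftP ord_max i) ni => [j|] ->; last by rewrite eqxx.
  have -> : lift ord_max j = widen_ord (leqnSn n) j.
    by apply/val_inj; rewrite /= /bump leqNgt ltn_ord.
  have -> : 'X_(widen_ord (leqnSn n) j) = mwiden ('X_j : {mpoly K[n]}).
    by rewrite mwidenX mnmwiden1.
  rewrite muniD muniZ muniX_max muni_mwiden rmorphD /= map_polyC /= mcoeffX.
  have -> : (U_(j) == 0)%MM = false by rewrite mnm1_eq0.
  by rewrite polyC0 add0r -mul_polyC rmorphM /= map_polyC map_polyX /= mcoeffC eqxx mulr1 mul_polyC.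
have -> : (muni q)`_d@_0 = (g1 p)`_d by rewrite /= coef_map.
rewrite e /= /mmap coef_sum /top raddf_sum big_mkcond /=.
rewrite [RHS]big_mkcond /=; apply: eq_bigr => m _.
have -> : mmap1 h m = (\prod_i l i ^+ m i) *: 'X^(mdeg m).
  rewrite /mmap1 mdegE -prodrXr -scaler_prod.
  by apply: eq_bigr => i _; rewrite /h exprZn.
rewrite coefCM coefZ coefXn [d == _]eq_sym; case: eqP => _.
  by rewrite mulr1 mevalZ mevalX.
by rewrite mulr0 mulr0.
Qed.
End Change.

(** * Unique factorization of multivariate polynomials *)

Section Factorial.

Definition divides (S : comNzRingType) (a b : S) := exists c, b = c * a.

Definition prime_elt (S : comUnitRingType) (p : S) :=
  [/\ p != 0, p \isn't a GRing.unit &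
    forall a b, divides p (a * b) -> divides p a \/ divides p b].

Lemma dividesC_coef (S : idomainType) (p : S) (f : {poly S}) :
  (forall i, divides p f`_i) -> exists g : {poly S}, f = p *: g.
Proof.
move=> /choice[c hc]; exists (\poly_(i < size f) c i).
apply/polyP => i; rewrite coefZ coef_poly; case: ltnP => [_|fi].
  by rewrite hc mulrC.
by rewrite mulr0 nth_default.
Qed.

(** At the first coefficients of [f] and [g] that [p] does not divide, the coefficient of index
    [i + j] of the product is their product up to multiples of [p]. *)
Lemma prime_polyC (S : idomainType) (p : S) (f g h : {poly S}) :
  prime_elt p -> f * g = p *: h ->
  (exists f' : {poly S}, f = p *: f') \/ (exists g' : {poly S}, g = p *: g').
Proof.
case=> p0 _ prime_p fg; apply: contrapT => /not_orP[nf ng].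
have ex (k : {poly S}) : ~ (exists k' : {poly S}, k = p *: k') -> exists i, ~~ `[< divides p k`_i >].
  move=> nk; apply: contrapT => h'; apply: nk; apply: dividesC_coef => i.
  by apply: contrapT => ni; apply: h'; exists i; apply/asboolPn.
case: (ex_minnP (ex _ nf)) => i /asboolPn fi mini.
case: (ex_minnP (ex _ ng)) => j /asboolPn gj minj.
have dfi k : (k < i)%N -> divides p f`_k.
  by move=> ki; apply: contrapT => /asboolPn /mini; rewrite leqNgt ki.
have dgj k : (k < j)%N -> divides p g`_k.
  by move=> kj; apply: contrapT => /asboolPn /minj; rewrite leqNgt kj.
have divD : forall a b, divides p a -> divides p b -> divides p (a + b).
  move=> a b; by move=> [c ->] [d ->]; exists (c + d); rewrite mulrDl.
have : divides p (f`_i * g`_j).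
  have := congr1 (fun q : {poly S} => q`_(i + j)) fg; rewrite coefM coefZ.
  have li : (i < (i + j).+1)%N by rewrite ltnS leq_addr.
  rewrite (bigD1 (Ordinal li)) //= addKn => /(canRL (addrK _)) ->.
  apply: (divD _ _); first by exists h`_(i + j); rewrite mulrC.
  rewrite -sumrN; apply: big_ind => [||k nk]; first by exists 0; rewrite mul0r.
    exact: divD.
  have {}nk : (k != i :> nat)%N by rewrite -val_eqE in nk.
  have [ki|ik] := ltnP k i.
    by have [c ->] := dfi _ ki; exists (- (c * g`_(i + j - k))); rewrite mulNr mulrAC.
  have /dgj[c ->] : (i + j - k < j)%N by have := ltn_ord k; lia.
  by exists (- (f`_k * c)); rewrite mulNr mulrA.
by case/prime_p.
Qed.

Lemma pseudo_divp (S : idomainType) (f d : {poly S}) : d != 0 ->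
  exists k q m, [/\ k != 0, k *: f = q * d + m & (size m < size d)%N].
Proof.
move=> d0; exists (lead_coef d ^+ Pdiv.IdomainDefs.scalp f d).
exists (Pdiv.IdomainDefs.divp f d), (Pdiv.IdomainDefs.modp f d).
rewrite expf_neq0 ?lead_coef_eq0 // Pdiv.Idomain.ltn_modp d0; split=> //.
exact: Pdiv.Idomain.divp_eq.
Qed.

Section Poly.
Variables (K : fieldType) (r : nat).
Let S : idomainType := {mpoly K[r]}.
(** This is the induction hypothesis on the number of variables. Existence of a prime divisor does
    the work of gcds and of a full factorization theory. *)
Hypothesis prime_divisor : forall q : {mpoly K[r]}, (1 < msize q)%N ->
  exists2 p : S, prime_elt p & divides p q.

Lemma msize_gt1 (p : {mpoly K[r]}) : p != 0 ->
  p \isn't a GRing.unit -> (1 < msize p)%N.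
Proof.
move=> p0; apply: contraR; rewrite -leqNgt => p1.
have ep := msize1_polyC p1.
have c0 : p@_0 != 0 by apply: contra p0 => /eqP e; rewrite ep e mpolyC0.
rewrite ep; apply/unitrP; exists (p@_0)^-1%:MP.
by rewrite -!mpolyCM mulVf // mulfV.
Qed.

Lemma msize_divides (c p : {mpoly K[r]}) : c != 0 -> prime_elt (p : S) ->
  (msize c < msize (c * p))%N.
Proof.
move=> c0 [p0 up _]; rewrite msizeM //; have := msize_gt1 p0 up.
have : (0 < msize c)%N by rewrite lt0n mmeasure_poly_eq0.
by move: (msize c) (msize p) => x y; lia.
Qed.

(* Gauss's lemma: scalars can be cancelled from a factorization without
   changing the degrees of the factors. *)
Lemma gauss_factor (q : S) (f g h : {poly S}) : q != 0 -> f * g = q *: h ->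
  exists f' g', [/\ f' * g' = h, size f' = size f & size g' = size g].
Proof.
have [n] := ubnP (msize q); elim: n => [|n IHn] in q f g *; first by rewrite ltn0.
move/ltnSE => qn q0 fg; have [q1|q1] := leqP (msize q) 1.
  have eq := msize1_polyC q1.
  have c0 : q@_0 != 0 by apply: contra q0 => /eqP e; rewrite eq e mpolyC0.
  exists f, (((q@_0)^-1%:MP : S) *: g); split=> //.
    by rewrite -scalerAr fg eq scalerA -mpolyCM mcoeffC eqxx mulr1 mulVf // scale1r.
  by rewrite size_scale // mpolyC_eq0 invr_eq0.
have [p pp [c ec]] := prime_divisor q1.
have c0 : c != 0 by apply: contra q0 => /eqP c0; rewrite ec c0 mul0r.
have p0 : p != 0 by case: pp.
have cq : (msize c < n)%N.
  by apply: leq_trans qn; rewrite ec; apply: msize_divides.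
have canc (a b : {poly S}) : p *: a = p *: b -> a = b.
  by move/eqP; rewrite -subr_eq0 -scalerBr scale_poly_eq0 (negbTE p0) subr_eq0 => /eqP.
have fg' : f * g = p *: (c *: h) by rewrite fg ec scalerA mulrC.
case: (prime_polyC pp fg') => -[k ek].
  have [|f' [g' [e1 e2 e3]]] := IHn c k g cq c0.
    by apply: canc; rewrite -fg' ek -scalerAl.
  by exists f', g'; rewrite e1 e2 e3 ek size_scale.
have [|f' [g' [e1 e2 e3]]] := IHn c f k cq c0.
  by apply: canc; rewrite -fg' ek -scalerAr.
by exists f', g'; rewrite e1 e2 e3 ek size_scale.
Qed.

Definition primitive (g : {poly S}) :=
  forall p : S, prime_elt p -> ~ exists g' : {poly S}, g = p *: g'.

Lemma primitive_part (g : {poly S}) : g != 0 ->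
  exists a g', [/\ a != 0, g = a *: g' & primitive g'].
Proof.
have [n] := ubnP (msize (lead_coef g)); elim: n => [|n IHn] in g *.
  by rewrite ltn0.
move/ltnSE => gn g0; have [pg|] := pselect (primitive g).
  by exists 1, g; rewrite oner_eq0 scale1r.
move/existsNP => [p /not_implyP[pp /contrapT[g1 eg]]].
have g10 : g1 != 0 by apply: contra g0 => /eqP e; rewrite eg e scaler0.
have [|a [g' [a0 eg1 pg']]] := IHn g1 _ g10.
  apply: leq_trans gn; rewrite eg lead_coefZ mulrC; apply: msize_divides => //.
  by rewrite lead_coef_eq0.
exists (p * a), g'; split=> //; last by rewrite eg eg1 scalerA.
by rewrite mulf_neq0 //; case: pp.
Qed.

(** Primes of [c] are removed one at a time: such a prime divides [g * h] but not the primitive [g],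
    hence divides [h]. *)
Lemma primitive_cancel (g a h : {poly S}) (c : S) : primitive g -> c != 0 ->
  c *: a = g * h -> exists h', a = g * h'.
Proof.
move=> pg; have [n] := ubnP (msize c); elim: n => [|n IHn] in c h *.
  by rewrite ltn0.
move/ltnSE => cn c0 e; have [c1|c1] := leqP (msize c) 1.
  have ec := msize1_polyC c1.
  have k0 : c@_0 != 0 by apply: contra c0 => /eqP e0; rewrite ec e0 mpolyC0.
  exists (((c@_0)^-1%:MP : S) *: h).
  by rewrite -scalerAr -e ec scalerA -mpolyCM mcoeffC eqxx mulr1 mulVf // scale1r.
have [p pp [d ed]] := prime_divisor c1.
have d0 : d != 0 by apply: contra c0 => /eqP d0; rewrite ed d0 mul0r.
have dn : (msize d < n)%N.
  by apply: leq_trans cn; rewrite ed; apply: msize_divides.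
have e' : g * h = p *: (d *: a) by rewrite -e ed scalerA mulrC.
case: (prime_polyC pp e') => [/(pg _ pp)//|[k ek]].
apply: (IHn d k dn d0); have [p0 _ _] := pp.
apply/eqP; rewrite -subr_eq0; have : p *: (d *: a - g * k) == 0.
  by rewrite scalerBr -e' ek scalerAr subrr.
by rewrite scale_poly_eq0 (negbTE p0).
Qed.

(** If no prime constant divides [f], let [g] be the primitive part of a polynomial of least size
    above 1 dividing a scalar multiple of [f]. Scalars cancel against [g], so it divides [f]; it is
    prime by a Bezout argument over the fraction field, written without denominators. *)
Lemma poly_prime_divisor (f : {poly S}) : f != 0 ->
  f \isn't a GRing.unit -> exists2 p : {poly S}, prime_elt p & divides p f.
Proof.
move=> f0 uf.
have [[p [pp [f' ef]]]|npf] := pselect (exists p, prime_elt p /\ exists f', f = p *: f').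
  exists p%:P; last by exists f'; rewrite ef mulrC mul_polyC.
  case: (pp) => p0 up _; split=> [||a b [c ec]].
  - by rewrite polyC_eq0.
  - by rewrite poly_unitE coefC eqxx negb_and up orbT.
  - have e : a * b = p *: c by rewrite ec mulrC mul_polyC.
    by case: (prime_polyC pp e) => -[c' ->]; [left|right];
      exists c'; rewrite mulrC mul_polyC.
have pf : primitive f by move=> p pp ex; apply: npf; exists p.
have sf : (1 < size f)%N.
  rewrite ltnNge; apply/negP => /size1_polyC ef.
  have c0 : f`_0 != 0 by apply: contra f0 => /eqP e; rewrite ef e polyC0.
  have uc : f`_0 \isn't a GRing.unit.
    by apply: contra uf => uc; rewrite ef poly_unitE coefC eqxx uc size_polyC c0.
  have [p pp [c ec]] := prime_divisor (msize_gt1 c0 uc).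
  by apply: (pf p pp); exists c%:P; rewrite ef ec mulrC polyCM mul_polyC.
pose P n := `[< exists (g : {poly S}) (c : S) (h : {poly S}), [/\ (1 < size g)%N, c != 0, c *: f = g * h
                             & size g = n] >].
have exP : exists n, P n.
  by exists (size f); apply/asboolP; exists f, 1, 1; rewrite oner_eq0 scale1r mulr1.
case: (ex_minnP exP) => n /asboolP[g0 [c0 [h0 [sg0 c00 e0 sn]]]] minn.
have g00 : g0 != 0 by rewrite -size_poly_gt0 ltnW.
have [a [g [a0 eg pg]]] := primitive_part g00.
have sg : size g = n by rewrite -sn eg size_scale.
have eg0 : c0 *: f = g * (a *: h0) by rewrite e0 eg -scalerAl scalerAr.
have mina (d : {poly S}) (c : S) (h : {poly S}) : (1 < size d)%N -> c != 0 -> c *: g = d * h -> (n <= size d)%N.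
  move=> sd c1 e; apply: minn; apply/asboolP; exists d, (c * c0), (h * (a *: h0)).
  by split=> //; rewrite ?mulf_neq0 // -scalerA eg0 mulrA -e -scalerAl.
have [h eh] := primitive_cancel pg c00 eg0.
exists g; last by exists h; rewrite mulrC.
have g_gt1 : (1 < size g)%N by rewrite sg -sn.
have g0' : g != 0 by rewrite -size_poly_gt0 ltnW.
split=> [//||A B [c ec]].
  by rewrite poly_unitE negb_and gtn_eqF.
(* A nonzero combination [D] of [g] and [A] of least size is their gcd over the fraction field: it
   divides both up to nonzero scalars. *)
pose Q n := `[< exists u v : {poly S}, u * g + v * A != 0 /\ size (u * g + v * A) = n >].
have exQ : exists n, Q n.
  by exists (size g); apply/asboolP; exists 1, 0; rewrite mul1r mul0r addr0.
case: (ex_minnP exQ) => d /asboolP[u [v []]]; set D := u * g + v * A.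
move=> D0 sD minD.
have divD x y : exists k q, k != 0 /\ k *: (x * g + y * A) = q * D.
  pose X := x * g + y * A.
  have [k [q [m [k0 e sm]]]] := pseudo_divp X D0; exists k, q; split=> //.
  suff m0 : m = 0 by rewrite -/X e m0 addr0.
  apply/eqP; apply: contraT => m0.
  have em : m = (k *: x - q * u) * g + (k *: y - q * v) * A.
    rewrite !mulrBl addrACA -!scalerAl -scalerDr -opprD -!mulrA -mulrDr.
    by rewrite -/X -/D e addrC addKr.
  have : Q (size m) by apply/asboolP; exists (k *: x - q * u), (k *: y - q * v);
    rewrite -em.
  by move/minD; rewrite -sD leqNgt sm.
have [k1 [q1 [k10 e1]]] := divD 1 0.
have [k2 [q2 [k20 e2]]] := divD 0 1.
rewrite !(mul1r, mul0r, addr0, add0r) in e1 e2.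
(* If [D] is not constant, minimality makes it proportional to [g], whence [g] divides [A]. If [D]
   is constant, [D * B] is a multiple of [g] and the constant cancels. *)
have [sD1|sD1] := leqP (size D) 1; last first.
  left; have kD : k1 *: g = D * q1 by rewrite e1 mulrC.
  have nD := mina D k1 q1 sD1 k10 kD.
  have q10 : q1 != 0.
    apply: contraNneq k10 => q10; move: e1; rewrite q10 mul0r => /eqP.
    by rewrite scale_poly_eq0 (negbTE g0') orbF.
  have : (size (k1 *: g) = (size q1 + size D).-1)%N by rewrite e1 size_mul.
  rewrite size_scale // sg => esz.
  have sq1 : size q1 = 1%N.
    have : (0 < size q1)%N by rewrite size_poly_gt0.
    by move: sD1 nD esz; move: (size D) (size q1) => dd qq; lia.
  have eq1 : q1 = (q1`_0)%:P by apply: size1_polyC; rewrite sq1.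
  have c10 : q1`_0 != 0 by apply: contra q10 => /eqP e; rewrite eq1 e polyC0.
  have : (q1`_0 * k2) *: A = g * (k1 *: q2).
    rewrite -scalerA e2 -[RHS]scalerAr [g * q2]mulrC [RHS]scalerAr e1.
    have -> : q1 * D = q1`_0 *: D by rewrite [in LHS]eq1 mul_polyC.
    by rewrite scalerAr.
  case/(primitive_cancel pg (mulf_neq0 c10 k20)) => A' ->.
  by exists A'; rewrite mulrC.
right; have eD := size1_polyC sD1.
have d0 : D`_0 != 0 by apply: contra D0 => /eqP e; rewrite eD e polyC0.
have : D`_0 *: B = g * (u * B + v * c).
  rewrite -mul_polyC -eD /D mulrDl -!mulrA ec mulrDr.
  by rewrite [g * (u * B)]mulrCA [g * (v * c)]mulrCA [g * c]mulrC.
by case/(primitive_cancel pg d0) => B' ->; exists B'; rewrite mulrC.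
Qed.

End Poly.

Local Opaque muni mmulti mwiden.

Theorem mpoly_prime_divisor (K : fieldType) r (q : {mpoly K[r]}) :
  (1 < msize q)%N -> exists2 p : {mpoly K[r]}, prime_elt p & divides p q.
Proof.
elim: r => [|r IHr] in q *.
  rewrite ltnNge => /negP[]; apply/msize_leP => m.
  by rewrite mdegE big_ord0.
move=> q1; have q0 : q != 0 by rewrite -(mmeasure_poly_eq0 mdeg) -lt0n ltnW.
have unit_muni (p : {mpoly K[r.+1]}) : muni p \is a GRing.unit -> p \is a GRing.unit.
  case/unitrP => v [v1 v2]; apply/unitrP; exists (mmulti v).
  by split; apply: muni_inj; rewrite muniM mmultiK ?v1 ?v2 muni1.
have mq0 : muni q != 0 by rewrite muni_eq0.
have uq : muni q \isn't a GRing.unit.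
  apply/negP => /unit_muni /unitrP[v [_ v1]].
  have v0 : v != 0.
    by apply: contra_eq_neq v1 => ->; rewrite mulr0 eq_sym oner_eq0.
  have := congr1 (fun x : {mpoly K[r.+1]} => msize x) v1.
  rewrite msizeM // msize1; have : (0 < msize v)%N by rewrite lt0n mmeasure_poly_eq0.
  by move: q1; move: (msize q) (msize v) => x y; lia.
have [p [p0 up pp] [c ec]] := poly_prime_divisor IHr mq0 uq.
have unit_mmulti : mmulti p \is a GRing.unit -> p \is a GRing.unit.
  case/unitrP => v [v1 v2]; apply/unitrP; exists (muni v).
  have e := mmultiK p; split; rewrite -[X in _ = X](muni1 r K).
    by rewrite -v1 muniM; congr (_ * _).
  by rewrite -v2 muniM; congr (_ * _).
have divE a : divides p (muni a) -> divides (mmulti p) a.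
  by case=> d ed; exists (mmulti d); apply: muni_inj; rewrite muniM !mmultiK.
exists (mmulti p); last by apply: divE; exists c.
split=> [||a b [d ed]].
- by apply: contra p0 => /eqP e; rewrite -(mmultiK p) e muni0.
- by apply: contra up.
have : divides p (muni a * muni b).
  exists (muni d); apply: (etrans (esym (muniM a b))).
  by rewrite ed muniM mmultiK.
by case/pp => /divE; [left | right].
Qed.

End Factorial.

Local Opaque muni mwiden mmulti.

(** * Degree bounds for linear systems over a polynomial ring *)

Section MonicDivision.
Variables (K : fieldType) (n : nat).

(** The leading coefficient is a constant and [P] has total degree at most [d], so each step
    subtracts terms of total degree no larger than the term it removes. *)
Lemma polydiv_monic d (c : K) (P F : {poly {mpoly K[n]}}) : c != 0 ->
  (size P <= d.+1)%N -> P`_d = c%:MP -> (forall i, msize P`_i <= d.+1 - i)%N ->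
  exists Q R, [/\ F = Q * P + R, (size R <= d)%N
    & forall D, (forall i, msize F`_i <= D - i)%N ->
                (forall i, msize R`_i <= D - i)%N].
Proof.
move=> c0 sP eP mP.
have [k] := ubnP (size F); elim: k => [|k IHk] in F *; first by rewrite ltn0.
move/ltnSE => Fk; have [Fd|dF] := leqP (size F) d.
  by exists 0, F; split; rewrite ?mul0r ?add0r.
pose s := (size F).-1.
have es : size F = s.+1 by rewrite prednK // (leq_ltn_trans _ dF).
have ds : (d <= s)%N by rewrite -ltnS -es.
pose a := F`_s.
pose Q0 : {poly {mpoly K[n]}} := (c^-1 *: a)%:P * 'X^(s - d).
have coefQ i : (Q0 * P)`_i = if (i < s - d)%N then 0
    else c^-1 *: a * P`_(i - (s - d)).
  by rewrite -mulrA coefCM coefXnM; case: ltnP; rewrite ?mulr0.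
have sz : (size (F - Q0 * P)%R < k)%N.
  apply: leq_trans Fk; rewrite es ltnS.
  apply/leq_sizeP => j; rewrite leq_eqVlt => /orP[/eqP <-|lt_j].
    rewrite coefB coefQ ltnNge leq_subr /= subKn // eP mulrC mul_mpolyC.
    by rewrite scalerA mulfV // scale1r -/a subrr.
  rewrite coefB coefQ; case: ltnP => _.
    by rewrite subr0 nth_default // es.
  rewrite [P`__]nth_default ?mulr0 ?subr0 ?nth_default ?es //.
  by apply: leq_trans sP _; lia.
have [Q [R [eF sR bR]]] := IHk _ sz.
exists (Q0 + Q), R; split=> // [|D bF].
  by rewrite mulrDl -addrA -eF addrC subrK.
apply: bR => i; rewrite coefB coefQ; apply: msizeD_le => //.
apply: msizeN_le; case: ltnP => si; first by rewrite msize0.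
have [a0|a0] := eqVneq a 0; first by rewrite a0 scaler0 mul0r msize0.
have := bF s; rewrite -/a => ba.
have pa : (0 < msize a)%N by rewrite lt0n mmeasure_poly_eq0.
have [ji|ji] := ltnP d (i - (s - d)).
  by rewrite [P`__]nth_default ?mulr0 ?msize0 // (leq_trans sP).
have := @msizeM_deg _ _ (c^-1 *: a) P`_(i - (s - d)) (D - s).-1 (d - (i - (s - d))).
have -> : (((D - s).-1 + (d - (i - (s - d)))).+1 = D - i)%N by lia.
apply; first by apply: msizeZ_leq; lia.
by apply: leq_trans (mP _) _; lia.
Qed.

Implicit Types f p q r : {mpoly K[n.+1]}.

Definition monic_last d p := (msize p <= d.+1)%N /\
  exists2 c : K, c != 0 & (muni p)`_d = c%:MP.

Lemma size_monic_last d p : monic_last d p -> size (muni p) = d.+1.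
Proof.
case=> pd [c c0 ec]; apply/eqP; rewrite eqn_leq.
rewrite (leq_trans (size_muni p) pd) ltnNge /=.
apply: contra c0 => /leq_sizeP/(_ d (leqnn d)).
by rewrite ec => /eqP; rewrite mpolyC_eq0.
Qed.

Lemma mdiv_monic d p f : monic_last d p ->
  exists q r, [/\ f = q * p + r, (size (muni r) <= d)%N
    & (msize r <= msize f)%N].
Proof.
move=> mp; have sp := size_monic_last mp; case: mp => pd [c c0 ec].
have [|Q [R [eF sR bR]]] := polydiv_monic (muni f) c0 (eq_leq sp) ec.
  by move=> i; have /msize_muniP/(_ i) := pd.
exists (mmulti Q), (mmulti R); split; last 1 first.
- by apply: msize_mmulti => i; apply: bR => j; apply/msize_muniP.
- by apply: muni_inj; rewrite muniD muniM !mmultiK.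
- by rewrite mmultiK.
Qed.

Lemma msize_mwiden (a : {mpoly K[n]}) d :
  (msize a <= d)%N -> (msize (mwiden a) <= d)%N.
Proof.
move=> ad; apply/msize_muniP => i; rewrite muni_mwiden coefC.
by case: eqP => [->|_]; rewrite ?subn0 ?msize0.
Qed.

End MonicDivision.

Section Spanned.
Variables (R : comNzRingType) (I : finType).

(** The number of generators is left free; [bounded_gens] replaces it by a number fixed in
    advance. *)
Definition spanned (G : (I -> R) -> Prop) (f : I -> R) : Prop :=
  exists (T : finType) (W : T -> I -> R) (h : T -> R),
    (forall l, G (W l)) /\ forall i, f i = \sum_l h l * W l i.

Lemma spanned_eq G (f g : I -> R) : f =1 g -> spanned G f -> spanned G g.
Proof.
by move=> fg [T [W [h [GW e]]]]; exists T, W, h; split=> // i; rewrite -fg.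
Qed.

Lemma spanned_sub (G G' : (I -> R) -> Prop) f : (forall v, G v -> G' v) ->
  spanned G f -> spanned G' f.
Proof.
by move=> GG' [T [W [h [GW e]]]]; exists T, W, h; split=> // l; apply: GG'.
Qed.

Lemma spanned_in (G : (I -> R) -> Prop) f : G f -> spanned G f.
Proof.
move=> Gf; exists unit, (fun=> f), (fun=> 1); split=> // i.
by rewrite (bigD1 tt) //= mul1r big1 ?addr0 //; case.
Qed.

Lemma spannedD G (f g : I -> R) : spanned G f -> spanned G g ->
  spanned G (fun i => f i + g i).
Proof.
move=> [T [W [h [GW e]]]] [T' [W' [h' [GW' e']]]].
exists (T + T')%type,
  (fun x => match x with inl l => W l | inr l => W' l end),
  (fun x => match x with inl l => h l | inr l => h' l end).
by split=> [[]//|i]; rewrite big_sumType /= e e'.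
Qed.

Lemma spannedZ G c (f : I -> R) : spanned G f -> spanned G (fun i => c * f i).
Proof.
move=> [T [W [h [GW e]]]]; exists T, W, (fun l => c * h l); split=> // i.
by rewrite e mulr_sumr; apply: eq_bigr => l _; rewrite mulrA.
Qed.

Lemma spanned0 G : spanned G (fun _ : I => 0 : R).
Proof.
exists void, (fun _ _ => 0), (fun _ => 0); split=> [[]|i].
by rewrite big1 // => -[].
Qed.

Lemma spanned_sum G (J : Type) (r : seq J) (F : J -> I -> R) :
  (forall j, spanned G (F j)) -> spanned G (fun i => \sum_(j <- r) F j i).
Proof.
move=> h; elim: r => [|j r IHr].
  by apply: spanned_eq (spanned0 G) => i; rewrite big_nil.
by apply: spanned_eq (spannedD (h j) IHr) => i; rewrite big_cons.
Qed.

Definition kernel k (A : nat -> I -> R) (v : I -> R) : Prop :=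
  forall j, (j < k)%N -> \sum_i v i * A j i = 0.

End Spanned.

(** * Hermann's theorem: reduction of systems to one equation *)

Section Hermann.
Variable K : numFieldType.

Lemma bounded_gens n (I : finType) E : exists t,
  forall G : (I -> {mpoly K[n]}) -> Prop,
  (forall v, G v -> forall i, (msize (v i) <= E)%N) ->
  exists W : 'I_t -> I -> {mpoly K[n]},
    (forall l, G (W l) \/ (forall i, W l i = 0)) /\
    (forall f, spanned G f -> exists h : 'I_t -> {mpoly K[n]},
       forall i, f i = \sum_l h l * W l i).
Proof.
have [t ht] := bounded_span K n I E; exists t => G bG.
have [W [W1 W2]] := ht G bG; exists W; split=> // f [T [V [h [GV e]]]].
have /choice[c hc] : forall l, exists c : 'I_t -> K,
    forall i, V l i = \sum_l' c l' *: W l' i by move=> l; apply/W2/GV.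
exists (fun l' => \sum_l c l l' *: h l) => i; rewrite e.
under eq_bigr do rewrite hc mulr_sumr.
rewrite exchange_big; apply: eq_bigr => l' _; rewrite mulr_suml.
by apply: eq_bigr => l _; rewrite -scalerAr -scalerAl.
Qed.

Definition hermann n (I : finType) k d E :=
  forall (A : nat -> I -> {mpoly K[n]}) (b : nat -> {mpoly K[n]}),
  (forall j i, (j < k)%N -> (msize (A j i) <= d)%N) ->
  (forall j, (j < k)%N -> (msize (b j) <= d)%N) ->
  (forall f, kernel k A f ->
     spanned (fun v => kernel k A v /\ forall i, (msize (v i) <= E)%N) f) /\
  ((exists f, forall j, (j < k)%N -> \sum_i f i * A j i = b j) ->
   exists f, (forall i, (msize (f i) <= E)%N) /\
     forall j, (j < k)%N -> \sum_i f i * A j i = b j).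

(** The solutions of the first [k] equations are parametrized by [t] generators of their kernel, and
    the next one becomes a single equation in [t] unknowns. Since [t] is fixed in advance, the bound
    for that equation exists before the system is given. The parametrization is why the two halves
    of [hermann] are proved together. *)
Lemma hermann_systems n : (forall I d, exists E, @hermann n I 1 d E) ->
  forall I k d, exists E, @hermann n I k d E.
Proof.
move=> h1 I k d; elim: k => [|k [E1 IHk]].
  exists 1%N => A b _ _; split=> [f _|_].
    exists I, (fun i j => (i == j)%:R), f; split=> [l|i].
      by split=> // i; case: eqP; rewrite ?msize1 ?msize0.
    rewrite (bigD1 i) //= eqxx mulr1 big1 ?addr0 // => j /negbTE->.
    by rewrite mulr0.
  by exists (fun=> 0); split=> // i; rewrite msize0.
have [t ht] := bounded_gens n I E1.
have [E2 hE2] := h1 'I_t (E1 + d)%N.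
exists (E2 + E1)%N => A b bA bb.
have [IH1 IH2] := IHk A b (fun j i jk => bA j i (ltnW jk)) (fun j jk => bb j (ltnW jk)).
have [|W [W1 W2]] := ht (fun v => kernel k A v /\ forall i, (msize (v i) <= E1)%N).
  by move=> v [].
have kW l : kernel k A (W l).
  case: (W1 l) => [[]//|W0] j jk; rewrite big1 // => i _.
  by rewrite W0 mul0r.
have bW l i : (msize (W l i) <= E1)%N.
  by case: (W1 l) => [[_]|->] //; rewrite msize0.
pose a (_ : nat) l := \sum_i W l i * A k i.
have ba (j : nat) l : (j < 1)%N -> (msize (a j l) <= E1 + d)%N.
  by move=> _; apply: msize_sum_le => i _; apply: msizeM_leD; rewrite ?bA.
have sumW (h : 'I_t -> {mpoly K[n]}) j :
    \sum_i (\sum_l h l * W l i) * A j i = \sum_l h l * \sum_i W l i * A j i.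
  under eq_bigr do rewrite mulr_suml.
  rewrite exchange_big; apply: eq_bigr => l _; rewrite mulr_sumr.
  by apply: eq_bigr => i _; rewrite mulrA.
have kerW h j : (j < k)%N -> \sum_i (\sum_l h l * W l i) * A j i = 0.
  by move=> jk; rewrite sumW big1 // => l _; rewrite kW ?mulr0.
split=> [f kf|[f sf]].
  have [|h eh] := W2 f; first by apply: IH1 => j jk; apply/kf/ltnW.
  have b0 (j : nat) : (j < 1)%N ->
    (msize (0 : {mpoly K[n]}) <= E1 + d)%N by rewrite msize0.
  have [+ _] := hE2 a (fun=> 0) ba b0.
  case/(_ h) => [j _|T [V [h' [kV eh']]]].
    by rewrite /a -sumW -[RHS](kf k (leqnn _)); apply: eq_bigr => i _; rewrite eh.
  exists T, (fun l i => \sum_l' V l l' * W l' i), h'; split=> [l|i].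
    split=> [j|i].
      rewrite ltnS leq_eqVlt => /orP[/eqP->|]; last exact: kerW.
      by rewrite sumW; have [+ _] := kV l; move/(_ 0%N); apply.
    apply: msize_sum_le => l' _; apply: msizeM_leD => //.
    by have [_] := kV l.
  rewrite eh; under eq_bigr do rewrite eh' mulr_suml.
  rewrite exchange_big; apply: eq_bigr => l _; rewrite mulr_sumr.
  by apply: eq_bigr => l' _; rewrite mulrA.
have [|f0 [bf0 sf0]] := IH2; first by exists f => j jk; apply/sf/ltnW.
have [|h eh] := W2 (fun i => f i - f0 i).
  apply: IH1 => j jk; under eq_bigr do rewrite mulrBl.
  by rewrite sumrB (sf _ (ltnW jk)) (sf0 _ jk) subrr.
pose b' (_ : nat) := b k - \sum_i f0 i * A k i.
have bb' (j : nat) : (j < 1)%N -> (msize (b' j) <= E1 + d)%N.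
  move=> _; apply: msizeD_le; first by rewrite (leq_trans (bb _ _)) ?leq_addl.
  apply: msizeN_le; apply: msize_sum_le => i _; apply: msizeM_leD => //.
  exact: bA.
have [_] := hE2 a b' ba bb'; case.
  exists h => j _; rewrite /a -sumW /b' -(sf k (leqnn _)) -sumrB.
  by apply: eq_bigr => i _; rewrite -eh mulrBl.
move=> h0 [bh0 sh0]; exists (fun i => f0 i + \sum_l h0 l * W l i); split.
  move=> i; apply: msizeD_le; first by rewrite (leq_trans (bf0 i)) ?leq_addl.
  by apply: msize_sum_le => l _; apply: msizeM_leD.
move=> j jk1; under eq_bigr do rewrite mulrDl.
rewrite big_split /=; move: jk1; rewrite ltnS leq_eqVlt => /orP[/eqP->|jk].
  by rewrite sumW (sh0 0%N) // /b' addrC subrK.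
by rewrite kerW // addr0 sf0.
Qed.

Lemma hermann0 I d : exists E, @hermann 0 I 1 d E.
Proof.
have s1 (p : {mpoly K[0]}) : (msize p <= 1)%N.
  by apply/msize_leP => m; rewrite mdegE big_ord0.
exists 1%N => A b _ _; split=> [f kf|[f sf]].
  by apply: spanned_in; split.
by exists f.
Qed.

End Hermann.

Lemma size_mul_cancel (R : idomainType) (p q : {poly R}) d e :
  size q = e.+1 -> (size (p * q)%R <= d + e)%N -> (size p <= d)%N.
Proof.
move=> sq; have [->|p0] := eqVneq p 0; first by rewrite size_poly0.
have q0 : q != 0 by rewrite -size_poly_gt0 sq.
by rewrite size_mul // sq addnS leq_add2r.
Qed.

Section Lift.
Variables (K : fieldType) (n d : nat) (I : finType).
Implicit Types u : I * 'I_d -> {mpoly K[n]}.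

Definition lift_last u (i : I) : {mpoly K[n.+1]} :=
  mmulti (\sum_(k < d) u (i, k) *: 'X^k).

Lemma muni_lift u i : muni (lift_last u i) = \sum_(k < d) u (i, k) *: 'X^k.
Proof. by rewrite mmultiK. Qed.

Lemma lift_lastK (f : I -> {mpoly K[n.+1]}) i : (size (muni (f i)) <= d)%N ->
  lift_last (fun x => (muni (f x.1))`_x.2) i = f i.
Proof.
move=> sf; apply: muni_inj; rewrite muni_lift /=; apply/polyP => j.
rewrite coef_sum; have [jd|dj] := ltnP j d.
  rewrite (bigD1 (Ordinal jd)) //= coefZ coefXn eqxx mulr1 big1 ?addr0 //.
  move=> k nk; rewrite coefZ coefXn; case: eqP => [e|]; last by rewrite mulr0.
  by case/eqP: nk; apply: val_inj.
rewrite nth_default ?(leq_trans sf) // big1 // => k _; rewrite coefZ coefXn.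
by case: eqP => [e|]; rewrite ?mulr0 //; move: (ltn_ord k); rewrite -e ltnNge dj.
Qed.

Lemma size_lift u i : (size (muni (lift_last u i)) <= d)%N.
Proof.
rewrite muni_lift; apply/leq_sizeP => j dj; rewrite coef_sum big1 // => k _.
rewrite coefZ coefXn; case: eqP => [e|]; rewrite ?mulr0 //.
by move: (ltn_ord k); rewrite -e ltnNge dj.
Qed.

Lemma msize_lift u E i : (forall x, msize (u x) <= E)%N ->
  (msize (lift_last u i) <= E + d)%N.
Proof.
move=> bu; apply: msize_mmulti_le; last by rewrite -muni_lift size_lift.
move=> j; rewrite coef_sum; apply: msize_sum_le => k _.
by rewrite coefZ coefXn; case: eqP; rewrite ?mulr1 ?mulr0 ?msize0.
Qed.

Lemma lift_lin (T : finType) (h : T -> {mpoly K[n]})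
    (V : T -> I * 'I_d -> {mpoly K[n]}) u i :
  (forall x, u x = \sum_l h l * V l x) ->
  lift_last u i = \sum_l mwiden (h l) * lift_last (V l) i.
Proof.
move=> eu; apply: muni_inj; rewrite muni_lift raddf_sum /=.
under eq_bigr do rewrite eu scaler_suml.
rewrite exchange_big; apply: eq_bigr => l _; rewrite muniM muni_lift muni_mwiden.
by rewrite mulr_sumr; apply: eq_bigr => k _; rewrite mul_polyC scalerA.
Qed.

Definition lift_eqs (a : I -> {mpoly K[n.+1]}) (j : nat) (x : I * 'I_d) :
  {mpoly K[n]} := (muni (a x.1) * 'X^(x.2))`_j.

Lemma msize_lift_eqs a D j x : (forall i, msize (a i) <= D)%N ->
  (msize (lift_eqs a j x) <= D)%N.
Proof.
move=> ba; rewrite /lift_eqs coefMXn; case: ltnP => _; first by rewrite msize0.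
exact: leq_trans (msize_muni_coef _ _) (ba _).
Qed.

(** Both sides have degree less than [d + d] in the last variable, so an equation whose unknowns
    have degree less than [d] there becomes [d + d] equations with one variable less. *)
Lemma lift_eqsP a b u : (forall i, msize (a i) <= d)%N -> (msize b <= d)%N ->
  \sum_i lift_last u i * a i = b <->
  forall j, (j < d + d)%N -> \sum_x u x * lift_eqs a j x = (muni b)`_j.
Proof.
move=> ba bb.
have e j : (muni (\sum_i lift_last u i * a i))`_j = \sum_x u x * lift_eqs a j x.
  transitivity (\sum_i \sum_(k < d) u (i, k) * lift_eqs a j (i, k)).
    rewrite raddf_sum /= coef_sum; apply: eq_bigr => i _.
    rewrite muniM muni_lift mulr_suml coef_sum; apply: eq_bigr => k _.
    by rewrite /lift_eqs /= -scalerAl coefZ ['X^_ * _]mulrC.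
  by rewrite pair_bigA; apply: eq_bigr => -[].
split=> [<- j _|h]; first by rewrite e.
apply: muni_inj; apply/polyP => j.
apply: (etrans (e j)).
have [jd|dj] := ltnP j (d + d); first exact: h.
rewrite [RHS]nth_default; last first.
  by apply: leq_trans (size_muni _) (leq_trans bb (leq_trans _ dj)); rewrite leq_addr.
rewrite big1 // => x _; rewrite /lift_eqs coefMXn; case: ltnP => xj.
  by rewrite mulr0.
rewrite nth_default ?mulr0 //; apply: leq_trans (size_muni _) _.
apply: leq_trans (ba _) _; rewrite leq_subRL //.
by apply: leq_trans dj; rewrite leq_add2r ltnW.
Qed.

End Lift.

(** * Hermann's theorem: one equation, induction on the variables *)

Section HermannStep.
Variable K : numFieldType.

Section Monic.
Variables (n d delta : nat) (I : finType) (i0 : I).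
Variables (a : I -> {mpoly K[n.+1]}).
Hypotheses (ba : forall i, (msize (a i) <= d)%N) (dd : (delta < d)%N).
Hypothesis mon : monic_last delta (a i0).

(* Koszul relations: modulo them every coordinate but the one of index [i0] can
   be reduced modulo the monic [a i0], which bounds its degree in the last
   variable. *)
Let kos (j i : I) := a i0 * (i == j)%:R - a j * (i == i0)%:R.

Lemma kos_kernel j : \sum_i kos j i * a i = 0.
Proof.
under eq_bigr do rewrite mulrBl -!mulrA.
rewrite sumrB -!mulr_sumr; have sum1 k : \sum_i (i == k)%:R * a i = a k.
  rewrite (bigD1 k) //= eqxx mul1r big1 ?addr0 // => i /negbTE->.
  by rewrite mul0r.
by rewrite !sum1 mulrC subrr.
Qed.

Lemma msize_kos j i : (msize (kos j i) <= d)%N.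
Proof.
by apply: msizeD_le; rewrite ?mmeasureN; case: eqP => _;
  rewrite ?mulr1 ?mulr0 ?msize0.
Qed.

(** Koszul relations replace every coordinate but [i0] by its remainder modulo [a i0]. The equation
    then expresses [g i0 * a i0] through small terms, and monicity of [a i0] bounds the remaining
    coordinate. *)
Lemma kos_reduce b f : (msize b <= d)%N -> \sum_i f i * a i = b ->
  exists g, [/\ \sum_i g i * a i = b, forall i, (size (muni (g i)) <= d)%N &
    spanned (fun v => \sum_i v i * a i = 0 /\ forall i, (msize (v i) <= d)%N)
      (fun i => f i - g i)].
Proof.
move=> bb sf.
have /choice[q /choice[r qr]] j : exists q r,
    f j = q * a i0 + r /\ (size (muni r) <= delta)%N.
  by have [q [r [e s _]]] := mdiv_monic (f j) mon; exists q, r.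
pose c j := if j == i0 then 0 else q j.
pose g i := f i - \sum_j c j * kos j i.
have gr i : i != i0 -> g i = r i.
  move=> ni; rewrite /g (bigD1 i) //= big1 ?addr0.
    rewrite /c /kos eqxx (negbTE ni) mulr1 mulr0 subr0.
    by have [-> _] := qr i; rewrite addrAC subrr add0r.
  move=> j nj; rewrite /kos (negbTE ni) eq_sym (negbTE nj) !mulr0 subr0.
  by rewrite mulr0.
have sg : \sum_i g i * a i = b.
  under eq_bigr do rewrite mulrBl mulr_suml.
  rewrite sumrB sf exchange_big big1 ?subr0 // => j _ /=.
  by under eq_bigr do rewrite -mulrA; rewrite -mulr_sumr kos_kernel mulr0.
have fg i : \sum_j c j * kos j i = f i - g i by rewrite /g opprB addrC subrK.
clearbody g; exists g; split=> // [i|].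
  have [->|ni] := eqVneq i i0; last first.
    by rewrite gr //; case: (qr i) => _ h; apply: leq_trans h (ltnW dd).
  move=> {i}.
  have := sg; rewrite (bigD1 i0) //= => /(canRL (addrK _)) /(congr1 (@muni n K)).
  rewrite muniM => e.
  have s1 : (size (muni (g i0) * muni (a i0))%R <= d + delta)%N.
    rewrite e muniB; apply: leq_trans (size_polyD _ _) _; rewrite geq_max.
    rewrite (leq_trans (leq_trans (size_muni _) bb)) ?leq_addr // size_polyN.
    rewrite (raddf_sum (@muni n K)).
    apply: leq_trans (size_sum _ _ _) _; apply/bigmax_leqP => i ni.
    rewrite /= muniM gr //; apply: leq_trans (size_polyMleq _ _) _.
    have [_ h] := qr i; have h' := leq_trans (size_muni _) (ba i).
    by apply: leq_trans (leq_pred _) _; rewrite addnC leq_add.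
  exact: (size_mul_cancel (size_monic_last mon) s1).
apply: (@spanned_eq _ _ _ (fun i => \sum_j c j * kos j i)).
  by move=> i; rewrite fg.
apply: spanned_sum => j; apply: spannedZ; apply: spanned_in.
by split=> [|i]; [apply: kos_kernel | apply: msize_kos].
Qed.

End Monic.

Lemma hermann_monic n (I : finType) d :
  (forall I k d, exists E, @hermann K n I k d E) ->
  exists E, forall (a : I -> {mpoly K[n.+1]}) b i0 delta,
    (forall i, (msize (a i) <= d)%N) -> (msize b <= d)%N ->
    (delta < d)%N -> monic_last delta (a i0) ->
    (forall f, \sum_i f i * a i = 0 -> spanned
       (fun v => \sum_i v i * a i = 0 /\ forall i, (msize (v i) <= E)%N) f) /\
    ((exists f, \sum_i f i * a i = b) ->
     exists f, (forall i, (msize (f i) <= E)%N) /\ \sum_i f i * a i = b).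
Proof.
move=> hn; have [E1 hE1] := hn (I * 'I_d)%type (d + d)%N d.
exists (E1 + d)%N => a b i0 delta ba bb dd mon.
have bA j (x : I * 'I_d) : (j < d + d)%N -> (msize (lift_eqs a j x) <= d)%N.
  by move=> _; apply: msize_lift_eqs.
split=> [f kf|[f sf]].
  have [|g [sg zg fg]] := kos_reduce ba dd mon _ kf; first by rewrite msize0.
  apply: (@spanned_eq _ _ _ (fun i => (f i - g i) + g i)).
    by move=> i; rewrite subrK.
  apply: spannedD.
    apply: spanned_sub fg => v [h1 h2]; split=> // i.
    by apply: leq_trans (h2 i) _; rewrite leq_addl.
  have b0 (j : nat) : (j < d + d)%N -> (msize (0 : {mpoly K[n]}) <= d)%N.
    by rewrite msize0.
  have [+ _] := hE1 (lift_eqs a) (fun=> 0) bA b0.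
  pose u (x : I * 'I_d) := (muni (g x.1))`_x.2.
  have gu i : lift_last u i = g i by apply: lift_lastK.
  case/(_ u) => [j jd|T [V [h [kV eu]]]].
    have e0 : \sum_i lift_last u i * a i = 0.
      by rewrite -[RHS]sg; apply: eq_bigr => i _; rewrite gu.
    have z0 : (msize (0 : {mpoly K[n.+1]}) <= d)%N by rewrite msize0.
    by have [/(_ e0 j jd)-> _] := lift_eqsP u ba z0; rewrite muni0 coef0.
  exists T, (fun l => lift_last (V l)), (fun l => mwiden (h l)); split=> [l|i].
    have [k1 k2] := kV l; split=> [|i]; last exact: msize_lift.
    apply/lift_eqsP => // [|j jd]; first by rewrite msize0.
    by rewrite k1 // muni0 coef0.
  by rewrite -gu; apply: lift_lin.
have [g [sg zg _]] := kos_reduce ba dd mon bb sf.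
have bb' (j : nat) : (j < d + d)%N -> (msize (muni b)`_j <= d)%N.
  by move=> _; apply: leq_trans (msize_muni_coef _ _) bb.
have [_] := hE1 (lift_eqs a) (fun j => (muni b)`_j) bA bb'; case.
  exists (fun x : I * 'I_d => (muni (g x.1))`_x.2); apply/lift_eqsP => //.
  by rewrite -[RHS]sg; apply: eq_bigr => i _; rewrite lift_lastK.
move=> u [bu su]; exists (lift_last u); split; first by move=> i; apply: msize_lift.
exact/lift_eqsP.
Qed.

(** A shear makes a nonzero coefficient monic, and neither it nor its inverse raises degrees. If all
    coefficients vanish, unit vectors of size 1 generate the kernel, whence [E.+1]. *)
Lemma hermann_step n : (forall I k d, exists E, @hermann K n I k d E) ->
  forall I d, exists E, @hermann K n.+1 I 1 d E.
Proof.
move=> hn I d; have [E hE] := hermann_monic I d hn.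
exists E.+1 => A b bA bb; pose a := A 0%N.
have sumA f j : (j < 1)%N -> \sum_i f i * A j i = \sum_i f i * a i by case: j.
have [[i0 a0]|na] := pselect (exists i, a i != 0); last first.
  have a0 i : a i = 0 by apply/eqP/negPn/negP => h; apply: na; exists i.
  have sum0 f : \sum_i f i * a i = 0 by apply: big1 => i _; rewrite a0 mulr0.
  split=> [f _|[f sf]].
    exists I, (fun i j => (i == j)%:R), f; split=> [l|i].
      split=> [j j1|i]; first by rewrite sumA ?sum0.
      by case: eqP; rewrite ?msize1 ?msize0.
    rewrite (bigD1 i) //= eqxx mulr1 big1 ?addr0 // => j /negbTE->.
    by rewrite mulr0.
  exists (fun=> 0); split=> [i|j j1]; first by rewrite msize0.
  by rewrite -(sf j j1) !(sumA _ j j1) !sum0.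
have [l [l0 mon]] := shear_monic a0.
pose phi := shear l; pose psi := shear (shear_inv l).
have phiK : cancel phi psi by apply: shear_invK.
have psiK : cancel psi phi by apply: shearK.
have sa0 : (msize (a i0)).-1.+1 = msize (a i0).
  by rewrite prednK // lt0n mmeasure_poly_eq0.
have bphi i : (msize (phi (a i)) <= d)%N.
  by apply: leq_trans (msize_shear _ _) (bA _ _ _).
have [|||hk hs] := hE (phi \o a) (phi (b 0%N)) i0 (msize (a i0)).-1 bphi.
- by apply: leq_trans (msize_shear _ _) (bb _ _).
- by rewrite sa0; apply: bA.
- by split; rewrite // sa0 msize_shear.
have phiS f : phi (\sum_i f i * a i) = \sum_i phi (f i) * phi (a i).
  by rewrite /phi rmorph_sum; apply: eq_bigr => i _; rewrite rmorphM.
have psiS f : psi (\sum_i f i * phi (a i)) = \sum_i psi (f i) * a i.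
  rewrite /psi rmorph_sum; apply: eq_bigr => i _.
  by rewrite rmorphM /=; congr (_ * _); apply: phiK.
split=> [f kf|[f sf]].
  have [|T [W [h [kW e]]]] := hk (phi \o f).
    by rewrite /= -phiS -(sumA f 0%N isT) (kf 0%N isT) /phi rmorph0.
  exists T, (fun l => psi \o W l), (psi \o h); split=> [t|i] /=.
    have [k1 k2] := kW t; split=> [j j1|i]; last first.
      by apply: leq_trans (msize_shear _ _) (leqW (k2 i)).
    by rewrite (sumA _ j j1) -psiS k1 /psi rmorph0.
  rewrite -[LHS]phiK -[phi _]/((phi \o f) i) e /psi rmorph_sum; apply: eq_bigr => t _.
  by rewrite rmorphM.
have [|g [bg sg]] := hs.
  by exists (phi \o f); rewrite /= -phiS -(sumA f 0%N isT) (sf 0%N isT).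
exists (psi \o g); split=> [i|j j1] /=.
  by apply: leq_trans (msize_shear _ _) (leqW (bg i)).
by rewrite (sumA _ j j1) -psiS sg phiK; case: j j1.
Qed.

Theorem hermann_bound n I k d : exists E, @hermann K n I k d E.
Proof.
elim: n => [|n IHn] in I k d *; apply: hermann_systems => {}I {}d.
  exact: hermann0.
exact: hermann_step.
Qed.

End HermannStep.

(** * The trace form of a finite algebra *)

Section TraceOfMatrix.
Variable F : fieldType.

(** By the factor theorem over the ring of matrices, [g] times the identity is a multiple of the
    characteristic matrix; take determinants. *)
Lemma horner_mx0_char n (X : 'M[F]_n.+1) (g : {poly F}) :
  horner_mx X g = 0 -> char_poly X %| g ^+ n.+1.
Proof.
have [phi [[psi phiK psiK] phiZ phiC _]] := mx_poly_ring_isom F n.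
move=> gX; have /factor_theorem[q eq] : root (map_poly scalar_mx g) X.
  by apply/rootP.
have e : g%:M = psi q * char_poly_mx X.
  apply: (can_inj phiK); rewrite phiZ rmorphM psiK eq; congr (_ * _).
  by rewrite rmorphB phiC phiZ map_polyX.
have := congr1 determinant e.
by rewrite det_scalar det_mulmx => ->; apply: dvdp_mull.
Qed.

Lemma dvdp_irreducible_exp (g p : {poly F}) k : irreducible_poly g ->
  p %| g ^+ k -> exists r, p %= g ^+ r.
Proof.
move=> irr; elim: k => [|k IHk] in p *.
  by rewrite expr0 dvdp1 size_poly_eq1 => p1; exists 0%N.
move=> pg; have [cop|ncop] := boolP (coprimep g p).
  by apply: IHk; move: pg; rewrite exprS Gauss_dvdpr // coprimep_sym.
have gp : g %| p.
  have := irr (gcdp g p) ncop (dvdp_gcdl _ _).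
  by move/eqp_dvdl <-; apply: dvdp_gcdr.
case/dvdpP: gp => q eq; have g0 := irredp_neq0 irr.
have [|r qr] := IHk q; first by move: pg; rewrite eq exprSr dvdp_mul2r.
by exists r.+1; rewrite eq exprSr eqp_mul2r.
Qed.

Lemma coef_monicM (p q : {poly F}) a b : p \is monic -> q \is monic ->
  size p = a.+2 -> size q = b.+2 ->
  (p * q)`_(a + b).+1 = p`_a + q`_b.
Proof.
move=> mp mq sp sq; rewrite coefM.
have lp : p`_a.+1 = 1 by have /monicP := mp; rewrite lead_coefE sp.
have lq : q`_b.+1 = 1 by have /monicP := mq; rewrite lead_coefE sq.
have la : (a < (a + b).+2)%N by rewrite ltnS leqW ?leq_addr.
have la1 : (a.+1 < (a + b).+2)%N by rewrite !ltnS leq_addr.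
rewrite (bigD1 (Ordinal la)) //= (bigD1 (Ordinal la1)) //=; last first.
  by rewrite -val_eqE /= gtn_eqF.
have -> : ((a + b).+1 - a = b.+1)%N by lia.
have -> : ((a + b).+1 - a.+1 = b)%N by lia.
rewrite lq mulr1 lp mul1r big1 ?addr0 // => i /andP[].
rewrite -!val_eqE /= => ni ni1; have [ia|ai] := ltnP i a.
  by rewrite (@nth_default _ 0 q) ?mulr0 // sq; lia.
by rewrite (@nth_default _ 0 p) ?mul0r // sp; lia.
Qed.

Lemma coef_monicX (g : {poly F}) d r : g \is monic -> size g = d.+2 ->
  size (g ^+ r.+1) = (r.+1 * d.+1).+1 /\
  (g ^+ r.+1)`_(r.+1 * d.+1).-1 = g`_d *+ r.+1.
Proof.
move=> mg sg; elim: r => [|r [IHs IHc]]; first by rewrite expr1 mul1n sg.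
have mgr : g ^+ r.+1 \is monic by rewrite monic_exp.
have e : (r.+1 * d.+1)%N = (r.+1 * d.+1).-1.+1 by [].
have sz : size (g ^+ r.+2) = (r.+2 * d.+1).+1.
  by rewrite exprS size_monicM ?monic_neq0 // sg IHs addSn /= mulSn addnS.
split=> //; have -> : (r.+2 * d.+1).-1 = (d + (r.+1 * d.+1).-1).+1 by lia.
by rewrite exprS (@coef_monicM g _ d (r.+1 * d.+1).-1) // IHc [RHS]mulrS.
Qed.

Hypothesis charF : forall n, n.+1%:R != 0 :> F.

(** Both characteristic polynomials are powers of [g], so the trace divided by the dimension is
    determined by the degree and the second coefficient of [g]. *)
Lemma trace_irreducible m k (X : 'M[F]_m.+1) (Y : 'M[F]_k.+1) (g : {poly F}) :
  irreducible_poly g -> horner_mx X g = 0 -> horner_mx Y g = 0 ->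
  \tr X *+ k.+1 = \tr Y *+ m.+1.
Proof.
move=> irr gX gY; have g0 := irredp_neq0 irr.
have lg0 : lead_coef g != 0 by rewrite lead_coef_eq0.
wlog mg : g irr gX gY g0 lg0 / g \is monic => [h|].
  apply: (h ((lead_coef g)^-1 *: g)).
  - split=> [|q sq]; first by rewrite size_scale ?invr_eq0 //; case: irr.
    rewrite dvdpZr ?invr_eq0 // => /(irr _ sq) /eqp_trans; apply.
    by rewrite eqp_sym eqp_scale ?invr_eq0.
  - by rewrite horner_mxZ gX scaler0.
  - by rewrite horner_mxZ gY scaler0.
  - by rewrite scaler_eq0 invr_eq0 negb_or lg0.
  - by rewrite lead_coefZ mulVf ?oner_eq0.
  - by rewrite monicE lead_coefZ mulVf.
have [d sg] : exists d, size g = d.+2.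
  by case: irr; case: (size g) => [|[|d]] // _ _; exists d.
have key n (Z : 'M[F]_n.+1) : horner_mx Z g = 0 ->
    \tr Z *+ d.+1 = - (g`_d *+ n.+1).
  move=> /horner_mx0_char /(dvdp_irreducible_exp irr)[r].
  have mgr : g ^+ r \is monic by rewrite monic_exp.
  rewrite eqp_monic ?char_poly_monic // => /eqP e.
  have sc := size_char_poly Z; rewrite e in sc.
  case: r => [|r] in mgr e sc; first by rewrite expr0 size_poly1 in sc.
  have [sz cf] := coef_monicX r mg sg.
  have {sz}sc : (r.+1 * d.+1 = n.+1)%N by apply: succn_inj; rewrite -sz.
  have := char_poly_trace Z (ltn0Sn _); rewrite e.
  have -> : (g ^+ r.+1)`_n.+1.-1 = g`_d *+ r.+1 by rewrite -cf sc.
  by move=> tZ; rewrite -[\tr Z]opprK -tZ mulNrn -mulrnA sc.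
have : (\tr X *+ k.+1) *+ d.+1 = (\tr Y *+ m.+1) *+ d.+1.
  by rewrite [LHS]mulrnAC (key _ _ gX) [RHS]mulrnAC (key _ _ gY) !mulNrn -!mulrnA mulnC.
by rewrite -mulr_natr -[RHS]mulr_natr => /(mulIf (charF d)).
Qed.

End TraceOfMatrix.

Section CoordinatesDomain.
Variables (F : fieldType) (R : comNzRingType) (m : nat).
Hypothesis charF : forall n, n.+1%:R != 0 :> F.
Variables (co : R -> 'rV[F]_m.+1) (N : R -> 'M[F]_m.+1) (e : 'I_m.+1 -> R).
Hypothesis coM : forall f g, co (f * g) = co f *m N g.
Hypothesis coe : forall i, co (e i) = delta_mx 0 i.

Let row_mult i g : row i (N g) = co (e i * g).
Proof. by rewrite coM coe -rowE. Qed.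

Let multM f g : N (f * g) = N f * N g.
Proof.
apply/row_matrixP => i; rewrite row_mult mulrA coM -row_mult.
by rewrite -row_mul.
Qed.

Let multE f : N f = \sum_i co f 0 i *: N (e i).
Proof.
apply/row_matrixP => j; rewrite row_mult mulrC coM raddf_sum /=.
rewrite {1}(row_sum_delta (co f)) mulmx_suml; apply: eq_bigr => i _.
by rewrite -scalemxAl -rowE linearZ /= !row_mult mulrC.
Qed.

Definition trace_form := \matrix_(i, j) \tr (N (e i * e j)).

Let trace_mulE f h : \tr (N (f * h)) = \sum_i co f 0 i * \tr (N (e i * h)).
Proof.
rewrite multM multE mulr_suml raddf_sum /=; apply: eq_bigr => i _.
by rewrite -scalerAl mxtraceZ -multM.
Qed.

Let trace_formE f j : (co f *m trace_form) 0 j = \tr (N (f * e j)).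
Proof. by rewrite mxE trace_mulE; apply: eq_bigr => i _; rewrite mxE. Qed.

Let radical_trace f : co f *m trace_form = 0 -> forall h, \tr (N (f * h)) = 0.
Proof.
move=> f0 h; rewrite mulrC trace_mulE big1 // => i _.
by rewrite mulrC [e i * f]mulrC -trace_formE f0 mxE mul0r.
Qed.

(** Write [g = g(0) + q X]. The trace of any polynomial in [N f] times a positive power of [N f]
    vanishes, so [g(N f) = 0] shows that the dimension times [g(0)] is zero. Then [g] is
    proportional to [X] and [N f = 0]. *)
Let radical_irreducible f g : irreducible_poly g -> horner_mx (N f) g = 0 ->
  co f *m trace_form = 0 -> co f = 0.
Proof.
move=> irr gf /radical_trace tf0; apply/eqP; apply: contraT => cf0.
have Nf0 : N f != 0.
  by apply: contra cf0 => /eqP Nf0; rewrite -[f]mul1r coM Nf0 mulmx0.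
have trq q k : \tr (horner_mx (N f) q *m N (f ^+ k.+1)) = 0.
  elim/poly_ind: q k => [|q c IHq] k; first by rewrite rmorph0 mul0mx mxtrace0.
  rewrite rmorphD rmorphM /= horner_mx_X horner_mx_C mulmxDl mxtraceD.
  rewrite -mulmxA [N f *m _](_ : _ = N (f ^+ k.+2)) ?IHq ?add0r.
    by rewrite mul_scalar_mx mxtraceZ exprS tf0 mulr0.
  by rewrite [in RHS]exprS multM.
have /factor_theorem[q eg] : root (g - g.[0]%:P) 0.
  by apply/rootP; rewrite hornerD hornerN hornerC subrr.
have [g0|g0] := eqVneq g.[0] 0.
  have : 'X %= g.
    apply: irr; first by rewrite size_polyX.
    by apply/dvdpP; exists q; rewrite -[LHS](subrK g.[0]%:P) eg g0 polyC0 addr0 subr0.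
  case/eqpP => -[c1 c2] /= /andP[c10 _] /(congr1 (horner_mx (N f))).
  rewrite !horner_mxZ horner_mx_X gf scaler0 => /eqP.
  by rewrite scaler_eq0 (negbTE c10) (negbTE Nf0).
have := congr1 (fun p => \tr (horner_mx (N f) p)) eg.
rewrite rmorphB rmorphM /= gf sub0r horner_mx_C polyC0 subr0 horner_mx_X.
have -> : horner_mx (N f) q * N f = horner_mx (N f) q *m N (f ^+ 1) by rewrite expr1.
rewrite trq raddfN /= mxtrace_scalar => /eqP; rewrite oppr_eq0 -mulr_natr.
by rewrite mulf_eq0 (negbTE g0) (negbTE (charF m)).
Qed.

(* If [c b = 0] with [c <> 0], compare the trace of [x] on the whole algebra
   with its trace on the ideal generated by [c]: when every basis element has
   an irreducible minimal polynomial the two are proportional. They vanish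
   together for [x] in the ideal of [b], which therefore lies in the radical
   of the trace form. *)
Lemma coordinates_domain :
  (forall i, exists2 g, irreducible_poly g & horner_mx (N (e i)) g = 0) ->
  (forall v : 'rV_m.+1, v != 0 -> v *m trace_form = 0 ->
     exists f, [/\ co f != 0, co f *m trace_form = 0
       & exists2 g, irreducible_poly g & horner_mx (N f) g = 0]) ->
  forall c b, co (c * b) = 0 -> co c = 0 \/ co b = 0.
Proof.
move=> irr_e rad c b cb0; have [->|c0] := eqVneq (co c) 0; first by left.
right; have Nc0 : N c != 0.
  by apply: contra c0 => /eqP Nc0; rewrite -[c]mul1r coM Nc0 mulmx0.
(* The row space of [N c] is the ideal generated by [c], and [conjmx U] restricts multiplications to
   it. *)
have : exists r (U : 'M[F]_(r, m.+1)), row_free U /\ (U :=: N c)%MS.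
  by exists (\rank (N c)), (row_base (N c)); split;
    [apply: row_base_free | apply: eq_row_base].
case=> -[|k] [U [freeU eqU]].
  move: eqU; rewrite [U]flatmx0 => eqU.
  by case/eqP: Nc0; apply/eqP; rewrite -submx0 -eqU sub0mx.
have stabU f : stablemx U (N f).
  rewrite (eqmxMr _ eqU) [N c *m N f](_ : _ = N f *m N c).
    by apply: submx_trans (submxMl _ _) _; rewrite eqU.
  by rewrite -[LHS]multM mulrC multM.
have trU f : \tr (N f) *+ k.+1 = \tr (conjmx U (N f)) *+ m.+1.
  rewrite {2}(multE f) /conjmx mulmx_sumr mulmx_suml.
  rewrite (multE f) !raddf_sum /= -?sumrMnl; apply: eq_bigr => i _.
  rewrite -scalemxAr -scalemxAl !mxtraceZ -!mulrnAr; congr (_ * _).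
  have [g irr_g g0] := irr_e i.
  by apply: (trace_irreducible charF irr_g g0); rewrite horner_mx_conj // g0 conjmx0.
have /eqP : co b *m trace_form = 0.
  apply/rowP => j; rewrite trace_formE mxE.
  have UN0 : conjmx U (N (b * e j)) = 0.
    have /submxP[D ->] : (U <= N c)%MS by rewrite eqU.
    rewrite /conjmx -[D *m N c *m N _]mulmxA -[N c *m N _]multM mulrA.
    suff -> : N (c * b * e j) = 0 by rewrite mulmx0 mul0mx.
    by apply/row_matrixP => i; rewrite row_mult row0 mulrCA coM cb0 mul0mx.
  have := trU (b * e j); rewrite UN0 mxtrace0 mul0rn => /eqP.
  by rewrite -mulr_natr mulf_eq0 (negbTE (charF k)) orbF => /eqP.
have [//|b0 /eqP bt0] := eqVneq (co b) 0.
have [f [f0 ft0 [g irr_g gf]]] := rad _ b0 bt0.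
by rewrite (radical_irreducible irr_g gf ft0) eqxx in f0.
Qed.

End CoordinatesDomain.

(** * Ideals and presentations over a polynomial subring *)

Lemma bounded_choice (P : nat -> nat -> Prop) m :
  (forall i, exists E, P i E) ->
  (forall i E E', (E <= E')%N -> P i E -> P i E') ->
  exists E, forall i, (i <= m)%N -> P i E.
Proof.
move=> /choice[E hE] mono; exists (\max_(i < m.+1) E i)%N => i im.
apply: (mono i _ _ _ (hE i)).
exact: (@leq_bigmax _ (fun i : 'I_m.+1 => E i) (Ordinal (im : (i < m.+1)%N))).
Qed.

Lemma big_option (V : nmodType) (T : finType) (F : option T -> V) :
  \sum_o F o = F None + \sum_l F (Some l).
Proof.
rewrite (bigD1 None) //= (reindex_omap Some id) /=; last by case.
by congr (_ + _); apply: eq_bigl => l; rewrite eqxx.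
Qed.

Section HermannFin.
Variable K : numFieldType.

Lemma hermann_fin n (I J : finType) d : exists E,
  forall (A : J -> I -> {mpoly K[n]}) (b : J -> {mpoly K[n]}),
  (forall j i, (msize (A j i) <= d)%N) -> (forall j, (msize (b j) <= d)%N) ->
  (forall f, (forall j, \sum_i f i * A j i = 0) ->
     spanned (fun v => (forall j, \sum_i v i * A j i = 0) /\
       forall i, (msize (v i) <= E)%N) f) /\
  ((exists f, forall j, \sum_i f i * A j i = b j) ->
   exists f, (forall i, (msize (f i) <= E)%N) /\
     forall j, \sum_i f i * A j i = b j).
Proof.
have [E hE] := hermann_bound K n I #|J| d; exists E => A b bA bb.
pose A' j := if @insub _ _ 'I_#|J| j is Some o then A (enum_val o) else fun=> 0.
pose b' j := if @insub _ _ 'I_#|J| j is Some o then b (enum_val o) else 0.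
have A'E j : A' (enum_rank j) = A j.
  by rewrite /A' valK enum_rankK.
have b'E j : b' (enum_rank j) = b j.
  by rewrite /b' valK enum_rankK.
have allJ (Q : nat -> Prop) : (forall j : J, Q (enum_rank j)) ->
    forall j, (j < #|J|)%N -> Q j.
  move=> h j jJ; have := h (enum_val (Ordinal jJ)).
  by rewrite enum_valK.
have bA' j i : (j < #|J|)%N -> (msize (A' j i) <= d)%N.
  move: j; apply: (allJ (fun j => is_true (msize (A' j i) <= d)%N)) => j.
  by rewrite A'E.
have bb' j : (j < #|J|)%N -> (msize (b' j) <= d)%N.
  move: j; apply: (allJ (fun j => is_true (msize (b' j) <= d)%N)) => j.
  by rewrite b'E.
have [h1 h2] := hE A' b' bA' bb'.
have solE f : (forall j, (j < #|J|)%N -> \sum_i f i * A' j i = b' j) <->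
    forall j, \sum_i f i * A j i = b j.
  split=> [h j|h]; first by rewrite -A'E -b'E; apply: h; apply: ltn_ord.
  by apply: (allJ (fun j => \sum_i f i * A' j i = b' j)) => j; rewrite A'E b'E.
have kerE f : kernel #|J| A' f <-> forall j, \sum_i f i * A j i = 0.
  split=> [h j|h]; first by rewrite -A'E; apply: h; apply: ltn_ord.
  by apply: (allJ (fun j => \sum_i f i * A' j i = 0)) => j; rewrite A'E.
split=> [f /kerE/h1|[f /solE sf]].
  by apply: spanned_sub => v [/kerE].
by have [|g [bg /solE sg]] := h2; [exists f | exists g].
Qed.

End HermannFin.

Section Ideals.
Variables (R : comNzRingType).

Definition is_ideal (I : R -> Prop) : Prop :=
  [/\ I 0, forall p q, I p -> I q -> I (p + q) & forall a p, I p -> I (a * p)].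

Definition mem_ideal (T : finType) (g : T -> R) (p : R) : Prop :=
  exists h : T -> R, p = \sum_l h l * g l.

Lemma mem_ideal_is_ideal T g : is_ideal (@mem_ideal T g).
Proof.
split=> [|p q [h ->] [h' ->]|a p [h ->]].
- by exists (fun=> 0); rewrite big1 // => l _; rewrite mul0r.
- exists (fun l => h l + h' l); rewrite -big_split; apply: eq_bigr => l _.
  by rewrite mulrDl.
- exists (fun l => a * h l); rewrite mulr_sumr; apply: eq_bigr => l _.
  by rewrite mulrA.
Qed.

Lemma mem_ideal_gen (T : finType) (g : T -> R) l : mem_ideal g (g l).
Proof.
exists (fun k => (k == l)%:R); rewrite (bigD1 l) //= eqxx mul1r big1 ?addr0 //.
by move=> k /negbTE->; rewrite mul0r.
Qed.

Variables (I : R -> Prop) (idI : is_ideal I).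

Lemma ideal0 : I 0. Proof. by case: idI. Qed.

Lemma idealD p q : I p -> I q -> I (p + q).
Proof. by case: idI => _ h _; apply: h. Qed.

Lemma idealMl a p : I p -> I (a * p).
Proof. by case: idI => _ _; apply. Qed.

Lemma idealMr a p : I p -> I (p * a).
Proof. by rewrite mulrC; apply: idealMl. Qed.

Lemma idealN p : I p -> I (- p).
Proof. by rewrite -mulN1r; apply: idealMl. Qed.

Lemma idealB p q : I p -> I q -> I (p - q).
Proof. by move=> Ip Iq; apply: idealD => //; apply: idealN. Qed.

Lemma ideal_sum (J : Type) (r : seq J) (P : pred J) F :
  (forall j, P j -> I (F j)) -> I (\sum_(j <- r | P j) F j).
Proof. by move=> h; apply: big_ind => //; [apply: ideal0 | apply: idealD]. Qed.

Lemma ideal_eqmod p q : I (p - q) -> I p <-> I q.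
Proof.
move=> pq; split=> [Ip|Iq]; last by rewrite -[p](subrK q); apply: idealD.
by rewrite -[q](subKr p); apply: idealB.
Qed.

End Ideals.

Section Stage.
Variables (K : numFieldType) (n : nat).
Local Notation R := {mpoly K[n]}.

(* The quotient by [I] is generated over the polynomial subring [psi] by [e],
   with a degree control, and the relations among the [e x] are generated in
   degree at most [E]. *)
Definition presentation (I : R -> Prop) j (X : finType) E
    (psi : {rmorphism {mpoly K[j]} -> R}) (e : X -> R) : Prop :=
  [/\ forall p, (msize (psi p) <= msize p)%N, forall x, (msize (e x) <= E)%N,
    forall f, exists c : X -> {mpoly K[j]},
      I (f - \sum_x psi (c x) * e x) /\ forall x, (msize (c x) <= msize f)%N
    & forall c : X -> {mpoly K[j]}, I (\sum_x psi (c x) * e x) ->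
      spanned (fun v => I (\sum_x psi (v x) * e x) /\
                 forall x, (msize (v x) <= E)%N) c].

(** Expressed through the [e x], a relation among the [f y] says that a matrix with bounded entries
    sends [c] into the module generated by the relations [W l]. The pairs of [c] and cofactors form
    the kernel of a linear system, and its small generators project to small relations. *)
Lemma relations_bound j (X Y : finType) E d : exists E',
  forall (I : R -> Prop) psi (e : X -> R), is_ideal I ->
  presentation I E psi e ->
  forall f : Y -> R, (forall y, (msize (f y) <= d)%N) ->
  forall c : Y -> {mpoly K[j]}, I (\sum_y psi (c y) * f y) ->
  spanned (fun v => I (\sum_y psi (v y) * f y) /\
             forall y, (msize (v y) <= E')%N) c.
Proof.
have [t ht] := bounded_gens K j X E.
have [E' hE'] := hermann_fin K j (Y + 'I_t)%type X (E + d).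
exists E' => I psi e idI [bpsi be red rel] f bf c cf.
have [|W [W1 W2]] := ht (fun v => I (\sum_x psi (v x) * e x) /\
                 forall x, (msize (v x) <= E)%N); first by move=> v [].
have bW l x : (msize (W l x) <= E)%N.
  by case: (W1 l) => [[_]|->] //; rewrite msize0.
have rW l : I (\sum_x psi (W l x) * e x).
  case: (W1 l) => [[]//|W0]; apply: ideal_sum => // x _.
  by rewrite W0 rmorph0 mul0r; apply: ideal0.
have /choice[a ha] y := red (f y).
pose A x (z : Y + 'I_t) :=
  match z with inl y => a y x | inr l => - W l x end.
have bA x z : (msize (A x z) <= E + d)%N.
  case: z => [y|l] /=; last by rewrite mmeasureN (leq_trans (bW _ _)) ?leq_addr.
  have [_ /(_ x)] := ha y; move/leq_trans; apply.
  by rewrite (leq_trans (bf y)) ?leq_addl.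
have redE (v : Y -> {mpoly K[j]}) : I (\sum_y psi (v y) * f y -
    \sum_x psi (\sum_y v y * a y x) * e x).
  have -> : \sum_x psi (\sum_y v y * a y x) * e x =
      \sum_y psi (v y) * \sum_x psi (a y x) * e x.
    under eq_bigr do rewrite rmorph_sum mulr_suml.
    rewrite exchange_big; apply: eq_bigr => y _; rewrite mulr_sumr.
    by apply: eq_bigr => x _; rewrite rmorphM mulrA.
  rewrite -sumrB; apply: ideal_sum => // y _; rewrite -mulrBr.
  by apply: idealMl => //; case: (ha y).
have [h eh] : exists h : 'I_t -> _, forall x, \sum_y c y * a y x = \sum_l h l * W l x.
  by apply/W2/rel; apply/(ideal_eqmod idI (redE c)).
have b0 (x : X) : (msize (0 : {mpoly K[j]}) <= E + d)%N by rewrite msize0.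
have [+ _] := hE' A (fun=> 0) bA b0.
pose u (z : Y + 'I_t) := match z with inl y => c y | inr l => h l end.
have sumA (v : Y + 'I_t -> {mpoly K[j]}) x : \sum_z v z * A x z =
    \sum_y v (inl y) * a y x - \sum_l v (inr l) * W l x.
  rewrite big_sumType /= -sumrN; congr (_ + _).
  by apply: eq_bigr => l _; rewrite mulrN.
case/(_ u) => [x|T [V [k [kV eV]]]]; first by rewrite sumA /= eh subrr.
exists T, (fun l y => V l (inl y)), k; split=> [l|y]; last by rewrite -(eV (inl y)).
have [k1 k2] := kV l; split=> [|y]; last exact: k2.
apply/(ideal_eqmod idI (redE (fun y => V l (inl y)))).
have {}k1 x : \sum_y V l (inl y) * a y x = \sum_l' V l (inr l') * W l' x.
  by apply/eqP; rewrite -subr_eq0 -sumA k1.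
under eq_bigr do rewrite k1 rmorph_sum mulr_suml.
rewrite exchange_big; apply: ideal_sum => // l' _.
under eq_bigr do rewrite rmorphM -mulrA.
by rewrite -mulr_sumr; apply: idealMl.
Qed.

End Stage.

Section StageStep.
Variables (K : numFieldType) (n : nat).
Local Notation R := {mpoly K[n]}.

Lemma lift_lastE j L (X : finType) (u : X * 'I_L -> {mpoly K[j]}) x :
  lift_last u x = \sum_(a < L) mwiden (u (x, a)) * 'X_ord_max ^+ a.
Proof.
apply: muni_inj; rewrite muni_lift raddf_sum; apply: eq_bigr => a _.
by rewrite /= muniM rmorphXn /= muniX_max muni_mwiden mul_polyC.
Qed.

Lemma monic_last_shift j d L (p : {mpoly K[j.+1]}) : monic_last d p ->
  (d <= L)%N -> monic_last L (p * 'X_ord_max ^+ (L - d)).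
Proof.
move=> [pd [c c0 ec]] dL; split; last first.
  exists c => //; rewrite muniM rmorphXn /= muniX_max coefMXn.
  by rewrite ltnNge leq_subr subKn.
have -> : L.+1 = (d + (L - d)).+1 by rewrite subnKC.
apply: msizeM_deg => //; rewrite mpolyXn msizeX.
by rewrite mdegMn mdeg1 mul1n.
Qed.

Lemma monic_last_multiple0 j L (p q : {mpoly K[j.+1]}) : monic_last L p ->
  (size (muni (q * p)) <= L)%N -> q * p = 0.
Proof.
move=> /size_monic_last sp; rewrite muniM => h.
have [->|q0] := eqVneq q 0; first by rewrite mul0r.
have : (size (muni q) <= 0)%N by apply: (size_mul_cancel sp); rewrite add0n.
by rewrite leqn0 size_poly_eq0 muni_eq0 (negbTE q0).
Qed.

(** Modulo a monic multiple of the sheared [p], powers of the last variable below [L] suffice; they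
    multiply the old generators. The old generating relations, multiplied by the same powers and
    reduced, generate the new relations. *)
Lemma presentation_step j (X : finType) E L : exists E',
  forall (I : R -> Prop) (psi : {rmorphism {mpoly K[j.+1]} -> R}) (e : X -> R),
  is_ideal I -> presentation I E psi e ->
  forall p : {mpoly K[j.+1]}, p != 0 -> (msize p <= L)%N -> I (psi p) ->
  exists (psi' : {rmorphism {mpoly K[j]} -> R}) (e' : X * 'I_L -> R),
    presentation I E' psi' e'.
Proof.
exists (E + (1 + L * 2))%N => I psi e idI [bpsi be red rel] p0 p00 p0L Ip0.
have [l [l0 mon0]] := shear_monic p00.
set d := (msize p0).-1 in mon0.
have sd : msize p0 = d.+1 by rewrite prednK // lt0n mmeasure_poly_eq0.
have dL : (d < L)%N by rewrite -sd.
have mp1 : monic_last d (shear l p0).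
  by split=> //; rewrite -sd; apply: msize_shear.
(* The added power makes the degree in the last variable exactly [L], so the new index set
   [X * 'I_L] does not depend on [p0]. *)
pose p := shear l p0 * 'X_ord_max ^+ (L - d).
have mp : monic_last L p by apply: monic_last_shift => //; apply: ltnW.
pose psi1 : {rmorphism _ -> R} := psi \o shear (shear_inv l).
have psi1E c : psi1 (shear l c) = psi c by rewrite /= shear_invK.
have bpsi1 c : (msize (psi1 c) <= msize c)%N.
  by apply: leq_trans (bpsi _) (msize_shear _ _).
have Ip c : I (psi1 (c * p)).
  rewrite rmorphM; apply: idealMl => //; rewrite /p rmorphM; apply: idealMr => //.
  by rewrite psi1E.
pose psi' : {rmorphism _ -> R} := psi1 \o @mwiden j K.
pose e' (z : X * 'I_L) := e z.1 * psi1 'X_ord_max ^+ z.2.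
have liftS (u : X * 'I_L -> {mpoly K[j]}) :
    \sum_x psi1 (lift_last u x) * e x = \sum_z psi' (u z) * e' z.
  transitivity (\sum_x \sum_(a < L) psi' (u (x, a)) * e' (x, a)); last first.
    by rewrite pair_bigA; apply: eq_bigr => -[].
  apply: eq_bigr => x _; rewrite lift_lastE rmorph_sum mulr_suml.
  apply: eq_bigr => a _; rewrite rmorphM rmorphXn /e' -mulrA.
  by congr (_ * _); rewrite mulrC.
have modp (c : X -> {mpoly K[j.+1]}) : exists r : X -> {mpoly K[j.+1]},
    [/\ I (\sum_x psi1 (c x) * e x - \sum_x psi1 (r x) * e x),
     forall x, (size (muni (r x)) <= L)%N, forall x, (msize (r x) <= msize (c x))%N
     & forall x, exists q, c x = q * p + r x].
  have /choice[r hr] x : exists r, [/\ exists q, c x = q * p + r,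
      (size (muni r) <= L)%N & (msize r <= msize (c x))%N].
    by have [q [r [h1 h2 h3]]] := mdiv_monic (c x) mp; exists r; split=> //; exists q.
  exists r; split=> [|x|x|x]; try by case: (hr x).
  rewrite -sumrB; apply: ideal_sum => // x _; rewrite -mulrBl -rmorphB.
  apply: idealMr => //; have [[q ->] _ _] := hr x.
  by rewrite addrK; apply: Ip.
exists psi', e'; split=> [c|z|f|c cI].
- by apply: leq_trans (bpsi1 _) _; apply: msize_mwiden.
- apply: msizeM_leD; first exact: be.
  apply: leq_trans (msizeX_le _ (_ : msize _ <= 2)%N) _.
    by apply: leq_trans (bpsi1 _) _; rewrite msizeX mdeg1.
  by rewrite leq_add2l leq_mul2r ltnW ?orbT.
- have [c [cI bc]] := red f; have [r [rI sr br _]] := modp (shear l \o c).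
  exists (fun z : X * 'I_L => (muni (r z.1))`_z.2); split=> [|z]; last first.
    apply: leq_trans (msize_muni_coef _ _) (leq_trans (br _) _).
    by apply: leq_trans (msize_shear _ _) (bc _).
  rewrite -liftS; under eq_bigr do rewrite lift_lastK //.
  have -> : f - \sum_x psi1 (r x) * e x = (f - \sum_x psi (c x) * e x) +
     (\sum_x psi1 ((shear l \o c) x) * e x - \sum_x psi1 (r x) * e x).
    rewrite addrA; congr (_ - _); under [X in _ = _ + X]eq_bigr do rewrite psi1E.
    by rewrite subrK.
  exact: idealD.
have [T [W [h [hW eW]]]] : spanned (fun v => I (\sum_x psi1 (v x) * e x) /\
    forall x, (msize (v x) <= E)%N) (lift_last c).
  have [|T [W [h [hW eW]]]] := rel (shear (shear_inv l) \o lift_last c).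
    by rewrite -liftS in cI.
  exists T, (fun t => shear l \o W t), (shear l \o h); split=> [t|x].
    have [h1 h2] := hW t; split=> [|x].
      by under eq_bigr do rewrite psi1E.
    by apply: leq_trans (msize_shear _ _) (h2 x).
  rewrite -[LHS](shearK l0) -/((shear _ \o lift_last c) x) eW rmorph_sum.
  by apply: eq_bigr => t _; rewrite rmorphM.
have /choice[r hr] t : exists r, [/\ exists q, h t = q * p + r
    & (size (muni r) <= L)%N].
  by have [q [r [h1 h2 h3]]] := mdiv_monic (h t) mp; exists r; split=> //; exists q.
have /choice[w hw] (z : T * 'I_L) := modp (fun x => 'X_ord_max ^+ z.2 * W z.1 x).
pose V (z : T * 'I_L) (y : X * 'I_L) := (muni (w z y.1))`_y.2.
have liftV z x : lift_last (V z) x = w z x.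
  by apply: lift_lastK; case: (hw z).
have hwq (z : T * 'I_L) x : exists q, w z x = 'X_ord_max ^+ z.2 * W z.1 x - q * p.
  have [_ _ _ /(_ x)[q e1]] := hw z; exists q; rewrite e1.
  by rewrite [q * p + _]addrC addrK.
have rE t : r t = \sum_(a < L) mwiden (muni (r t))`_a * 'X_ord_max ^+ a.
  have [_ sr] := hr t.
  rewrite -[LHS](@lift_lastK _ _ L unit (fun=> r t) tt sr).
  exact: (@lift_lastE j L unit _ tt).
(* Both sides agree modulo [p] and have degree less than [L] in the last variable, hence are
   equal. *)
have eC x : lift_last c x = \sum_(z : T * 'I_L) mwiden (muni (r z.1))`_z.2 * w z x.
  apply/eqP; rewrite -subr_eq0; apply/eqP.
  have [q eq] : exists q,
      lift_last c x - \sum_(z : T * 'I_L) mwiden (muni (r z.1))`_z.2 * w z x = q * p.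
    have /choice[q1 hq1] t : exists q, h t = q * p + r t by case: (hr t).
    have /choice[q2 hq2] (z : T * 'I_L) : exists q, w z x = 'X_ord_max ^+ z.2 * W z.1 x - q * p.
      exact: hwq.
    exists (\sum_t q1 t * W t x + \sum_(z : T * 'I_L) mwiden (muni (r z.1))`_z.2 * q2 z).
    rewrite eW mulrDl !mulr_suml.
    under [X in _ - X]eq_bigr do rewrite hq2 mulrBr.
    rewrite sumrB opprB addrCA addrC; congr (_ + _); last first.
      by apply: eq_bigr => z _; rewrite mulrA.
    under eq_bigr do rewrite hq1 mulrDl.
    rewrite big_split /= -addrA [X in _ + X](_ : _ = 0).
      by rewrite addr0; apply: eq_bigr => t _; rewrite mulrAC.
    apply/eqP; rewrite subr_eq0; apply/eqP.
    transitivity (\sum_t \sum_(a < L)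
        mwiden (muni (r t))`_a * ('X_ord_max ^+ a * W t x)); last first.
      by rewrite pair_bigA.
    apply: eq_bigr => t _; rewrite [in LHS]rE mulr_suml.
    by apply: eq_bigr => a _; rewrite mulrA.
  rewrite eq; apply: (monic_last_multiple0 mp); rewrite -eq.
  rewrite muniB; apply: leq_trans (size_polyD _ _) _; rewrite geq_max.
  rewrite size_lift size_polyN (raddf_sum (@muni j K)) /=.
  apply: leq_trans (size_sum _ _ _) _; apply/bigmax_leqP => z _.
  rewrite muniM muni_mwiden mul_polyC.
  by apply: leq_trans (size_scale_leq _ _) _; case: (hw z).
exists (T * 'I_L)%type, V, (fun z : T * 'I_L => (muni (r z.1))`_z.2); split=> [z|y].
  have [h1 h2 h3 _] := hw z; split=> [|y].
    rewrite -liftS; under eq_bigr do rewrite liftV.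
    apply/(ideal_eqmod idI h1).
    under eq_bigr do rewrite rmorphM -mulrA.
    by rewrite -mulr_sumr; apply: idealMl => //; case: (hW z.1).
  apply: leq_trans (msize_muni_coef _ _) (leq_trans (h3 _) _).
  rewrite addnC; apply: msizeM_leD; last by case: (hW z.1).
  apply: leq_trans (msizeX_le _ (_ : msize _ <= 2)%N) _; first by rewrite msizeX mdeg1.
  by rewrite leq_add2l leq_mul2r ltnW ?orbT.
case: y => x a; have cE : c (x, a) = (muni (lift_last c x))`_a.
  rewrite muni_lift coef_sum (bigD1 a) //= coefZ coefXn eqxx mulr1 big1 ?addr0 //.
  move=> b nb; rewrite coefZ coefXn; case: eqP => [e1|]; last by rewrite mulr0.
  by case/eqP: nb; apply: val_inj.
rewrite cE eC (raddf_sum (@muni j K)) coef_sum; apply: eq_bigr => z _.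
by rewrite /= muniM muni_mwiden coefCM.
Qed.

End StageStep.

Section Fractions.
Variable S : idomainType.

Lemma fractionE (x : {fraction S}) : exists a b : S,
  b != 0 /\ x = tofrac a / tofrac b.
Proof.
pose r := repr x; have d0 : (frac r).2 != 0 by apply: denom_ratioP.
exists (frac r).1, (frac r).2; split=> //.
apply: (canRL (mulfK _)); first by rewrite tofrac_eq0.
have tofracE a : tofrac a = \pi_({fraction S})%qT (Ratio a 1).
  by rewrite !piE.
rewrite !tofracE -[x]reprK -/r.
transitivity (\pi_({fraction S})%qT (FracField.mulf r (Ratio (frac r).2 1))).
  exact: (esym (FracField.pi_mul _ _)).
apply/eqmodP; rewrite /= FracField.equivfE /FracField.mulf /=.
by rewrite !numden_Ratio ?oner_eq0 ?mulr1 // mulrC.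
Qed.

Lemma common_denominator (T : finType) (v : T -> {fraction S}) :
  exists s w, s != 0 /\ forall t, tofrac s * v t = tofrac (w t).
Proof.
have /choice[a /choice[b hab]] t := fractionE (v t).
exists (\prod_t b t), (fun t => a t * \prod_(t' | t' != t) b t'); split.
  by apply/prodf_neq0 => t _; case: (hab t).
move=> t; have [b0 ->] := hab t; rewrite (bigD1 t) //= !tofracM.
rewrite mulrAC mulrCA mulfV ?mulr1 1?mulrC //; by rewrite tofrac_eq0.
Qed.

End Fractions.

(** * A basis of the quotient after inverting one element *)

Section Basis.
Variables (K : numFieldType) (n : nat).
Local Notation R := {mpoly K[n]}.

(* After inverting [q], the family [b] is a basis of the quotient by [I]. *)
Definition basis_mod (I : R -> Prop) j (psi : {mpoly K[j]} -> R) (E : nat) m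
    (b : 'I_m -> R) (q : {mpoly K[j]}) : Prop :=
  [/\ forall i, (msize (b i) <= E)%N, (msize q <= E)%N /\ q != 0,
    forall c : 'I_m -> {mpoly K[j]}, I (\sum_i psi (c i) * b i) ->
       forall i, c i = 0
    & forall f, exists c : 'I_m -> {mpoly K[j]},
       I (psi q * f - \sum_i psi (c i) * b i) /\
       forall i, (msize (c i) <= msize f + E)%N].

(** Take a maximal independent subfamily of the [e x]. Each remaining [e x] occurs with nonzero
    coefficient in some relation over this subfamily, hence also in a small generating one; the
    product of these coefficients is the common denominator. *)
Lemma basis_exists j (X : finType) E : exists E',
  forall (I : R -> Prop) (psi : {rmorphism {mpoly K[j]} -> R}) (e : X -> R),
  is_ideal I -> presentation I E psi e ->
  exists m (b : 'I_m -> R) q, (m <= #|X|)%N /\ basis_mod I psi E' b q.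
Proof.
have [E1 hE1] := relations_bound K n j X X E E.
exists (E + (1 + #|X| * E1.+1) + E1.+1)%N => I psi e idI pres.
have := hE1 _ _ _ idI pres => {}hE1; case: pres => [bpsi be red rel].
pose indep (J : {set X}) := forall c : X -> {mpoly K[j]},
  (forall x, x \notin J -> c x = 0) -> I (\sum_x psi (c x) * e x) ->
  forall x, c x = 0.
have ex0 : exists J, `[< indep J >].
  by exists finset.set0; apply/asboolP => c c0 _ x; apply: c0; rewrite inE.
have [J /maxsetP[/asboolP indJ maxJ]] := ex_maxset ex0.
have /choice[q /choice[w hw]] x : exists q w, [/\ q != 0, (msize q <= E1.+1)%N,
    forall y, y \notin J -> w y = 0, forall y, (msize (w y) <= E1.+1)%N
    & I (psi q * e x - \sum_y psi (w y) * e y)].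
  have [xJ|xJ] := boolP (x \in J).
    exists 1, (fun y => (y == x)%:R); rewrite oner_eq0 msize1; split=> // [y yJ|y|].
    - by case: eqP => // e1; rewrite -e1 (negbTE yJ) in xJ.
    - by case: eqP; rewrite ?msize1 ?msize0.
    - rewrite (bigD1 x) //= eqxx rmorph1 mul1r big1 ?addr0 ?subrr.
        exact: ideal0.
      by move=> y /negbTE->; rewrite rmorph0 mul0r.
  have [c [sc [Ic [y0 cy0]]]] : exists c : X -> {mpoly K[j]},
      (forall y, y \notin (x |: J)%SET -> c y = 0) /\
      (I (\sum_y psi (c y) * e y) /\ exists y, c y <> 0).
    apply: contrapT => h; suff : (x |: J)%SET = J.
      by move/setP/(_ x); rewrite !inE eqxx (negbTE xJ).
    apply: maxJ; last exact: subsetU1.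
    apply/asboolP => c sc Ic y; apply: contrapT => cy; apply: h.
    by exists c; split=> //; split=> //; exists y.
  have cx : c x != 0.
    apply/eqP => cx0; apply: cy0; apply: indJ => // y yJ.
    have [->//|yx] := eqVneq y x.
    by apply: sc; rewrite !inE negb_or yx.
  (* Setting the other vectors to zero discards their coefficients while keeping the index set [X],
     for which [E1] was chosen. *)
  pose f y := if y \in (x |: J)%SET then e y else 0.
  have sumf v : \sum_y psi (v y) * f y =
      psi (v x) * e x + \sum_y psi (if y \in J then v y else 0) * e y.
    rewrite (bigD1 x) //= /f !inE eqxx; congr (_ + _).
    rewrite [RHS](bigD1 x) //= (negbTE xJ) rmorph0 mul0r add0r.
    apply: eq_bigr => y yx; rewrite !inE (negbTE yx) /=.
    by case: ifP => // _; rewrite mulr0 rmorph0 mul0r.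
  have [||T [V [h [hV eV]]]] := hE1 f _ c.
  - by move=> y; rewrite /f; case: ifP => // _; rewrite msize0.
  - suff <- : \sum_y psi (c y) * e y = \sum_y psi (c y) * f y by [].
    apply: eq_bigr => y _; rewrite /f; case: ifP => // /negbT /sc ->.
    by rewrite rmorph0 !mul0r.
  have [l Vlx] : exists l, V l x != 0.
    apply: contrapT => nV; case/eqP: cx; rewrite eV big1 // => l _.
    have /eqP -> : V l x == 0 by apply: contrapT => /negP h0; apply: nV; exists l.
    by rewrite mulr0.
  have [Il bl] := hV l.
  exists (V l x), (fun y => if y \in J then - V l y else 0); split=> //.
  - exact: leqW.
  - by move=> y /negbTE->.
  - by move=> y; case: ifP; rewrite ?mmeasureN ?msize0 // leqW.
  - suff -> : psi (V l x) * e x - \sum_y psi (if y \in J then - V l y else 0) * e y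
       = \sum_y psi (V l y) * f y by [].
    rewrite sumf -sumrN; congr (_ + _); apply: eq_bigr => y _.
    by case: ifP; rewrite ?rmorphN ?rmorph0 ?mulNr ?opprK ?mul0r ?oppr0.
pose Q := \prod_x q x.
have bprod (P : pred X) : (msize (\prod_(x | P x) q x) <= 1 + #|X| * E1.+1)%N.
  have -> : #|X| = size (index_enum X) by rewrite cardT enumT.
  by apply: msize_prod_le => x _; case: (hw x).
have redQ f : exists c : X -> {mpoly K[j]}, [/\ forall y, y \notin J -> c y = 0,
    I (psi Q * f - \sum_y psi (c y) * e y) &
    forall y, (msize (c y) <= msize f + (1 + #|X| * E1.+1) + E1.+1)%N].
  have [a [Ia ba]] := red f.
  exists (fun y => \sum_x a x * (\prod_(x' | x' != x) q x') * w x y); split.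
  - by move=> y yJ; rewrite big1 // => x _; case: (hw x) => _ _ ->; rewrite ?mulr0.
  - have -> : psi Q * f - \sum_y psi (\sum_x a x * (\prod_(x' | x' != x) q x') * w x y) * e y
      = psi Q * (f - \sum_x psi (a x) * e x) + \sum_x psi (a x * (\prod_(x' | x' != x) q x')) *
         (psi (q x) * e x - \sum_y psi (w x y) * e y).
      rewrite mulrBr -addrA; congr (_ + _).
      under [X in _ = _ + X]eq_bigr do rewrite mulrBr.
      rewrite sumrB addrA -[LHS]add0r; congr (_ - _).
        rewrite mulr_sumr -sumrN -big_split big1 // => x _ /=.
        by rewrite /Q (bigD1 x) //= !rmorphM; ring.
      under eq_bigr do rewrite rmorph_sum mulr_suml.
      rewrite exchange_big; apply: eq_bigr => x _; rewrite mulr_sumr.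
      by apply: eq_bigr => y _; rewrite rmorphM mulrA.
    apply: idealD => //; first exact: idealMl.
    by apply: ideal_sum => // x _; apply: idealMl => //; case: (hw x).
  - move=> y; apply: msize_sum_le => x _; apply: msizeM_leD; last by case: (hw x).
    by apply: msizeM_leD.
have sumJ (F : X -> R) : (forall x, x \notin J -> F x = 0) ->
    \sum_x F x = \sum_(i < #|J|) F (enum_val i).
  move=> F0; rewrite -big_enum_val [LHS](bigID (mem J)) /=.
  by rewrite [X in _ + X]big1 ?addr0.
exists #|J|, (fun i => e (enum_val i)), Q; split; first exact: max_card.
split.
- by move=> i; apply: leq_trans (be _) _; rewrite -addnA leq_addr.
- split; first by apply: leq_trans (bprod _) _; rewrite addnAC leq_addl.
  by apply/prodf_neq0 => x _; case: (hw x).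
- move=> c Ic i.
  pose c' x := if [pick k : 'I_#|J| | enum_val k == x] is Some k then c k else 0.
  have c'E k : c' (enum_val k) = c k.
    rewrite /c'; case: pickP => [k' /eqP /enum_val_inj -> //|/(_ k)].
    by rewrite eqxx.
  have c'0 x : x \notin J -> c' x = 0.
    rewrite /c'; case: pickP => // k /eqP <-; by rewrite enum_valP.
  rewrite -c'E; apply: indJ => //.
  rewrite sumJ; last by move=> x /c'0 ->; rewrite rmorph0 mul0r.
  by under eq_bigr do rewrite c'E.
- move=> f; have [c [c0 Ic bc]] := redQ f.
  exists (fun i => c (enum_val i)); split=> [|i].
    by rewrite -(sumJ (fun x => psi (c x) * e x)) // => x /c0 ->; rewrite rmorph0 mul0r.
  by apply: leq_trans (bc _) _; rewrite -!addnA leq_add2l leq_addl.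
Qed.

End Basis.

(** * Primality tested in bounded degree *)

Section PrimeTest.
Variables (K : numFieldType) (n : nat).
Local Notation R := {mpoly K[n]}.

Definition prime_test (B : nat) (I : R -> Prop) : Prop :=
  forall f g, (msize f <= B)%N -> (msize g <= B)%N -> I (f * g) -> I f \/ I g.

(** The polynomials sent into [I] are the relations of the single element 1, and these are generated
    in size at most [L]. *)
Lemma injective_bound j (X : finType) E : exists L,
  forall (I : R -> Prop) (psi : {rmorphism {mpoly K[j]} -> R}) (e : X -> R),
  is_ideal I -> presentation I E psi e ->
  (forall p, p != 0 -> (msize p <= L)%N -> ~ I (psi p)) ->
  forall p, I (psi p) -> p = 0.
Proof.
have [L hL] := relations_bound K n j X unit E 1; exists L => I psi e idI pres h p Ip.
have [||T [V [k [hV eV]]]] := hL I psi e idI pres (fun=> 1) _ (fun=> p).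
- by move=> _; rewrite msize1.
- by rewrite (bigD1 tt) //= big1 ?addr0 ?mulr1 //; case.
rewrite (eV tt) big1 // => l _; have [Il bl] := hV l.
have [->|Vl0] := eqVneq (V l tt) 0; first by rewrite mulr0.
case: (h _ Vl0 (bl tt)); move: Il.
by rewrite (bigD1 tt) //= big1 ?addr0 ?mulr1 //; case.
Qed.

Lemma map_poly_eval j (psi : {rmorphism {mpoly K[j]} -> R})
    (g : {poly {mpoly K[j]}}) a k :
  (size g <= k)%N -> (map_poly psi g).[a] = \sum_(i < k) psi g`_i * a ^+ i.
Proof.
move=> gk; rewrite (@horner_coef_wide _ k).
  by apply: eq_bigr => i _; rewrite coef_map.
exact: leq_trans (size_poly _ _) gk.
Qed.

(** Read as polynomials in one more variable, nonzero factors have additive total degree. *)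
Lemma msize_polyM_coef j (f g : {poly {mpoly K[j]}}) D i : f * g != 0 ->
  (forall i, msize (f * g)%R`_i <= D)%N ->
  (msize f`_i <= D + size (f * g)%R)%N /\ (msize g`_i <= D + size (f * g)%R)%N.
Proof.
move=> fg0 bD; have := msize_mmulti_le bD (leqnn _).
have eM : mmulti (f * g) = mmulti f * mmulti g.
  by apply: muni_inj; rewrite muniM !mmultiK.
have M0 : mmulti (f * g) != 0 by rewrite -muni_eq0 mmultiK.
rewrite eM in M0 *; move: M0; rewrite mulf_eq0 negb_or => /andP[f0 g0].
rewrite msizeM // => h.
have pf : (0 < msize (mmulti f))%N by rewrite lt0n mmeasure_poly_eq0.
have pg : (0 < msize (mmulti g))%N by rewrite lt0n mmeasure_poly_eq0.
have hf := msize_muni_coef (mmulti f) i; have hg := msize_muni_coef (mmulti g) i.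
rewrite !mmultiK in hf hg.
split; [apply: leq_trans hf _ | apply: leq_trans hg _]; apply: leq_trans h.
  by move: pf pg; move: (msize (mmulti f)) (msize (mmulti g)) => x y; lia.
by move: pf pg; move: (msize (mmulti f)) (msize (mmulti g)) => x y; lia.
Qed.

(** A relation of [a] of least degree can be replaced by a generating one with nonzero top
    coefficient, which is small. A proper factorization over the fraction field descends by
    [gauss_factor], with coefficients of size at most [E1 + N.+1]. The values of the factors at [a]
    are then within reach of the test, and by minimality neither lies in [I]. *)
Lemma irreducible_relation j (X : finType) E d N : exists B,
  forall (I : R -> Prop) (psi : {rmorphism {mpoly K[j]} -> R}) (e : X -> R),
  is_ideal I -> presentation I E psi e -> (forall p, I (psi p) -> p = 0) ->
  prime_test B I ->
  forall a, (msize a <= d)%N ->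
  (exists g : {poly {mpoly K[j]}}, [/\ g != 0, (size g <= N.+1)%N & I (map_poly psi g).[a]]) ->
  exists2 g : {poly {mpoly K[j]}}, irreducible_poly (map_poly (@tofrac _) g) & I (map_poly psi g).[a].
Proof.
have [E1 hE1] := relations_bound K n j X 'I_N.+1 E (1 + N * d).
exists ((E1 + N.+1) + (1 + N * d))%N => I psi e idI pres inj test a ad exg.
have bX (k : nat) : (k <= N)%N -> (msize (a ^+ k) <= 1 + N * d)%N.
  move=> kN; apply: leq_trans (msizeX_le _ ad) _.
  by rewrite leq_add2l leq_mul2r kN orbT.
pose P k := `[< exists g : {poly {mpoly K[j]}}, size g = k.+1 /\ I (map_poly psi g).[a] >].
have exP : exists k, P k.
  case: exg => g [g0 _ Ig]; exists (size g).-1; apply/asboolP; exists g; split=> //.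
  by rewrite prednK // size_poly_gt0.
case: (ex_minnP exP) => k /asboolP[g [sg Ig]] mink.
have kN : (k <= N)%N.
  case: exg => g' [g'0 sg' Ig']; apply: leq_trans (mink (size g').-1 _) _.
    apply/asboolP; exists g'; split=> //; by rewrite prednK // size_poly_gt0.
  by rewrite -ltnS prednK // size_poly_gt0.
have k0 : (0 < k)%N.
  rewrite lt0n; apply/eqP => k0; rewrite k0 in sg.
  have /eqP/size_poly1P[c c0 ec] := sg.
  move: Ig; rewrite ec map_polyC hornerC => /inj ec0.
  by rewrite ec0 eqxx in c0.
(* The degree [k] depends on the ideal, the index set may not: powers above [k] are replaced by
   zero. *)
pose f (i : 'I_N.+1) := if (i <= k)%N then a ^+ i else 0.
have sumf (v : nat -> {mpoly K[j]}) :
    \sum_(i < N.+1) psi (v i) * f i = \sum_(i < k.+1) psi (v i) * a ^+ i.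
  rewrite (big_ord_widen N.+1 (fun i => psi (v i) * a ^+ i)) // [RHS]big_mkcond /=.
  by apply: eq_bigr => i _; rewrite /f ltnS; case: ifP; rewrite ?mulr0.
have [||T [V [h [hV eV]]]] := hE1 I psi e idI pres f _ (fun i => g`_i).
- by move=> i; rewrite /f; case: ifP => ik; [apply: bX; rewrite -ltnS | rewrite msize0].
- by rewrite (sumf (fun i => g`_i)) -map_poly_eval ?sg.
have kN1 : (k < N.+1)%N by [].
have [l Vl] : exists l, V l (Ordinal kN1) != 0.
  apply: contrapT => nV; have := eV (Ordinal kN1).
  rewrite big1 /= => [gk|l _]; last first.
    have /eqP -> : V l (Ordinal kN1) == 0.
      by apply: contrapT => /negP h0; apply: nV; exists l.
    by rewrite mulr0.
  have : lead_coef g == 0 by rewrite lead_coefE sg gk.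
  by rewrite lead_coef_eq0 -size_poly_eq0 sg.
have [Il bl] := hV l.
pose v i := if @insub _ _ 'I_N.+1 i is Some o then V l o else 0.
have vE (i : 'I_N.+1) : v i = V l i by rewrite /v valK.
pose G : {poly {mpoly K[j]}} := \poly_(i < k.+1) v i.
have sG : size G = k.+1.
  apply: size_poly_eq; rewrite -[k]/(val (Ordinal kN1)) vE; exact: Vl.
have IG : I (map_poly psi G).[a].
  rewrite (map_poly_eval _ _ (eq_leq sG)).
  have -> : \sum_(i < k.+1) psi G`_i * a ^+ i = \sum_(i < N.+1) psi (V l i) * f i.
    under [RHS]eq_bigr do rewrite -vE.
    by rewrite (sumf v); apply: eq_bigr => i _; rewrite coef_poly ltn_ord.
  exact: Il.
have bG i : (msize G`_i <= E1)%N.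
  rewrite coef_poly; case: ifP => // ik; last by rewrite msize0.
  have iN : (i < N.+1)%N by apply: leq_trans ik kN1.
  by rewrite -[i]/(val (Ordinal iN)) vE.
have G0 : G != 0 by rewrite -size_poly_gt0 sG.
have small (p : {poly {mpoly K[j]}}) : (1 < size p)%N -> (size p < k.+1)%N ->
    (forall i, (msize p`_i <= E1 + N.+1)%N) ->
    ~ I (map_poly psi p).[a] /\ (msize (map_poly psi p).[a] <= E1 + N.+1 + (1 + N * d))%N.
  move=> sp1 spk bp; split=> [Ip|].
    have : P (size p).-1.
      by apply/asboolP; exists p; rewrite prednK // ltnW.
    by move/mink; move: sp1 spk; move: (size p) => s; lia.
  rewrite (map_poly_eval _ _ (leqnn _)); apply: msize_sum_le => i _.
  have [bpsi _ _ _] := pres.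
  apply: msizeM_leD; first exact: leq_trans (bpsi _) (bp _).
  by apply: bX; apply: leq_trans (ltnW (ltn_ord i)) (leq_trans (ltnSE spk) kN).
have inj_frac : injective (@tofrac {mpoly K[j]}).
  by move=> x y /eqP; rewrite tofrac_eq => /eqP.
have smap (p : {poly {mpoly K[j]}}) : size (map_poly (@tofrac _) p) = size p.
  by apply: size_map_inj_poly => //; rewrite tofrac0.
exists G => //; split=> [|q sq1 qG]; first by rewrite smap sG.
have mG0 : map_poly (@tofrac _) G != 0 by rewrite -size_poly_gt0 smap sG.
rewrite -dvdp_size_eqp // smap sG; apply: contrapT => /negP sqk.
have /dvdpP[r er] := qG.
have q0 : q != 0 by apply: contra mG0 => /eqP e0; rewrite er e0 mulr0.
have r0 : r != 0 by apply: contra mG0 => /eqP e0; rewrite er e0 mul0r.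
have clear (p : {poly {fraction {mpoly K[j]}}}) : exists s (w : {poly {mpoly K[j]}}),
    s != 0 /\ tofrac s *: p = map_poly (@tofrac _) w.
  have [s [w [s0 hw]]] := common_denominator (fun i : 'I_(size p) => p`_i).
  exists s, (\poly_(i < size p) if @insub _ _ 'I_(size p) i is Some o then w o else 0).
  split=> //; apply/polyP => i; rewrite coefZ coef_map coef_poly.
  case: ltnP => ip; last by rewrite nth_default // mulr0; symmetry; apply: tofrac0.
  by rewrite insubT /= -hw.
have [s1 [w1 [s10 e1]]] := clear q; have [s2 [w2 [s20 e2]]] := clear r.
have sz1 : size w1 = size q by rewrite -smap -e1 size_scale // tofrac_eq0.
have sz2 : size w2 = size r by rewrite -smap -e2 size_scale // tofrac_eq0.
have eG : w1 * w2 = (s1 * s2) *: G.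
  apply: (map_inj_poly inj_frac (tofrac0 _)).
  rewrite rmorphM /= map_polyZ -e1 -e2 er -scalerAl -scalerAr scalerA.
  by rewrite rmorphM mulrC [q * r]mulrC.
have [f1 [f2 [ef sf1 sf2]]] := gauss_factor (@mpoly_prime_divisor K j)
   (mulf_neq0 s10 s20) eG.
have szq : size q != 0%N by rewrite size_poly_eq0.
have szr : size r != 0%N by rewrite size_poly_eq0.
have szG : ((size r + size q).-1 = k.+1)%N by rewrite -sG -smap er size_mul.
have fG0 : f1 * f2 != 0 by rewrite ef.
have bfG i : (msize (f1 * f2)%R`_i <= E1)%N by rewrite ef.
have bf i := msize_polyM_coef i fG0 bfG.
have sfG : (size (f1 * f2)%R <= N.+1)%N by rewrite ef sG.
rewrite sz1 in sf1; rewrite sz2 in sf2.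
have sqk' : (size q <= k.+1)%N by rewrite -sG -smap dvdp_leq.
have [||i|n1 b1] := small f1.
- by rewrite sf1; move: szq sq1; move: (size q) => s; lia.
- by rewrite sf1 ltn_neqAle sqk sqk'.
- by have [h1 _] := bf i; apply: leq_trans h1 _; rewrite leq_add2l.
have [||i|n2 b2] := small f2.
- rewrite sf2; move: szr szG sqk sqk' szq; move: (size q) (size r) => s s'; lia.
- rewrite sf2; move: szr szG sqk sqk' szq sq1; move: (size q) (size r) => s s'; lia.
- by have [_ h2] := bf i; apply: leq_trans h2 _; rewrite leq_add2l.
have := test _ _ b1 b2; rewrite -hornerM -rmorphM /= ef => /(_ IG).
by case.
Qed.

End PrimeTest.

Lemma sum_unit (V : nmodType) (F : unit -> V) : \sum_t F t = F tt.
Proof. by rewrite (bigD1 tt) //= big1 ?addr0 //; case. Qed.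

(** * Coordinates and traces over the fraction field *)

Section Coordinates.
Variables (K : numFieldType) (n j m : nat).
Local Notation R := {mpoly K[n]}.
Local Notation S := {mpoly K[j]}.
Variables (I : R -> Prop) (psi : {rmorphism S -> R}) (E : nat).
Variables (b : 'I_m.+1 -> R) (q : S).
Hypotheses (idI : is_ideal I) (basis_b : basis_mod I psi E b q).
Let F := {fraction S}.

Let q0 : q != 0. Proof. by case: basis_b => _ []. Qed.

(** Numerators over the common denominator [q]. They are obtained by choice, but independence of the
    basis makes them unique, hence linear in [f]. *)
Definition num_coord (f : R) : 'I_m.+1 -> S :=
  let: And4 _ _ _ red := basis_b in projT1 (cid (red f)).

Lemma num_coordI f : I (psi q * f - \sum_i psi (num_coord f i) * b i).
Proof. by rewrite /num_coord; case: basis_b => _ _ _ red; case: cid => c []. Qed.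

Lemma msize_num_coord f i : (msize (num_coord f i) <= msize f + E)%N.
Proof. by rewrite /num_coord; case: basis_b => _ _ _ red; case: cid => c []. Qed.

Lemma num_coord_uniq f c : I (psi q * f - \sum_i psi (c i) * b i) ->
  forall i, num_coord f i = c i.
Proof.
move=> Ic i; apply/eqP; rewrite -subr_eq0; apply/eqP.
case: basis_b => _ _ indep _; apply: (indep (fun i => num_coord f i - c i)).
under eq_bigr do rewrite rmorphB mulrBl.
rewrite sumrB; have sub3 (x y z : R) : x - y = (z - y) - (z - x) by ring.
by rewrite (sub3 _ _ (psi q * f)); apply: idealB => //; apply: num_coordI.
Qed.

Lemma num_coord0 f : (forall i, num_coord f i = 0) <-> I (psi q * f).
Proof.
split=> [c0|If i].
  have := num_coordI f; rewrite big1 ?subr0 // => i _.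
  by rewrite c0 rmorph0 mul0r.
apply: (num_coord_uniq (c := fun=> 0)); rewrite big1 ?subr0 // => k _.
by rewrite rmorph0 mul0r.
Qed.

Lemma num_coord_sum (T : finType) (a : T -> S) (f : T -> R) i :
  num_coord (\sum_t psi (a t) * f t) i = \sum_t a t * num_coord (f t) i.
Proof.
apply: (num_coord_uniq (c := fun i => \sum_t a t * num_coord (f t) i)).
under [X in _ - X]eq_bigr do rewrite rmorph_sum mulr_suml.
rewrite exchange_big mulr_sumr -sumrB; apply: ideal_sum => // t _.
under eq_bigr do rewrite rmorphM -mulrA.
by rewrite -mulr_sumr mulrCA -mulrBr; apply: idealMl => //; apply: num_coordI.
Qed.

Lemma num_coord_basis i k : num_coord (b i) k = q *+ (i == k).
Proof.
apply: (num_coord_uniq (c := fun k => q *+ (i == k))).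
rewrite (bigD1 i) //= eqxx big1 ?addr0 ?subrr; first exact: ideal0.
by move=> l; rewrite eq_sym => /negbTE->; rewrite rmorph0 mul0r.
Qed.

Lemma num_coord_eqmod f g : I (f - g) -> forall i, num_coord f i = num_coord g i.
Proof.
move=> fg; apply: num_coord_uniq.
have -> : psi q * f - \sum_i psi (num_coord g i) * b i =
  psi q * (f - g) + (psi q * g - \sum_i psi (num_coord g i) * b i) by ring.
by apply: idealD => //; [apply: idealMl | apply: num_coordI].
Qed.

Lemma num_coordM f g k :
  q * num_coord (f * g) k = \sum_i num_coord f i * num_coord (b i * g) k.
Proof.
have -> : q * num_coord (f * g) k = num_coord (psi q * (f * g)) k.
  have := num_coord_sum (fun=> q) (fun _ : unit => f * g) k.
  by rewrite !sum_unit.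
rewrite -num_coord_sum; apply: num_coord_eqmod; rewrite mulrA.
under eq_bigr do rewrite mulrA.
by rewrite -mulr_suml -mulrBl; apply: idealMr => //; apply: num_coordI.
Qed.

Definition coord (f : R) : 'rV[F]_m.+1 :=
  \row_i (tofrac (num_coord f i) / tofrac q).

Definition mult_mx (f : R) : 'M[F]_m.+1 := \matrix_i coord (b i * f).

Let fq0 : tofrac q != 0 :> F. Proof. by rewrite tofrac_eq0. Qed.

Lemma coordM f g : coord (f * g) = coord f *m mult_mx g.
Proof.
apply/rowP => k; rewrite !mxE.
have := congr1 (fun x => (tofrac x / tofrac q) / tofrac q : F) (num_coordM f g k).
rewrite tofracM [tofrac q * _ / _]mulrAC mulfV // mul1r => ->.
rewrite rmorph_sum !mulr_suml; apply: eq_bigr => i _.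
by rewrite !mxE /= tofracM; ring.
Qed.

Lemma coord_basis i : coord (b i) = delta_mx 0 i.
Proof.
apply/rowP => k; rewrite !mxE num_coord_basis eqxx /= eq_sym.
by case: eqP => _; rewrite ?mulfV // tofrac0 mul0r.
Qed.

Lemma coord_sum (T : finType) (a : T -> S) (f : T -> R) :
  coord (\sum_t psi (a t) * f t) = \sum_t tofrac (a t) *: coord (f t).
Proof.
apply/rowP => k; rewrite !mxE num_coord_sum rmorph_sum mulr_suml summxE.
by apply: eq_bigr => t _; rewrite !mxE /= tofracM mulrA.
Qed.

Lemma coord0 f : coord f = 0 <-> I (psi q * f).
Proof.
rewrite -num_coord0; split=> [/rowP c0 i|c0].
  apply/eqP; have /eqP := c0 i; rewrite !mxE mulf_eq0 invr_eq0 (negbTE fq0) orbF.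
  by rewrite tofrac_eq0.
by apply/rowP => i; rewrite !mxE c0 tofrac0 mul0r.
Qed.

Lemma coord_comb (w : 'I_m.+1 -> S) :
  coord (\sum_i psi (w i) * b i) = \row_i tofrac (w i).
Proof.
rewrite coord_sum; apply/rowP => k; rewrite summxE !mxE (bigD1 k) //=.
rewrite coord_basis !mxE !eqxx mulr1 big1 ?addr0 // => i /negbTE ik.
by rewrite coord_basis !mxE eq_sym ik andbF mulr0.
Qed.

Lemma coord_horner a (g : {poly S}) f :
  coord f *m horner_mx (mult_mx a) (map_poly (@tofrac _) g) =
  coord (f * (map_poly psi g).[a]).
Proof.
elim/poly_ind: g f => [|g c IHg] f.
  rewrite !rmorph0 mulmx0 horner0 mulr0; apply/esym/coord0.
  by rewrite mulr0; apply: ideal0.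
rewrite !rmorphD !rmorphM /= !map_polyX !map_polyC /= hornerMXaddC.
rewrite horner_mx_X horner_mx_C mulmxDr mulmxA IHg -coordM mulrDr mulrA.
rewrite mul_mx_scalar.
pose F2 (t : bool) := if t then f * (map_poly psi g).[a] * a else f.
pose a2 (t : bool) := if t then 1 else c : S.
have := coord_sum a2 F2; rewrite !big_bool /= rmorph1 mul1r tofrac1 scale1r.
by rewrite [psi c * f]mulrC => ->.
Qed.

Lemma horner_mult_mx a (g : {poly S}) : I (map_poly psi g).[a] ->
  horner_mx (mult_mx a) (map_poly (@tofrac _) g) = 0.
Proof.
move=> Ig; apply/row_matrixP => i; rewrite row0 rowE -coord_basis coord_horner.
by apply/coord0; do 2 apply: idealMl => //.
Qed.

(** The [m.+2] powers of [a] are dependent in a space of dimension [m.+1]. *)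
Lemma algebraic_relation a : exists g : {poly S},
  [/\ g != 0, (size g <= m.+2)%N & I (map_poly psi g).[a]].
Proof.
pose P : 'M[F]_(m.+2, m.+1) := \matrix_(k < m.+2) coord (a ^+ k).
have [v v0 vP] : exists2 v : 'rV_m.+2, v != 0 & v *m P = 0.
  have : kermx P != 0.
    by rewrite -mxrank_eq0 mxrank_ker subn_eq0 -ltnNge ltnS rank_leq_col.
  case/rowV0Pn => v /sub_kermxP vP v0; by exists v.
have [s [w [s0 hw]]] := common_denominator (v 0).
pose g : {poly S} := \poly_(k < m.+2) (if @insub _ _ 'I_m.+2 k is Some o then w o else 0).
have gE (k : 'I_m.+2) : g`_k = w k by rewrite coef_poly ltn_ord valK.
have g0 : g != 0.
  case/rV0Pn: v0 => k vk; apply: contraNneq vk => g0.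
  have := hw k; rewrite -gE g0 coef0 tofrac0 => /eqP.
  by rewrite mulf_eq0 tofrac_eq0 (negbTE s0).
(* Vanishing coordinates only put [psi q] times the value into [I], hence the factor [q]. *)
exists (q *: g); rewrite scale_poly_eq0 negb_or q0 g0; split=> //.
  by rewrite size_scale // size_poly.
rewrite map_polyZ hornerZ; apply/coord0; rewrite (map_poly_eval _ _ (size_poly _ _)).
rewrite coord_sum; under eq_bigr do rewrite gE -hw -scalerA.
rewrite -scaler_sumr; have -> : \sum_(k < m.+2) v 0 k *: coord (a ^+ k) = v *m P.
  by rewrite mulmx_sum_row; apply: eq_bigr => k _; rewrite rowK.
by rewrite vP scaler0.
Qed.

(** This is [q] times the matrix of the trace form: the kernel is the same, but the entries lie in
    [S] and have bounded degree. *)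
Definition gram i k : S := \sum_l num_coord (b l * (b i * b k)) l.

Lemma trace_formE i k :
  trace_form mult_mx b i k = tofrac (gram i k) / tofrac q.
Proof.
rewrite mxE rmorph_sum mulr_suml; apply: eq_bigr => l _.
by rewrite !mxE.
Qed.

Lemma msize_gram i k : (msize (gram i k) <= E + (E + E) + E)%N.
Proof.
apply: msize_sum_le => l _; apply: leq_trans (msize_num_coord _ _) _.
have [bb _ _ _] := basis_b.
by rewrite leq_add2r; do 2 apply: msizeM_leD => //.
Qed.

Lemma gram_radical (w : 'I_m.+1 -> S) :
  (forall k, \sum_i w i * gram i k = 0) <->
  (\row_i tofrac (w i)) *m trace_form mult_mx b = 0.
Proof.
have e k : ((\row_i tofrac (w i)) *m trace_form mult_mx b) 0 k =
    tofrac (\sum_i w i * gram i k) / tofrac q.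
  rewrite mxE rmorph_sum mulr_suml; apply: eq_bigr => i _.
  by rewrite mxE trace_formE /= tofracM mulrA.
split=> [h|h k]; first by apply/rowP => k; rewrite e h tofrac0 mul0r mxE.
have /eqP := e k; rewrite h mxE eq_sym mulf_eq0 invr_eq0 (negbTE fq0) orbF.
by rewrite tofrac_eq0 => /eqP.
Qed.

(** A nonzero radical can be represented by a vector with small entries in [S], so the corresponding
    element, like the basis elements, is covered by the irreducibility hypothesis. *)
Lemma coord_domain d :
  (forall A : 'I_m.+1 -> 'I_m.+1 -> S,
     (forall i k, (msize (A i k) <= E + (E + E) + E)%N) ->
     (exists2 w, (exists i, w i != 0) & forall k, \sum_i w i * A i k = 0) ->
     exists2 w, (exists i, w i != 0) & (forall k, \sum_i w i * A i k = 0) /\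
       forall i, (msize (w i) <= d)%N) ->
  (forall a, (msize a <= d + E)%N -> exists2 g : {poly S},
      irreducible_poly (map_poly (@tofrac _) g) & I (map_poly psi g).[a]) ->
  (forall p, msize (psi p) <= msize p)%N ->
  forall f g, I (f * g) -> I (psi q * f) \/ I (psi q * g).
Proof.
move=> kerA irr bpsi f g Ifg.
have charF k : k.+1%:R != 0 :> F.
  rewrite -(rmorph_nat (@tofrac S)) tofrac_eq0 -mpolyC_nat mpolyC_eq0.
  by rewrite pnatr_eq0.
have [bb _ _ _] := basis_b.
have := coordinates_domain charF coordM coord_basis => dom.
have Ifg0 : coord (f * g) = 0 by apply/coord0; apply: idealMl.
have irr_mx a : (msize a <= d + E)%N ->
    exists2 g, irreducible_poly g & horner_mx (mult_mx a) g = 0.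
  case/irr => h irr_h Ih; exists (map_poly (@tofrac _) h) => //.
  exact: horner_mult_mx.
case: (dom _ _ f g Ifg0) => [i|v v0 vt|/coord0|/coord0]; try by [left|right].
  by apply: irr_mx; rewrite (leq_trans (bb i)) ?leq_addl.
have [s [w [s0 hw]]] := common_denominator (v 0).
have ew : \row_i tofrac (w i) = tofrac s *: v.
  by apply/rowP => i; rewrite !mxE hw.
have [|w' [i w'i] [kw' bw']] := kerA gram (fun i k => msize_gram i k).
  exists w.
    case/rV0Pn: v0 => i vi; exists i; apply: contraNneq vi => wi0.
    by have := hw i; rewrite wi0 tofrac0 => /eqP; rewrite mulf_eq0 tofrac_eq0 (negbTE s0).
  by apply/gram_radical; rewrite ew -scalemxAl vt scaler0.
exists (\sum_i psi (w' i) * b i); split.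
- rewrite coord_comb; apply/rV0Pn; exists i; by rewrite mxE tofrac_eq0.
- by rewrite coord_comb; apply/gram_radical.
- apply: irr_mx; apply: msize_sum_le => k _; apply: msizeM_leD => //.
  exact: leq_trans (bpsi _) (bw' k).
Qed.

End Coordinates.

Section PrimeBound.
Variables (K : numFieldType) (n : nat).
Local Notation R := {mpoly K[n]}.

Lemma prime_test_le B B' (I : R -> Prop) : (B <= B')%N ->
  prime_test B' I -> prime_test B I.
Proof. by move=> BB' h f g fB gB; apply: h; apply: leq_trans BB'. Qed.

(** The rank of the quotient varies with the ideal, so one bound has to serve all matrix sizes up to
    [m.+1]. *)
Lemma kernel_bound j d m : exists E, forall k, (k <= m)%N ->
  forall A : 'I_k.+1 -> 'I_k.+1 -> {mpoly K[j]},
  (forall i l, (msize (A i l) <= d)%N) ->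
  (exists2 w, (exists i, w i != 0) & forall l, \sum_i w i * A i l = 0) ->
  exists2 w, (exists i, w i != 0) & (forall l, \sum_i w i * A i l = 0) /\
    forall i, (msize (w i) <= E)%N.
Proof.
apply: bounded_choice => [k|k E E' EE' h A bA ex]; last first.
  have [w w0 [kw bw]] := h A bA ex; exists w => //; split=> // i.
  exact: leq_trans (bw i) EE'.
have [E hE] := hermann_fin K j 'I_k.+1 'I_k.+1 d.
exists E => A bA [w [i wi] kw].
have [+ _] := hE (fun l i => A i l) (fun=> 0) (fun l i => bA i l)
  (fun _ => leq_trans (eq_leq (msize0 _ _)) (leq0n _)).
case/(_ _ kw) => T [V [h [hV eV]]].
have [l Vl] : exists l, V l i != 0.
  apply: contrapT => nV; case/eqP: wi; rewrite eV big1 // => l _.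
  have /eqP -> : V l i == 0 by apply: contrapT => /negP h0; apply: nV; exists l.
  by rewrite mulr0.
by have [k1 k2] := hV l; exists (V l); [exists i|].
Qed.

(* Elements multiplied into the ideal by [a] are generated by small ones, to
   which the test applies. *)
Lemma colon_bound (T : finType) d : exists B, forall (g : T -> R) a,
  (forall l, (msize (g l) <= d)%N) -> (msize a <= d)%N ->
  prime_test B (mem_ideal g) -> ~ mem_ideal g a ->
  forall f, mem_ideal g (a * f) -> mem_ideal g f.
Proof.
have [B hB] := hermann_fin K n (option T) unit d.
exists (d + B)%N => g a bg ba test na f [h eh].
have idI := mem_ideal_is_ideal g.
pose A (_ : unit) o := if o is Some l then - g l else a.
have bA x o : (msize (A x o) <= d)%N by case: o => [l|] //=; rewrite mmeasureN.
have [+ _] := hB A (fun=> 0) bA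
  (fun _ => leq_trans (eq_leq (msize0 _ _)) (leq0n _)).
case/(_ (fun o => if o is Some l then h l else f)) => [u|U [V [k [hV eV]]]].
  rewrite big_option /= mulrC eh; under [X in _ + X]eq_bigr do rewrite mulrN.
  by rewrite sumrN subrr.
rewrite (eV None); apply: ideal_sum => // u _; apply: idealMl => //.
have [kV bV] := hV u; have := kV tt; rewrite big_option /= => e.
case: (test a (V u None)) => //.
- by apply: leq_trans ba _; rewrite leq_addr.
- by apply: leq_trans (bV _) _; rewrite leq_addl.
exists (fun l => V u (Some l)); rewrite mulrC; apply/eqP.
rewrite -subr_eq0 -sumrN; apply/eqP; rewrite -[RHS]e; congr (_ + _).
by apply: eq_bigr => l _; rewrite mulrN.
Qed.

Lemma independent_prime_bound j (X : finType) E (T : finType) D : exists L B,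
  forall (g : T -> R) (psi : {rmorphism {mpoly K[j]} -> R}) (e : X -> R),
  (forall l, (msize (g l) <= D)%N) -> ~ mem_ideal g 1 ->
  prime_test B (mem_ideal g) -> presentation (mem_ideal g) E psi e ->
  (forall p, p != 0 -> (msize p <= L)%N -> ~ mem_ideal g (psi p)) ->
  forall f h, mem_ideal g (f * h) -> mem_ideal g f \/ mem_ideal g h.
Proof.
have [L hL] := injective_bound K n j X E.
have [E' hE'] := basis_exists K n j X E.
have [d hd] := kernel_bound j (E' + (E' + E') + E') #|X|.
(* The size [d + E'] is that of a combination of basis elements with small radical coefficients;
   [#|X|.+1] bounds the degree of a dependence among powers, the rank being at most [#|X|]. *)
have [B1 hB1] := irreducible_relation K n j X E (d + E') #|X|.+1.
have [B2 hB2] := colon_bound T (D + E').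
exists L, (B1 + B2)%N => g psi e bg n1 test pres hl f h Ifh.
have idI := mem_ideal_is_ideal g.
have inj := hL _ psi e idI pres hl.
have [m [b [q [mX basis_b]]]] := hE' _ psi e idI pres.
have [bpsi _ _ _] := pres; have [bb [bq q0] indep red] := basis_b.
(* An empty basis would put [psi q] into the ideal, against injectivity. *)
case: m => [|m] in b mX basis_b bb indep red *.
  have [c [+ _]] := red 1; rewrite big_ord0 subr0 mulr1 => /inj q00.
  by rewrite q00 eqxx in q0.
have colon p : mem_ideal g (psi q * p) -> mem_ideal g p.
  apply: hB2 => [l|||].
  - by apply: leq_trans (bg l) _; rewrite leq_addr.
  - by apply: leq_trans (bpsi q) (leq_trans bq _); rewrite leq_addl.
  - by apply: prime_test_le test; rewrite leq_addl.
  - by move/inj => q00; rewrite q00 eqxx in q0.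
have irr a : (msize a <= d + E')%N -> exists2 p : {poly {mpoly K[j]}},
    irreducible_poly (map_poly (@tofrac _) p) & mem_ideal g (map_poly psi p).[a].
  move=> ba; apply: (hB1 _ psi e idI pres inj) => //.
    by apply: prime_test_le test; rewrite leq_addr.
  have [r [r0 sr Ir]] := algebraic_relation idI basis_b a.
  by exists r; split=> //; apply: leq_trans sr _; rewrite ltnS leqW.
by case: (coord_domain idI basis_b (hd m (ltnW mX)) irr bpsi Ifh) => /colon;
  [left | right].
Qed.

(** Whether a variable can be eliminated depends on the ideal, so the bounds of both cases are
    added. Without variables, a nonzero polynomial sent into the ideal is a constant and would give
    1. *)
Lemma presented_prime_bound j (X : finType) E (T : finType) D : exists B,
  forall (g : T -> R) (psi : {rmorphism {mpoly K[j]} -> R}) (e : X -> R),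
  (forall l, (msize (g l) <= D)%N) -> ~ mem_ideal g 1 ->
  prime_test B (mem_ideal g) -> presentation (mem_ideal g) E psi e ->
  forall f h, mem_ideal g (f * h) -> mem_ideal g f \/ mem_ideal g h.
Proof.
elim: j => [|j IHj] in X E *.
  have [L [B hB]] := independent_prime_bound 0 X E T D.
  exists B => g psi e bg n1 test pres; apply: hB pres _ => // p p0 _ Ip.
  have [c ep] : exists c : K, p = c%:MP.
    by exists p@_0; apply: msize1_polyC; apply/msize_leP => m; rewrite mdegE big_ord0.
  have c0 : c != 0 by apply: contra p0 => /eqP c0; rewrite ep c0 mpolyC0.
  apply: n1; have -> : 1 = psi (c^-1%:MP) * psi p.
    by rewrite -rmorphM ep -mpolyCM mulVf // rmorph1.
  exact: (idealMl (mem_ideal_is_ideal g)).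
have [L [B hB]] := independent_prime_bound j.+1 X E T D.
have [E' hE'] := presentation_step K n j X E L.
have [B' hB'] := IHj (X * 'I_L)%type E'.
exists (B + B')%N => g psi e bg n1 test pres.
have [[p [p0 pL Ip]]|np] := pselect (exists p : {mpoly K[j.+1]},
    [/\ p != 0, (msize p <= L)%N & mem_ideal g (psi p)]).
  have [psi' [e' pres']] := hE' _ _ _ (mem_ideal_is_ideal g) pres p p0 pL Ip.
  apply: hB' pres' => //; by apply: prime_test_le test; rewrite leq_addl.
apply: hB pres _ => //; first by apply: prime_test_le test; rewrite leq_addr.
by move=> p p0 pL Ip; apply: np; exists p.
Qed.

Theorem prime_bound (T : finType) D : exists B, forall g : T -> R,
  (forall l, (msize (g l) <= D)%N) -> ~ mem_ideal g 1 ->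
  prime_test B (mem_ideal g) ->
  forall f h, mem_ideal g (f * h) -> mem_ideal g f \/ mem_ideal g h.
Proof.
have [B hB] := presented_prime_bound n unit D.+1 T D.
exists B => g bg n1 test.
(* Initially the quotient is presented over the whole polynomial ring by the generator 1, with the
   [g l] as generating relations. *)
apply: (hB g (idfun : {rmorphism _ -> _}) (fun=> 1)) => //.
split=> [//|_|f|c]; first by rewrite msize1.
  exists (fun=> f); split=> //.
  by rewrite sum_unit mulr1 subrr; apply: ideal0; apply: mem_ideal_is_ideal.
rewrite sum_unit mulr1 /= => -[h eh].
exists T, (fun l _ => g l), h; split=> [l|[]//].
split=> [|_]; last by rewrite leqW.
by rewrite sum_unit mulr1 /=; apply: mem_ideal_gen.
Qed.

End PrimeBound.

(** * Solutions of bounded level *)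

Section Levels.
Variable K : numClosedFieldType.

(* An abstract bound on the height: [t] depends on the operation and on the
   number of coefficients, but not on the degree of the algebraic numbers. *)
Record level_structure (lev : nat -> K -> Prop) : Prop := {
  lev_le : forall t t' x, (t <= t')%N -> lev t x -> lev t' x;
  lev_nat : forall k, exists t, lev t k%:R;
  lev_add : forall t, exists t', forall x y, lev t x -> lev t y -> lev t' (x + y);
  lev_mul : forall t, exists t', forall x y, lev t x -> lev t y -> lev t' (x * y);
  lev_opp : forall t, exists t', forall x, lev t x -> lev t' (- x);
  lev_inv : forall t, exists t', forall x, lev t x -> lev t' x^-1;
  lev_root : forall t d, exists t', forall p : {poly K}, p != 0 ->
    (size p <= d)%N -> (forall i, lev t p`_i) ->
    forall x, root p x -> lev t' x }.

Variables (lev : nat -> K -> Prop) (hlev : level_structure lev).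

Lemma lev0_nat t : exists t', (t <= t')%N /\ lev t' 0 /\ lev t' 1.
Proof.
have [t0 h0] := lev_nat hlev 0; have [t1 h1] := lev_nat hlev 1.
exists (t + t0 + t1)%N; split; first by rewrite -addnA leq_addr.
split; first by apply: lev_le h0 => //; rewrite addnAC leq_addl.
by apply: lev_le h1 => //; rewrite leq_addl.
Qed.

Lemma lev_sum (I : finType) t : exists t', forall F : I -> K,
  (forall i, lev t (F i)) -> forall P : pred I, lev t' (\sum_(i | P i) F i).
Proof.
suff [t' ht] : exists t', forall (F : I -> K) (r : seq I) (P : pred I),
    (forall i, lev t (F i)) -> (size r <= #|I|)%N ->
    lev t' (\sum_(i <- r | P i) F i).
  by exists t' => F hF P; apply: ht => //; rewrite cardT enumT.
elim: #|I| => [|k [t1 IHk]].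
  have [t' [_ [h0 _]]] := lev0_nat 0; exists t' => F [|//] P _ _.
  by rewrite big_nil.
have [t2 ht2] := lev_add hlev (t + t1).
exists (t1 + t2)%N => F [|i r] P hF sr.
  by apply: lev_le (IHk F [::] P hF _) => //; rewrite leq_addr.
have IH := IHk F r P hF sr; rewrite big_cons; case: ifP => _; last first.
  by apply: lev_le IH => //; rewrite leq_addr.
apply: lev_le (ht2 _ _ (lev_le hlev _ (hF i)) (lev_le hlev _ IH)) => //;
  by rewrite ?leq_addl ?leq_addr.
Qed.

(** Gaussian elimination, one equation at a time: the number of operations depends only on the
    numbers of equations and unknowns, so levels stay bounded. *)
Lemma linear_system_seq (I : finType) k t : exists t',
  forall (J : eqType) (s : seq J) (A : J -> I -> K) (b : J -> K),
  (size s <= k)%N -> (forall j i, lev t (A j i)) -> (forall j, lev t (b j)) ->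
  (exists f, {in s, forall j, \sum_i f i * A j i = b j}) ->
  exists f, (forall i, lev t' (f i)) /\ {in s, forall j, \sum_i f i * A j i = b j}.
Proof.
elim: k t => [|k IHk] t.
  have [t' [_ [h0 _]]] := lev0_nat 0; exists t' => J [|//] A b _ _ _ _.
  by exists (fun=> 0).
have [t0 [t0t [t00 _]]] := lev0_nat t.
have [u1 hu1] := lev_inv hlev t0.
have [u2 hu2] := lev_mul hlev (t0 + u1).
have [u3 hu3] := lev_mul hlev (t0 + u2).
have [u4 hu4] := lev_opp hlev u3.
have [u5 hu5] := lev_add hlev (t0 + u4).
have [v hv] := IHk (t0 + u5)%N.
have [w1 hw1] := lev_mul hlev (t0 + v).
have [w2 hw2] := lev_sum I w1.
have [w3 hw3] := lev_opp hlev w2.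
have [w4 hw4] := lev_add hlev (t0 + w3).
have [w5 hw5] := lev_mul hlev (w4 + u1).
exists (v + w5)%N => J [|j0 s] A b sk hA hb [f hf].
  have [f0 [lf0 _]] := hv J [::] (fun _ _ => 0) (fun=> 0) isT
    (fun _ _ => lev_le hlev (leq_addr _ _) t00)
    (fun _ => lev_le hlev (leq_addr _ _) t00) (ex_intro _ (fun=> 0) (fun j => fun h => match notF h with end)).
  by exists f0; split=> // i; apply: lev_le (lf0 i) => //; rewrite leq_addr.
have {}hA j i : lev t0 (A j i) by apply: lev_le (hA j i).
have {}hb j : lev t0 (b j) by apply: lev_le (hb j).
have fs : {in s, forall j, \sum_i f i * A j i = b j}.
  by move=> j js; apply: hf; rewrite inE js orbT.
have f0 : \sum_i f i * A j0 i = b j0 by apply: hf; rewrite inE eqxx.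
have lift_lev x T T' : (T <= T')%N -> lev T x -> lev T' x by exact: lev_le.
have [[i0 a0]|na] := pselect (exists i, A j0 i != 0); last first.
  have A0 i : A j0 i = 0 by apply/eqP/negPn/negP => h; apply: na; exists i.
  have [||||g [lg hg]] := hv J s A b; rewrite //.
  - by move=> j i; apply: lift_lev (hA j i); rewrite leq_addr.
  - by move=> j; apply: lift_lev (hb j); rewrite leq_addr.
  - by exists f.
  exists g; split=> [i|j]; first by apply: lift_lev (lg i); rewrite leq_addr.
  rewrite inE => /orP[/eqP->|/hg//].
  by rewrite -f0 !big1 // => i _; rewrite A0 mulr0.
pose a := A j0 i0; pose c j := A j i0 / a.
have lc j : lev u2 (c j).
  apply: hu2; first by apply: lift_lev (hA j i0); rewrite leq_addr.
  by apply: lift_lev (hu1 _ (hA j0 i0)); rewrite leq_addl.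
have lsub x y j : lev t0 x -> lev t0 y -> lev u5 (x - c j * y).
  move=> lx ly; apply: hu5; first by apply: lift_lev lx; rewrite leq_addr.
  apply: (lift_lev _ u4); first by rewrite leq_addl.
  apply: hu4; apply: hu3; first by apply: lift_lev (lc j); rewrite leq_addl.
  by apply: lift_lev ly; rewrite leq_addr.
(* With a zero pivot column, the pivot unknown can later be reset by back-substitution without
   disturbing the reduced equations. *)
pose A' j i := if i == i0 then 0 else A j i - c j * A j0 i.
pose b' j := b j - c j * b j0.
have rest j (g : I -> K) : \sum_i g i * A' j i =
    \sum_i g i * A j i - c j * \sum_i g i * A j0 i.
  rewrite mulr_sumr -sumrB; apply: eq_bigr => i _; rewrite /A'.
  case: eqP => [->|_]; last by ring.
  by rewrite mulr0 /c mulrCA mulfVK // subrr.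
have [||||g [lg hg]] := hv J s A' b'; rewrite //.
- move=> j i; rewrite /A'; case: ifP => _.
    by apply: lift_lev t00; rewrite leq_addr.
  by apply: lift_lev (lsub _ _ _ (hA j i) (hA j0 i)); rewrite leq_addl.
- by move=> j; apply: lift_lev (lsub _ _ _ (hb j) (hb j0)); rewrite leq_addl.
- by exists f => j js; rewrite rest fs // f0.
pose y := (b j0 - \sum_(i | i != i0) g i * A j0 i) / a.
pose h i := if i == i0 then y else g i.
have sumh j : \sum_i h i * A j i = y * A j i0 + \sum_(i | i != i0) g i * A j i.
  rewrite (bigD1 i0) //= {1}/h eqxx; congr (_ + _); apply: eq_bigr => i ni.
  by rewrite /h (negbTE ni).
have h0 : \sum_i h i * A j0 i = b j0.
  by rewrite sumh /y mulfVK // subrK.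
exists h; split=> [i|j].
  rewrite /h; case: ifP => _; last by apply: lift_lev (lg i); rewrite leq_addr.
  apply: (lift_lev _ w5); first by rewrite leq_addl.
  apply: hw5; last by apply: lift_lev (hu1 _ (hA j0 i0)); rewrite leq_addl.
  apply: (lift_lev _ w4); first by rewrite leq_addr.
  apply: hw4; first by apply: lift_lev (hb j0); rewrite leq_addr.
  apply: (lift_lev _ w3); first by rewrite leq_addl.
  apply/hw3/hw2 => k'; apply: hw1; first by apply: lift_lev (lg k'); rewrite leq_addl.
  by apply: lift_lev (hA j0 k'); rewrite leq_addr.
rewrite inE => /orP[/eqP->//|js].
have := hg j js; have -> : \sum_i g i * A' j i = \sum_i h i * A' j i.
  by apply: eq_bigr => i _; rewrite /h /A'; case: eqP; rewrite ?mulr0.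
rewrite rest h0 /b' => /eqP; rewrite (inj_eq (addIr _)) => /eqP //.
Qed.

Lemma linear_system (I J : finType) t : exists t',
  forall (A : J -> I -> K) (b : J -> K),
  (forall j i, lev t (A j i)) -> (forall j, lev t (b j)) ->
  (exists f, forall j, \sum_i f i * A j i = b j) ->
  exists f, (forall i, lev t' (f i)) /\ forall j, \sum_i f i * A j i = b j.
Proof.
have [t' ht] := linear_system_seq I #|J| t; exists t' => A b hA hb [f hf].
have [||g [lg hg]] := ht J (enum J) A b _ hA hb; first by rewrite cardE.
  by exists f => j _; apply: hf.
by exists g; split=> // j; apply: hg; rewrite mem_enum.
Qed.

End Levels.

(** * A Nullstellensatz with zeros of bounded level *)

Section Nullstellensatz.
Variables (K : numClosedFieldType) (lev : nat -> K -> Prop).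
Hypothesis hlev : level_structure lev.

Lemma mcoeffMX_if n (p : {mpoly K[n]}) m k :
  (p * 'X_[m])@_k = if (m <= k)%MM then p@_(k - m) else 0.
Proof.
case: ifP => mk; first by rewrite -[in LHS](submK mk) addmC mcoeffMX.
apply/eqP; rewrite mcoeff_eq0 (perm_mem (msuppMX _ _)).
apply/negP => /mapP[m' _ e]; move: mk; rewrite e => /negP[].
by apply/mnm_lepP => i; rewrite mnmDE leq_addr.
Qed.

Definition extend (T : Type) (R : Type) (g : T -> R) (y : R) (o : option T) :=
  if o is Some l then g l else y.

Lemma extend_unit (R : comNzRingType) (T : finType) (g : T -> R) y :
  mem_ideal (extend g y) 1 <-> exists b, mem_ideal g (1 - b * y).
Proof.
split=> [[h eh]|[b [h eh]]].
  exists (h None), (fun l => h (Some l)).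
  by rewrite [in LHS]eh big_option /= addrAC subrr add0r.
exists (extend h b); rewrite big_option /= -eh; ring.
Qed.

Lemma prod_unit_mod (R : comNzRingType) (T : finType) (g : T -> R)
    (I : eqType) (r : seq I) (F : I -> R) :
  {in r, forall i, exists b, mem_ideal g (1 - b * F i)} ->
  exists b, mem_ideal g (1 - b * \prod_(i <- r) F i).
Proof.
have idI := mem_ideal_is_ideal g.
elim: r => [_|i r IHr hr].
  by exists 1; rewrite big_nil mulr1 subrr; apply: ideal0.
have [b Ib] := hr i (mem_head _ _).
have [|c Ic] := IHr; first by move=> k kr; apply: hr; rewrite inE kr orbT.
exists (b * c); rewrite big_cons.
have -> : 1 - b * c * (F i * \prod_(k <- r) F k) =
   (1 - b * F i) + b * F i * (1 - c * \prod_(k <- r) F k) by ring.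
by apply: idealD => //; apply: idealMl.
Qed.

Definition var_eval m (i : 'I_m) (p : {poly K}) : {mpoly K[m]} :=
  (map_poly (@mpolyC m K) p).['X_i].

Lemma var_evalE m (i : 'I_m) (p : {poly K}) k : (size p <= k)%N ->
  var_eval i p = \sum_(a < k) p`_a *: 'X_i ^+ a.
Proof.
move=> pk; rewrite /var_eval (@horner_coef_wide _ k).
  by apply: eq_bigr => a _; rewrite coef_map mul_mpolyC.
exact: leq_trans (size_poly _ _) pk.
Qed.

(* If [N.+1] integer translates of ['X_i] are units modulo the ideal, their
   inverses of bounded degree are linearly dependent; clearing denominators
   yields a nonzero polynomial in ['X_i] alone. *)
Lemma inverse_dependence m (T : finType) (g : T -> {mpoly K[m]}) i E
    (N := #|{: 'X_{1..m < E}}|) :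
  (forall k : 'I_N.+1, exists b : {mpoly K[m]}, (msize b <= E)%N /\
     mem_ideal g (1 - b * ('X_i - k%:R))) ->
  exists p : {poly K}, [/\ p != 0, (size p <= N.+1)%N & mem_ideal g (var_eval i p)].
Proof.
move=> /choice[b hb]; have idI := mem_ideal_is_ideal g.
pose A : 'M[K]_(N.+1, N) :=
  \matrix_(k < N.+1, j < N) (b k)@_(enum_val j : 'X_{1..m < E}).
have [v v0 vA] : exists2 v : 'rV_N.+1, v != 0 & v *m A = 0.
  have : kermx A != 0.
    by rewrite -mxrank_eq0 mxrank_ker subn_eq0 -ltnNge ltnS rank_leq_col.
  by case/rowV0Pn => v /sub_kermxP vA v0; exists v.
have vb : \sum_k v 0 k *: b k = 0.
  apply/mpolyP => mu; rewrite mcoeff0 raddf_sum /=.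
  have [muE|Emu] := ltnP (mdeg mu) E; last first.
    rewrite big1 // => k _; rewrite mcoeffZ; have [bE _] := hb k.
    by have /msize_leP -> := bE; rewrite ?mulr0.
  have /rowP/(_ (enum_rank (BMultinom muE))) := vA; rewrite !mxE => {2}<-.
  by apply: eq_bigr => k _; rewrite mcoeffZ mxE enum_rankK.
pose q (k : 'I_N.+1) : {poly K} := \prod_(l < N.+1 | l != k) ('X - (l%:R)%:P).
pose p := \sum_k v 0 k *: q k.
have natI (k l : 'I_N.+1) : (k%:R - l%:R == 0 :> K) = (k == l).
  by rewrite subr_eq0 eqr_nat.
exists p; split.
- case/rV0Pn: v0 => k vk; apply: contraNneq vk => p0.
  have : p.[k%:R] == 0 by rewrite p0 horner0.
  rewrite /p horner_sum (bigD1 k) //= big1 ?addr0 => [|l lk].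
    rewrite hornerZ mulf_eq0 => /orP[//|]; rewrite /q horner_prod prodf_seq_eq0.
    case/hasP => l _ /andP[lk]; rewrite hornerXsubC natI => /eqP e.
    by rewrite e eqxx in lk.
  rewrite hornerZ /q horner_prod (bigD1 k) 1?eq_sym //= hornerXsubC subrr.
  by rewrite mul0r mulr0.
- apply: leq_trans (size_sum _ _ _) _; apply/bigmax_leqP => k _.
  apply: leq_trans (size_scale_leq _ _) _.
  rewrite /q -big_filter size_prod_XsubC size_filter -sum1_count sum1_card.
  by rewrite cardC1 card_ord.
pose Q (k : 'I_N.+1) : {mpoly K[m]} := 'X_i - k%:R.
pose qX (k : 'I_N.+1) := \prod_(l < N.+1 | l != k) Q l.
have evq k : var_eval i (q k) = qX k.
  rewrite /var_eval /q /qX rmorph_prod horner_prod; apply: eq_bigr => l _.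
  by rewrite rmorphB /= map_polyX map_polyC hornerXsubC /= mpolyC_nat.
(* Up to elements of the ideal, [qX k] is [b k] times the full product of the [Q k]; the resulting
   main term vanishes because the [b k] are dependent. *)
have -> : var_eval i p = \sum_k v 0 k *: (qX k * (1 - b k * Q k)) +
    (\sum_k v 0 k *: b k) * \prod_k Q k.
  have -> : var_eval i p = \sum_k v 0 k *: qX k.
    rewrite /var_eval /p rmorph_sum horner_sum; apply: eq_bigr => k _.
    by rewrite -mul_polyC rmorphM /= map_polyC /= hornerM hornerC -evq mul_mpolyC.
  rewrite mulr_suml -big_split; apply: eq_bigr => k _ /=.
  rewrite (bigD1 k) //= -/(qX k) -scalerAl -scalerDr; congr (_ *: _); ring.
rewrite vb mul0r addr0; apply: ideal_sum => // k _.
by rewrite -mul_mpolyC; do 2 apply: idealMl => //; case: (hb k).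
Qed.

Lemma prod_var_eval m (i : 'I_m) (p : {poly K}) rs : p = lead_coef p *: \prod_(x <- rs) ('X - x%:P) ->
  var_eval i p = lead_coef p *: \prod_(x <- rs) ('X_i - x%:MP).
Proof.
move=> {1}->; rewrite /var_eval -mul_polyC rmorphM /= map_polyC hornerM hornerC.
rewrite rmorph_prod horner_prod /= mul_mpolyC; congr (_ *: _).
by apply: eq_bigr => x _; rewrite rmorphB /= map_polyX map_polyC hornerXsubC.
Qed.

(** If no natural number up to [N] is a possible value of ['X_i], [inverse_dependence] puts a
    polynomial in ['X_i] alone into the ideal, and it can be rechosen of bounded level. One of its
    roots works: otherwise its linear factors, and hence the polynomial itself, would be units
    modulo the ideal that contains it. *)
Lemma small_coordinate m (T : finType) d t : exists t',
  forall g : T -> {mpoly K[m]}, (forall l, msize (g l) <= d)%N ->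
  (forall l mu, lev t (g l)@_mu) -> ~ mem_ideal g 1 ->
  forall i : 'I_m, exists2 x, lev t' x & ~ mem_ideal (extend g ('X_i - x%:MP)) 1.
Proof.
have [E hE] := hermann_fin K m (option T) unit (2 + d).
pose N := #|{: 'X_{1..m < E}}|.
have [E2 hE2] := hermann_fin K m T unit (N.+2 + d).
have [t0 [tt0 [lev0 lev1]]] := lev0_nat hlev t.
have [t1 ht1] := lev_opp hlev t0.
pose W := (N.+2 + (E2 + d))%N.
have [t2 ht2] := linear_system hlev ('I_N.+1 + T * 'X_{1..m < E2})%type
  (option 'X_{1..m < W}) (t0 + t1).
have [t3 ht3] := lev_root hlev (t0 + t2) N.+1.
have [u hu] : exists u, forall k, (k <= N)%N -> lev u k%:R.
  apply: (bounded_choice (P := fun k u => lev u k%:R)) => [k|k a b].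
    exact: lev_nat.
  exact: lev_le.
exists (u + t3)%N => g bg lg n1 i; have idI := mem_ideal_is_ideal g.
have liftl x a b : (a <= b)%N -> lev a x -> lev b x by exact: lev_le.
have [[k kN]|nk] := pselect (exists2 k, (k <= N)%N &
    ~ mem_ideal (extend g ('X_i - (k%:R)%:MP)) 1).
  by move=> nk; exists k%:R => //; apply: liftl (hu k kN); rewrite leq_addr.
have msX a : (msize ('X_i ^+ a : {mpoly K[m]}) = a.+1)%N.
  by rewrite mpolyXn msizeX mdegMn mdeg1 mul1n.
have [p [p0 sp Ip]] : exists p : {poly K},
    [/\ p != 0, (size p <= N.+1)%N & mem_ideal g (var_eval i p)].
  apply: (@inverse_dependence m T g i E) => k.
  have : mem_ideal (extend g ('X_i - (k%:R)%:MP)) 1.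
    by apply: contrapT => h; apply: nk; exists k => //; rewrite -ltnS.
  case=> h eh.
  have bext (_ : unit) o : (msize (extend g ('X_i - (k%:R)%:MP)%R o) <= 2 + d)%N.
    case: o => [l|] /=; first by rewrite (leq_trans (bg l)) ?leq_addl.
    apply: (@leq_trans 2); rewrite ?leq_addr //; apply: msizeD_le.
      by rewrite msizeX mdeg1.
    by rewrite mmeasureN (leq_trans (msizeC_le _ _)).
  have b1 (_ : unit) : (msize (1 : {mpoly K[m]}) <= 2 + d)%N by rewrite msize1.
  have [_] := hE _ _ bext b1.
  case; first by exists h => _; rewrite -eh.
  move=> f [bf /(_ tt) ef]; exists (f None); split=> //.
  exists (fun l => f (Some l)); apply/esym/(canRL (addrK _)).
  by rewrite addrC -mpolyC_nat -[RHS]ef big_option.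
(* The coefficients of an element of the ideal in one variable solve a linear
   system, hence can be taken of bounded level. *)
have [a0 pa0] : exists a0 : 'I_N.+1, p`_a0 != 0.
  have ap : ((size p).-1 < N.+1)%N.
    by apply: leq_trans sp; rewrite prednK // size_poly_gt0.
  by exists (Ordinal ap); rewrite /= -lead_coefE lead_coef_eq0.
have [h [bh eh]] : exists h : T -> {mpoly K[m]},
    (forall l, msize (h l) <= E2)%N /\ var_eval i p = \sum_l h l * g l.
  have bg' (_ : unit) l : (msize (g l) <= N.+2 + d)%N.
    by rewrite (leq_trans (bg l)) ?leq_addl.
  have bp (_ : unit) : (msize (var_eval i p) <= N.+2 + d)%N.
    rewrite (var_evalE _ sp); apply: msize_sum_le => a _; apply: msizeZ_leq.
    by rewrite msX (leq_trans (ltn_ord a)) // (leq_trans (leqnSn _)) ?leq_addr.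
  have [_] := hE2 _ _ bg' bp; case.
    by case: Ip => h eh; exists h => _; rewrite -eh.
  by move=> h [bh /(_ tt) eh]; exists h.
(* The equation [None] prescribes the value 1 for one coefficient, so the small solution is again a
   nonzero polynomial. *)
pose A (o : option 'X_{1..m < W}) (z : 'I_N.+1 + T * 'X_{1..m < E2}) : K :=
  match o, z with
  | None, inl a => (a == a0)%:R
  | None, inr _ => 0
  | Some mu, inl a => ('X_i ^+ a : {mpoly K[m]})@_mu
  | Some mu, inr y => - (g y.1 * 'X_[y.2])@_mu
  end.
pose B (o : option 'X_{1..m < W}) : K := if o is None then 1 else 0.
have sumN (f : 'I_N.+1 + T * 'X_{1..m < E2} -> K) :
    \sum_z f z * A None z = f (inl a0).
  rewrite big_sumType /= (bigD1 a0) //= eqxx mulr1 !big1 ?addr0 // => [y _|a].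
    by rewrite mulr0.
  by move=> /negbTE->; rewrite mulr0.
have sumS (f : 'I_N.+1 + T * 'X_{1..m < E2} -> K) mu : \sum_z f z * A (Some mu) z =
    (\sum_(a < N.+1) f (inl a) *: 'X_i ^+ a -
     \sum_l (\sum_(nu : 'X_{1..m < E2}) f (inr (l, nu)) *: 'X_[nu]) * g l)@_mu.
  rewrite big_sumType /= mcoeffB !raddf_sum /=; congr (_ + _).
    by apply: eq_bigr => a _; rewrite mcoeffZ.
  transitivity (\sum_l \sum_(nu : 'X_{1..m < E2})
      f (inr (l, nu)) * A (Some mu) (inr (l, nu))).
    by rewrite pair_bigA; apply: eq_bigr => -[].
  apply: eq_bigr => l _; rewrite mulr_suml raddf_sum -sumrN.
  by apply: eq_bigr => nu _; rewrite /= -scalerAl mcoeffZ mulrN mulrC [_ * g l]mulrC mulrC.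
have lA o z : lev (t0 + t1) (A o z).
  have l0 : lev (t0 + t1) 0 by apply: liftl lev0; rewrite leq_addr.
  have l1 : lev (t0 + t1) 1 by apply: liftl lev1; rewrite leq_addr.
  case: o z => [mu|] [a|[l nu]] //=; last by case: eqP.
    by rewrite mpolyXn mcoeffX; case: eqP.
  apply: (liftl _ t1); rewrite ?leq_addl //; apply: ht1.
  by rewrite mcoeffMX_if; case: ifP => // _; apply: liftl (lg _ _).
have lB o : lev (t0 + t1) (B o).
  by case: o => [mu|]; [apply: liftl lev0 | apply: liftl lev1]; rewrite leq_addr.
have [|f [lf ef]] := ht2 A B lA lB.
  exists (fun z : 'I_N.+1 + T * 'X_{1..m < E2} => match z with inl a => p`_a / p`_a0
                   | inr y => (h y.1)@_(y.2) / p`_a0 end).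
  case=> [mu|]; last by rewrite sumN mulfV.
  rewrite sumS /=.
  have -> : \sum_(a < N.+1) (p`_a / p`_a0) *: 'X_i ^+ a = (p`_a0)^-1 *: var_eval i p.
    rewrite (var_evalE _ sp) scaler_sumr; apply: eq_bigr => a _.
    by rewrite scalerA mulrC.
  have -> : \sum_l (\sum_(nu : 'X_{1..m < E2}) ((h l)@_nu / p`_a0) *: 'X_[nu]) * g l
      = (p`_a0)^-1 *: \sum_l h l * g l.
    rewrite scaler_sumr; apply: eq_bigr => l _.
    rewrite [in RHS](mpolywE (bh l)) scalerAl scaler_sumr; congr (_ * _).
    by apply: eq_bigr => nu _; rewrite scalerA mulrC.
  by rewrite eh subrr mcoeff0.
pose p' : {poly K} := \poly_(a < N.+1) f (inl (inord a)).
have p'E (a : 'I_N.+1) : p'`_a = f (inl a) by rewrite coef_poly ltn_ord inord_val.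
have p'0 : p' != 0.
  apply: contra_neq (oner_neq0 K) => p'0.
  by have := ef None; rewrite sumN -p'E p'0 coef0 => /esym.
have Ip' : mem_ideal g (var_eval i p').
  exists (fun l => \sum_(nu : 'X_{1..m < E2}) f (inr (l, nu)) *: 'X_[nu]).
  apply/eqP; rewrite -subr_eq0 (var_evalE _ (size_poly _ _)); apply/eqP/mpolyP => mu.
  under eq_bigr do rewrite p'E.
  rewrite mcoeff0; have [muW|Wmu] := ltnP (mdeg mu) W.
    exact: (etrans (esym (sumS f (BMultinom muW))) (ef (Some (BMultinom muW)))).
  set D := _ - _; have : (msize D <= W)%N.
    apply: msizeD_le.
      apply: msize_sum_le => a _; apply: msizeZ_leq; rewrite msX.
      by rewrite (leq_trans (ltn_ord a)) // (leq_trans (leqnSn _)) ?leq_addr.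
    apply: msizeN_le; apply: msize_sum_le => l _.
    apply: leq_trans (_ : E2 + d <= _)%N; last by rewrite leq_addl.
    apply: msizeM_leD => //; apply: msize_sum_le => nu _; apply: msizeZ_leq.
    by rewrite msizeX bmdeg.
  by move/msize_leP; apply.
have [rs ep'] := closed_field_poly_normal p'.
have [x xr nx] : exists2 x, x \in rs & ~ mem_ideal (extend g ('X_i - x%:MP)) 1.
  apply: contrapT => h'; apply: n1.
  have [x xr|b Ib] := @prod_unit_mod _ _ g _ rs (fun x => 'X_i - x%:MP).
    by apply/extend_unit; apply: contrapT => nx; apply: h'; exists x.
  rewrite (prod_var_eval i ep') in Ip'.
  rewrite -(subrK (b * \prod_(x <- rs) ('X_i - x%:MP)) 1); apply: idealD => //.
  apply: idealMl => //; have lc0 : lead_coef p' != 0 by rewrite lead_coef_eq0.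
  rewrite -[X in mem_ideal g X]scale1r -(mulVf lc0) -scalerA -mul_mpolyC.
  exact: idealMl.
exists x => //; apply: (liftl _ t3); rewrite ?leq_addl //.
apply: (ht3 p' p'0 (size_poly _ _)) => [a|].
  rewrite coef_poly; case: ltnP => _; first by apply: liftl (lf _); rewrite leq_addl.
  by apply: liftl lev0; rewrite leq_addr.
by rewrite ep' rootZ ?lead_coef_eq0 // root_prod_XsubC.
Qed.

Lemma eval_mod_ideal m (T : finType) (G : T -> {mpoly K[m]}) (x : 'I_m -> K) :
  (forall i, mem_ideal G ('X_i - (x i)%:MP)) ->
  forall p, mem_ideal G (p - (meval x p)%:MP).
Proof.
move=> hx; have idI := mem_ideal_is_ideal G.
have hM p q : mem_ideal G (p - (meval x p)%:MP) -> mem_ideal G (q - (meval x q)%:MP) ->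
    mem_ideal G (p * q - (meval x (p * q))%:MP).
  move=> hp hq; rewrite mevalM mpolyCM.
  have -> : p * q - (meval x p)%:MP * (meval x q)%:MP =
    q * (p - (meval x p)%:MP) + (meval x p)%:MP * (q - (meval x q)%:MP) by ring.
  by apply: idealD => //; apply: idealMl.
have h1 : mem_ideal G (1 - (meval x 1)%:MP).
  by rewrite meval1 subrr; apply: ideal0.
elim/mpolyind => [|c mu p _ _ IHp]; first by rewrite meval0 mpolyC0 subrr; apply: ideal0.
rewrite mevalD mevalZ mpolyCD mpolyCM -mul_mpolyC opprD addrACA -mulrBr.
apply: idealD => //; apply: idealMl => //; rewrite mpolyXE_id.
apply: (big_ind (fun q => mem_ideal G (q - (meval x q)%:MP))) => // i _.
by elim: (mu i) => [|e IHe]; rewrite ?expr0 // exprS; apply: hM; rewrite ?mevalXU.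
Qed.

(** Coordinates are fixed one by one by adjoining ['X_i - x]: the ideal stays proper, and the
    enlarged family still has bounded degree and level. *)
Lemma small_point_seq m k (T : finType) d t : exists t',
  forall g : T -> {mpoly K[m]}, (forall l, msize (g l) <= d)%N ->
  (forall l mu, lev t (g l)@_mu) -> ~ mem_ideal g 1 ->
  forall s : seq 'I_m, size s = k ->
  exists (T' : finType) (G : T' -> {mpoly K[m]}),
    [/\ forall l, mem_ideal G (g l), ~ mem_ideal G 1 &
     {in s, forall i, exists2 x, lev t' x & mem_ideal G ('X_i - x%:MP)}].
Proof.
elim: k T d t => [|k IHk] T d t.
  exists 0%N => g bg lg n1 s /size0nil ->; exists T, g.
  by split=> // l; apply: mem_ideal_gen.
have [t1 ht1] := small_coordinate m T d t.
have [t2 [t12 [lev0 lev1]]] := lev0_nat hlev (t + t1).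
have [t3 ht3] := lev_opp hlev t2.
have [t4 ht4] := IHk (option T) (2 + d)%N (t2 + t3)%N.
exists (t1 + t4)%N => g bg lg n1 [//|i s] [sk].
have liftl x a b : (a <= b)%N -> lev a x -> lev b x by exact: lev_le.
have [x lx nx] := ht1 g bg lg n1 i.
have lx2 : lev t2 x by apply: liftl lx; rewrite (leq_trans _ t12) ?leq_addl.
have [||T' [G [hG nG hs]]] := ht4 (extend g ('X_i - x%:MP)) _ _ nx s sk.
- case=> [l|] /=; first by rewrite (leq_trans (bg l)) ?leq_addl.
  apply: (@leq_trans 2); rewrite ?leq_addr //; apply: msizeD_le.
    by rewrite msizeX mdeg1.
  by rewrite mmeasureN (leq_trans (msizeC_le _ _)).
- case=> [l|] mu /=.
    apply: liftl (lg l mu); apply: leq_trans (leq_addr _ _).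
    by apply: leq_trans t12; rewrite leq_addr.
  have l0 : lev (t2 + t3) 0 by apply: liftl lev0; rewrite leq_addr.
  have l1 : lev (t2 + t3) 1 by apply: liftl lev1; rewrite leq_addr.
  rewrite mcoeffB mcoeffX mcoeffC; case: (eqVneq mu 0%MM) => [->|_].
    rewrite mnm1_eq0 mulr1 sub0r; apply: (liftl _ t3); rewrite ?leq_addl //.
    exact: ht3.
  by rewrite mulr0 subr0; case: eqP.
exists T', G; split=> [l|//|k']; first exact: (hG (Some l)).
rewrite inE => /orP[/eqP->|/hs[y ly hy]]; last first.
  by exists y => //; apply: liftl ly; rewrite leq_addl.
by exists x; [apply: liftl lx; rewrite leq_addr | apply: (hG None)].
Qed.

(** Modulo a proper ideal containing all the ['X_i - x i], each [g l] is congruent to its value at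
    [x], a constant that must vanish. *)
Theorem leveled_nullstellensatz m (T : finType) d t : exists t',
  forall g : T -> {mpoly K[m]}, (forall l, msize (g l) <= d)%N ->
  (forall l mu, lev t (g l)@_mu) -> ~ mem_ideal g 1 ->
  exists x : 'I_m -> K, (forall i, lev t' (x i)) /\ forall l, meval x (g l) = 0.
Proof.
have [t' ht'] := small_point_seq m m T d t; exists t' => g bg lg n1.
have [|T' [G [hG nG hs]]] := ht' g bg lg n1 (enum 'I_m); first by rewrite size_enum_ord.
have /choice[x hx] i : exists x, lev t' x /\ mem_ideal G ('X_i - x%:MP).
  by have [|x lx hx] := hs i; [rewrite mem_enum | exists x].
have idG := mem_ideal_is_ideal G.
exists x; split=> [i|l]; first by case: (hx i).
apply/eqP; apply: contraT => gx0; case: nG.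
have e := @eval_mod_ideal m T' G x (fun i => proj2 (hx i)) (g l).
have Gx : mem_ideal G (meval x (g l))%:MP by apply/(ideal_eqmod idG e).
rewrite -mpolyC1 -(mulVf gx0) mpolyCM; exact: idealMl.
Qed.

End Nullstellensatz.

(** * Failures of primality with bounded level *)

Section SmallWitness.
Variables (K : numClosedFieldType) (lev : nat -> K -> Prop).
Hypothesis hlev : level_structure lev.

(** These normal forms turn non-membership in [J] into the condition that some coefficient is
    nonzero, which can be normalized to an equation. *)
Lemma monomial_basis n (J : {mpoly K[n]} -> Prop) B : is_ideal J ->
  exists N : {set 'X_{1..n < B}},
    (forall c : 'X_{1..n < B} -> K, (forall x, x \notin N -> c x = 0) ->
       J (\sum_x c x *: 'X_[x]) -> forall x, c x = 0) /\
    (forall f, (msize f <= B)%N -> exists c : 'X_{1..n < B} -> K,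
       (forall x, x \notin N -> c x = 0) /\ J (f - \sum_x c x *: 'X_[x])).
Proof.
move=> idJ; have JZ a p : J p -> J (a *: p).
  by rewrite -mul_mpolyC; apply: idealMl.
pose indep (N : {set 'X_{1..n < B}}) := forall c : 'X_{1..n < B} -> K,
  (forall x, x \notin N -> c x = 0) -> J (\sum_x c x *: 'X_[x]) ->
  forall x, c x = 0.
have ex0 : exists N, `[< indep N >].
  by exists finset.set0; apply/asboolP => c c0 _ x; apply: c0; rewrite inE.
have [N /maxsetP[/asboolP indN maxN]] := ex_maxset ex0.
exists N; split=> // f fB.
have /choice[w hw] (x : 'X_{1..n < B}) : exists w : 'X_{1..n < B} -> K,
    (forall y, y \notin N -> w y = 0) /\ J ('X_[x] - \sum_y w y *: 'X_[y]).
  have [xN|xN] := boolP (x \in N).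
    exists (fun y => (y == x)%:R); split=> [y yN|].
      by case: eqP => // e; rewrite -e (negbTE yN) in xN.
    rewrite (bigD1 x) //= eqxx scale1r big1 ?addr0 ?subrr; first exact: ideal0.
    by move=> y /negbTE->; rewrite scale0r.
  have [c [sc [Jc [y0 cy0]]]] : exists c : 'X_{1..n < B} -> K,
      (forall y, y \notin (x |: N)%SET -> c y = 0) /\
      (J (\sum_y c y *: 'X_[y]) /\ exists y, c y <> 0).
    apply: contrapT => h; suff : (x |: N)%SET = N.
      by move/setP/(_ x); rewrite !inE eqxx (negbTE xN).
    apply: maxN; last exact: subsetU1.
    apply/asboolP => c sc Jc y; apply: contrapT => cy; apply: h.
    by exists c; split=> //; split=> //; exists y.
  have cx : c x != 0.
    apply/eqP => cx0; apply: cy0; apply: indN => // y yN.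
    have [->//|yx] := eqVneq y x.
    by apply: sc; rewrite !inE negb_or yx.
  exists (fun y => if y == x then 0 else - ((c x)^-1 * c y)); split=> [y yN|].
    have [//|yx] := eqVneq y x.
    have -> : c y = 0 by apply: sc; rewrite !inE negb_or yx.
    by rewrite mulr0 oppr0.
  suff -> : 'X_[x] - \sum_y (if y == x then 0 else - ((c x)^-1 * c y)) *: 'X_[y]
      = (c x)^-1 *: (\sum_y c y *: 'X_[y] : {mpoly K[n]}) by apply: JZ.
  rewrite (bigD1 x) //= eqxx scale0r add0r [in RHS](bigD1 x) //= scalerDr.
  rewrite scalerA mulVf // scale1r -sumrN scaler_sumr; congr (_ + _).
  by apply: eq_bigr => y /negbTE->; rewrite scalerA scaleNr opprK.
exists (fun y => \sum_(x : 'X_{1..n < B}) f@_x * w x y); split=> [y yN|].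
  by rewrite big1 // => x _; case: (hw x) => -> //; rewrite mulr0.
have -> : \sum_y (\sum_(x : 'X_{1..n < B}) f@_x * w x y) *: 'X_[y] =
    \sum_(x : 'X_{1..n < B}) f@_x *: (\sum_y w x y *: 'X_[y] : {mpoly K[n]}).
  under eq_bigr do rewrite scaler_suml.
  rewrite exchange_big; apply: eq_bigr => x _; rewrite scaler_sumr.
  by apply: eq_bigr => y _; rewrite scalerA.
rewrite {1}(mpolywE fB) -sumrB; apply: ideal_sum => // x _.
by rewrite -scalerBr; apply: JZ; case: (hw x).
Qed.

Theorem small_witness n (T : finType) d B t : exists t',
  forall g : T -> {mpoly K[n]}, (forall l, msize (g l) <= d)%N ->
  (forall l mu, lev t (g l)@_mu) ->
  forall f h, (msize f <= B)%N -> (msize h <= B)%N ->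
  mem_ideal g (f * h) -> ~ mem_ideal g f -> ~ mem_ideal g h ->
  exists f' h', [/\ (msize f' <= B)%N, (msize h' <= B)%N,
    (forall mu, lev t' f'@_mu) /\ (forall mu, lev t' h'@_mu) &
    [/\ mem_ideal g (f' * h'), ~ mem_ideal g f' & ~ mem_ideal g h']].
Proof.
have [E hE] := hermann_fin K n T unit (d + (B + B)).
(* Both sides of the product identity have size at most [W], so finitely many coefficient equations
   express it. *)
pose W := ((B + B) + (E + d))%N.
pose X : finType := 'X_{1..n < B}.
pose Y : finType := (T * 'X_{1..n < E})%type.
(* The unknowns are the coefficients of the two factors and of the cofactors expressing their
   product through [g]. *)
pose U : finType := (X + X + Y)%type.
pose Eq : finType := ('X_{1..n < W} + (X + X) + bool)%type.
have [t0 [tt0 [lev0 lev1]]] := lev0_nat hlev t.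
have [t1 ht1] := lev_sum hlev (X * X)%type t0.
have [t2 ht2] := lev_sum hlev Y t0.
have [t3 ht3] := lev_opp hlev (t0 + t2).
have [t4 ht4] := lev_add hlev (t0 + t1 + t3).
have [t5 ht5] := leveled_nullstellensatz hlev #|U| Eq 3 (t0 + t4).
exists (t0 + t5)%N => g bg lg f h fB hB fh nf nh.
have liftl x a b : (a <= b)%N -> lev a x -> lev b x by exact: lev_le.
have idJ := mem_ideal_is_ideal g; set J := mem_ideal g in fh nf nh *.
have JZ a p : J p -> J (a *: p) by rewrite -mul_mpolyC; apply: idealMl.
have [N [indN redN]] := monomial_basis B idJ.
have normalize p : (msize p <= B)%N -> ~ J p -> exists (c : X -> K) x0 a,
    [/\ forall x, x \notin N -> c x = 0, c x0 = 1
      & J (a *: p - \sum_x c x *: 'X_[x])].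
  move=> pB np; have [c [sc Jc]] := redN p pB.
  have [x0 cx0] : exists x0, c x0 != 0.
    apply: contrapT => nc; apply: np.
    apply/(ideal_eqmod idJ Jc); rewrite big1; first exact: ideal0.
    move=> x _; have /eqP -> : c x == 0.
      by apply: contrapT => /negP h0; apply: nc; exists x.
    by rewrite scale0r.
  exists (fun x => (c x0)^-1 * c x), x0, (c x0)^-1; split=> [x xN||].
  - by rewrite (sc x xN) mulr0.
  - by rewrite mulVf.
  - rewrite [X in _ - X](_ : _ = (c x0)^-1 *: (\sum_x c x *: 'X_[x] : {mpoly K[n]})).
      by rewrite -scalerBr; apply: JZ.
    by rewrite scaler_sumr; apply: eq_bigr => x _; rewrite scalerA.
have [phi [x0 [a [sphi phi1 Jphi]]]] := normalize f fB nf.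
have [gam [x1 [b [sgam gam1 Jgam]]]] := normalize h hB nh.
pose poly1 (c : X -> K) : {mpoly K[n]} := \sum_x c x *: 'X_[x].
have msize_poly1 c : (msize (poly1 c) <= B)%N.
  by apply: msize_sum_le => x _; apply: msizeZ_leq; rewrite msizeX bmdeg.
pose poly2 (c : Y -> K) : {mpoly K[n]} :=
  \sum_l (\sum_(nu : 'X_{1..n < E}) c (l, nu) *: 'X_[nu]) * g l.
have Jpoly2 c : J (poly2 c).
  by exists (fun l => \sum_(nu : 'X_{1..n < E}) c (l, nu) *: 'X_[nu]).
have [eta eeta] : exists eta : Y -> K, poly1 phi * poly1 gam = poly2 eta.
  have bprod (_ : unit) : (msize (poly1 phi * poly1 gam)%R <= d + (B + B))%N.
    by apply: leq_trans (msizeM_leD (msize_poly1 _) (msize_poly1 _)) _; rewrite leq_addl.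
  have bg' (_ : unit) l : (msize (g l) <= d + (B + B))%N.
    by apply: leq_trans (bg l) _; rewrite leq_addr.
  have [_] := hE _ _ bg' bprod; case.
    have : J (poly1 phi * poly1 gam).
      have -> : poly1 phi * poly1 gam = (a * b) *: (f * h) -
          ((a *: f - poly1 phi) * (b *: h) + poly1 phi * (b *: h - poly1 gam)).
        rewrite -[(a * b) *: _]scalerA scalerAr scalerAl; ring.
      apply: idealB => //; first exact: JZ.
      by apply: idealD => //; [apply: idealMr | apply: idealMl].
    by case=> k ek; exists k.
  move=> k [bk /(_ tt) ek]; exists (fun y : Y => (k y.1)@_(y.2)); rewrite -ek.
  by apply: eq_bigr => l _; rewrite [in LHS](mpolywE (bk l)).
pose V (u : U) : {mpoly K[#|U|]} := 'X_(enum_rank u).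
pose Pmu (mu : 'X_{1..n}) : {mpoly K[#|U|]} :=
  \sum_(z : 'X_{1..n < B} * 'X_{1..n < B}) ('X_[z.1 + z.2] : {mpoly K[n]})@_mu *: (V (inl (inl z.1)) * V (inl (inr z.2)))
  - \sum_(y : T * 'X_{1..n < E}) (g y.1 * 'X_[y.2])@_mu *: V (inr y).
pose P (e : Eq) : {mpoly K[#|U|]} :=
  match e with
  | inl (inl mu) => Pmu mu
  | inl (inr (inl x)) => if x \in N then 0 else V (inl (inl x))
  | inl (inr (inr x)) => if x \in N then 0 else V (inl (inr x))
  | inr true => V (inl (inl x0)) - 1
  | inr false => V (inl (inr x1)) - 1
  end.
have evalV (x : 'I_#|U| -> K) u : meval x (V u) = x (enum_rank u) by rewrite mevalXU.
have evalP (x : 'I_#|U| -> K) mu : meval x (Pmu mu) =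
    (poly1 (fun z => x (enum_rank (inl (inl z) : U))) *
     poly1 (fun z => x (enum_rank (inl (inr z) : U))) -
     poly2 (fun y => x (enum_rank (inr y : U))))@_mu.
  rewrite mevalB mcoeffB; congr (_ - _).
    rewrite /poly1 mulr_suml !raddf_sum /=.
    transitivity (\sum_y \sum_z x (enum_rank (inl (inl y) : U)) *
       x (enum_rank (inl (inr z) : U)) * ('X_[y + z] : {mpoly K[n]})@_mu).
      rewrite pair_bigA; apply: eq_bigr => -[y z] _.
      by rewrite mevalZ mevalM !evalV mulrC.
    apply: eq_bigr => y _; rewrite mulr_sumr raddf_sum; apply: eq_bigr => z _.
    by rewrite /= -scalerAl -scalerAr scalerA mcoeffZ mpolyXD.
  rewrite /poly2 !raddf_sum /=.
  transitivity (\sum_l \sum_(nu : 'X_{1..n < E}) x (enum_rank (inr (l, nu) : U)) *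
     (g l * 'X_[nu])@_mu).
    rewrite pair_bigA; apply: eq_bigr => -[l nu] _.
    by rewrite mevalZ evalV mulrC.
  apply: eq_bigr => l _; rewrite mulr_suml raddf_sum; apply: eq_bigr => nu _.
  by rewrite /= -scalerAl mcoeffZ [_ * g l]mulrC.
have lV u k : lev t0 (V u)@_k by rewrite mcoeffX; case: eqP.
have bP e : (msize (P e) <= 3)%N.
  have bV u : (msize (V u) <= 2)%N by rewrite msizeX mdeg1.
  case: e => [[mu|[x|x]]|[]] /=; try by case: ifP; rewrite ?msize0 // leqW.
  - apply: msizeD_le; last first.
      apply: msizeN_le; apply: msize_sum_le => y _; apply: msizeZ_leq.
      exact: leqW.
    apply: msize_sum_le => z _; apply: msizeZ_leq.
    exact: (msizeM_deg (d := 1) (e := 1)).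
  - by apply: msizeD_le; rewrite ?mmeasureN ?msize1 // leqW.
  - by apply: msizeD_le; rewrite ?mmeasureN ?msize1 // leqW.
have lP e k : lev (t0 + t4) (P e)@_k.
  have l04 y : lev t0 y -> lev (t0 + t4) y by apply: liftl; rewrite leq_addr.
  have l4 y z : lev (t0 + t1) y -> lev t3 z -> lev (t0 + t4) (y + z).
    move=> ly lz; apply: (liftl _ t4); rewrite ?leq_addl //; apply: ht4.
      by apply: liftl ly; rewrite leq_addr.
    by apply: liftl lz; rewrite leq_addl.
  have l1 u : lev (t0 + t4) (V u - 1)@_k.
    rewrite mcoeffB; apply: l4; first by apply: liftl (lV u k); rewrite leq_addr.
    apply: ht3; rewrite mcoeff1; case: eqP => _;
      [apply: liftl lev1 | apply: liftl lev0]; by rewrite leq_addr.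
  case: e => [[mu|[x|x]]|[]] //=; try by case: ifP => _; rewrite ?mcoeff0; apply: l04.
  rewrite /Pmu mcoeffB; apply: l4.
    apply: (liftl _ t1); rewrite ?leq_addl // raddf_sum /=; apply: ht1 => z.
    rewrite mcoeffZ !mcoeffX -mpolyXD mcoeffX.
    by case: eqP; case: eqP; rewrite ?mulr1 ?mulr0.
  apply: ht3; apply: (liftl _ t2); rewrite ?leq_addl // raddf_sum /=; apply: ht2 => y.
  rewrite mcoeffZ mcoeffX; case: eqP => _; rewrite ?mulr0 // mulr1 mcoeffMX_if.
  by case: ifP => // _; apply: liftl (lg _ _).
have nP : ~ mem_ideal P 1.
  pose x (i : 'I_#|U|) : K := match enum_val i : U with
    inl (inl z) => phi z | inl (inr z) => gam z | inr y => eta y end.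
  have xE u : x (enum_rank u) = match u with
    inl (inl z) => phi z | inl (inr z) => gam z | inr y => eta y end.
    by rewrite /x enum_rankK.
  case=> k /(congr1 (meval x)); rewrite meval1 raddf_sum big1 => [/eqP|e _].
    by rewrite oner_eq0.
  rewrite /= mevalM [X in _ * X](_ : _ = 0) ?mulr0 //.
  case: e => [[mu|[y|y]]|[]] /=.
  - rewrite evalP; under [poly1 _]eq_bigr do rewrite xE.
    under [X in _ * X - _]eq_bigr do rewrite xE.
    rewrite -/(poly1 phi) -/(poly1 gam) eeta.
    rewrite [X in _ - X](_ : _ = poly2 eta) ?subrr ?mcoeff0 //.
    by apply: eq_bigr => l _; congr (_ * _); apply: eq_bigr => nu _; rewrite xE.
  - by case: ifP => [_|/negbT yN]; rewrite ?meval0 // evalV xE sphi.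
  - by case: ifP => [_|/negbT yN]; rewrite ?meval0 // evalV xE sgam.
  - by rewrite mevalB meval1 evalV xE phi1 subrr.
  - by rewrite mevalB meval1 evalV xE gam1 subrr.
have [x [lx xP]] := ht5 P bP lP nP.
pose phi' z := x (enum_rank (inl (inl z) : U)).
pose gam' z := x (enum_rank (inl (inr z) : U)).
have lpoly1 c mu : (forall z, lev (t0 + t5) (c z)) -> lev (t0 + t5) (poly1 c)@_mu.
  move=> lc; rewrite /poly1 raddf_sum /=; have [muB|Bmu] := ltnP (mdeg mu) B.
    rewrite (bigD1 (BMultinom muB)) //= mcoeffZ mcoeffX eqxx mulr1 big1 ?addr0 //.
    move=> z nz; rewrite mcoeffZ mcoeffX.
    by case: eqP => [e|]; rewrite ?mulr0 //; case/eqP: nz; apply: val_inj.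
  rewrite big1 => [|z _]; first by apply: liftl lev0; rewrite leq_addr.
  rewrite mcoeffZ mcoeffX; case: eqP => [e|]; rewrite ?mulr0 //.
  by move: (bmdeg z); rewrite e ltnNge Bmu.
have lx' i : lev (t0 + t5) (x i) by apply: liftl (lx i); rewrite leq_addl.
have notJ (c : X -> K) z : (forall y, y \notin N -> c y = 0) -> c z = 1 -> ~ J (poly1 c).
  move=> sc cz /(indN c sc)/(_ z); rewrite cz => /eqP.
  by rewrite oner_eq0.
exists (poly1 phi'), (poly1 gam'); split=> //.
  by split=> mu; apply: lpoly1 => z; apply: lx'.
split.
- suff -> : poly1 phi' * poly1 gam' = poly2 (fun y => x (enum_rank (inr y : U))) by [].
  apply/eqP; rewrite -subr_eq0; apply/eqP/mpolyP => mu; rewrite mcoeff0.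
  have [muW|Wmu] := ltnP (mdeg mu) W.
    by have := xP (inl (inl (BMultinom muW))); rewrite /= evalP.
  set D := _ - _; have : (msize D <= W)%N.
    apply: msizeD_le.
      apply: leq_trans (msizeM_leD (msize_poly1 _) (msize_poly1 _)) _.
      by rewrite leq_addr.
    apply: msizeN_le; apply: leq_trans (_ : E + d <= _)%N; last by rewrite leq_addl.
    apply: msize_sum_le => l _; apply: msizeM_leD => //.
    by apply: msize_sum_le => nu _; apply: msizeZ_leq; rewrite msizeX bmdeg.
  by move/msize_leP; apply.
- apply: (notJ _ x0) => [y yN|].
    by have := xP (inl (inr (inl y))); rewrite /= (negbTE yN) evalV.
  by have := xP (inr true); rewrite /= mevalB meval1 evalV => /eqP; rewrite subr_eq0 => /eqP.
- apply: (notJ _ x1) => [y yN|].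
    by have := xP (inl (inr (inr y))); rewrite /= (negbTE yN) evalV.
  by have := xP (inr false); rewrite /= mevalB meval1 evalV => /eqP; rewrite subr_eq0 => /eqP.
Qed.

End SmallWitness.

Local Notation pQtoC := (map_poly (ratr : rat -> algC)).
Local Notation pZtoC := (map_poly (intr : int -> algC)).
Local Notation pZtoQ := (map_poly (intr : int -> rat)).

(** * Mahler measures of roots *)

Lemma symmetric_value (R L : idomainType) (g : {rmorphism R -> L}) N
    (th : N.-tuple L) (m : {poly R}) (p : {mpoly R[N]}) :
  map_poly g m = \prod_(w <- th) ('X - w%:P) -> p \is symmetric ->
  exists F, g F = mmap g (tnth th) p.
Proof.
move=> em /sym_fundamental[t [<- _]].
pose G : {rmorphism {mpoly R[N]} -> L} := mmap g (tnth th).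
pose c (i : 'I_N) : R := (-1) ^+ i.+1 * m`_(N - i.+1).
have Gs (i : 'I_N) : G (mesym N R i.+1) = g (c i).
  have iN : (i.+1 < N.+1)%N by rewrite ltnS ltn_ord.
  have := mroots_coeff th (Ordinal iN); rewrite -em coef_map /= => e.
  rewrite rmorphM rmorphXn rmorphN1 /= e mulrA -exprMn mulrNN mulr1 expr1n mul1r.
  rewrite /mesym !raddf_sum /=; apply/eq_bigr => h _.
  rewrite !rmorph_prod /=; apply/eq_bigr => j _.
  by rewrite /G /= mmapX mmap1U mevalXU.
exists t.@[c].
transitivity (G (t \mPo [tuple mesym N R i.+1 | i < N])) => //.
rewrite /comp_mpoly /meval [in LHS]/mmap [X in G X]/mmap !rmorph_sum.
apply: eq_bigr => mu _.
rewrite !rmorphM; congr (_ * _); first by rewrite /G /= mmapC.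
rewrite /mmap1 !rmorph_prod; apply: eq_bigr => i _.
by rewrite !rmorphXn tnth_mktuple Gs.
Qed.

Lemma prod_conjugates z : minCpoly z = \prod_(w <- conjugates z) ('X - w%:P).
Proof.
rewrite /conjugates; case: closed_field_poly_normal => r /= {1}->.
by rewrite (monicP (minCpoly_monic z)) scale1r.
Qed.

Lemma size_conjugates z : size (conjugates z) = alg_degree z.
Proof. by rewrite /alg_degree prod_conjugates size_prod_XsubC. Qed.

Lemma alg_degree_gt0 z : (0 < alg_degree z)%N.
Proof. by rewrite /alg_degree; move: (size_minCpoly z); case: size => [|[]]. Qed.

Lemma minCpoly_irreducible z : exists p : {poly rat},
  [/\ minCpoly z = pQtoC p, p \is monic, irreducible_poly p
    & forall q, root (pQtoC q) z = (p %| q)].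
Proof.
have [p [ep mp] hp] := minCpolyP z; exists p; split=> //.
have sp : (1 < size p)%N by rewrite -(size_map_poly (ratr : rat -> algC)) -ep size_minCpoly.
split=> // q sq qp; have [k ek] := dvdpP _ _ qp.
have p0 : p != 0 by rewrite monic_neq0.
have : root (pQtoC p) z by rewrite -ep root_minCpoly.
rewrite ek rmorphM rootM !hp => /orP[|p1q]; last by rewrite /eqp -ek qp p1q.
have /norP[k0 q0] : ~~ ((k == 0) || (q == 0)) by rewrite -mulf_eq0 -ek.
move/(dvdp_leq k0); rewrite ek size_mul // => h; case/eqP: sq.
have := size_poly_gt0 k; have := size_poly_gt0 q; rewrite k0 q0.
by move: h; move: (size k) (size q) => x y; lia.
Qed.

Lemma map_polyQZ p : pQtoC (pZtoQ p) = pZtoC p.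
Proof. by rewrite -map_poly_comp; apply: eq_map_poly => x /=; rewrite ratr_int. Qed.

Lemma int_minpoly_neq0 z : tag (rat_poly_scale (s2val (minCpolyP z))) != 0.
Proof.
case: (minCpolyP z) => p [ep mp] _ /=; case: rat_poly_scale => q [a _ eq] /=.
apply: contraTneq mp => q0.
by rewrite eq q0 rmorph0 scaler0 monicE lead_coef0 eq_sym oner_eq0.
Qed.

Lemma lead_int_minpoly_gt0 z : 0 < lead_coef (int_minpoly z).
Proof. by rewrite -sgz_gt0 /int_minpoly sgz_lead_primitive int_minpoly_neq0. Qed.

Lemma zprimitive_int_minpoly z : zprimitive (int_minpoly z) = int_minpoly z.
Proof. by rewrite /int_minpoly zprimitive_id. Qed.

Lemma map_int_minpoly z :
  pZtoC (int_minpoly z) = (lead_coef (int_minpoly z))%:~R *: minCpoly z.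
Proof.
suff [c ec] : exists c, pZtoC (int_minpoly z) = c *: minCpoly z.
  rewrite ec; congr (_ *: _).
  have := congr1 lead_coef ec; rewrite lead_coef_map_inj // ?lead_coefZ; last exact: intr_inj.
  by rewrite (monicP (minCpoly_monic z)) mulr1 => ->.
have := int_minpoly_neq0 z; rewrite /int_minpoly.
case: (minCpolyP z) => p [ep mp] hp /=; case: rat_poly_scale => q [a a0 eq] /= q0.
have z0 : (zcontents q)%:~R != 0 :> algC by rewrite intr_eq0 zcontents_eq0.
exists ((zcontents q)%:~R^-1 * a%:~R).
rewrite ep eq map_polyZ map_polyQZ {3}[q]zpolyEprim map_polyZ /= !scalerA.
by rewrite fmorphV /= ratr_int mulfK ?intr_eq0 // mulVf //= scale1r.
Qed.

(** This is a norm from Q(z)[X] to Q[X], symmetric in the conjugates. The symmetric function theorem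
    is applied over [{poly rat}], where the powers ['X^(e j)] count as constants. *)
Lemma conjugates_norm (J : finType) (p : J -> {poly rat}) (e : J -> nat) z :
  exists F : {poly rat}, pQtoC F =
    \prod_(w <- conjugates z) \sum_j (pQtoC (p j)).[w] *: 'X^(e j).
Proof.
have [m [em _ _ _]] := minCpoly_irreducible z.
pose N := size (conjugates z).
pose th : N.-tuple {poly algC} := [tuple of map polyC (in_tuple (conjugates z))].
pose E i := \sum_j (\sum_(k < size (p j)) ((p j)`_k)%:P%:MP * 'X_i ^+ k)
   * ('X^(e j))%:MP : {mpoly {poly rat}[N]}.
have [||F eF] := @symmetric_value _ _ pQtoC N th (map_poly polyC m) (\prod_i E i).
- rewrite -map_poly_comp (eq_map_poly (g := polyC \o ratr)) => [|x /=]; last exact: map_polyC.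
  rewrite (map_poly_comp polyC) -em prod_conjugates rmorph_prod big_map /=.
  by apply: eq_bigr => w _; rewrite rmorphB /= map_polyX map_polyC.
- apply/issymP => s; rewrite rmorph_prod [RHS](reindex_inj (@perm_inj _ s)) /=.
  apply: eq_bigr => i _; rewrite rmorph_sum; apply: eq_bigr => j _.
  rewrite rmorphM rmorph_sum /= [X in _ * X]mmapC; congr (_ * _).
  apply: eq_bigr => k _; rewrite rmorphM rmorphXn /= [X in X * _]mmapC.
  by rewrite [X in X ^+ _]mmapX mmap1U.
exists F; rewrite eF rmorph_prod [RHS]big_tnth; apply: eq_bigr => i _.
rewrite rmorph_sum; apply: eq_bigr => j _.
rewrite rmorphM rmorph_sum /= mmapC /= map_polyXn -mul_polyC; congr (_ * _).
rewrite horner_coef size_map_poly rmorph_sum; apply: eq_bigr => k _ /=.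
rewrite !rmorphM !rmorphXn /= mmapC mmapX mmap1U coef_map /=.
by rewrite (map_polyC _ (p j)`_k) tnth_map.
Qed.

(** The product is rational and divides a power of the irreducible minimal polynomial of [p(z)], so
    it is itself a power of it. *)
Lemma conjugates_image z (p : {poly rat}) : exists r,
  \prod_(w <- conjugates z) ('X - ((pQtoC p).[w])%:P) =
  minCpoly (pQtoC p).[z] ^+ r.
Proof.
have [m [em mm _ mz]] := minCpoly_irreducible z.
have [g [eg mg ig gz]] := minCpoly_irreducible (pQtoC p).[z].
have [F eF] := @conjugates_norm bool (fun b => if b then 1 else - p) (fun b => b) z.
have {}eF : pQtoC F = \prod_(w <- conjugates z) ('X - ((pQtoC p).[w])%:P).
  rewrite eF; apply: eq_bigr => w _; rewrite big_bool /= rmorph1 hornerC scale1r.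
  by rewrite rmorphN hornerN scaleNr -mul_polyC expr0 mulr1.
have mF : F \is monic by rewrite -(map_monic (ratr : {rmorphism rat -> algC})) eF monic_prod_XsubC.
rewrite -eF eg.
have : F %| g ^+ size (conjugates z).
  rewrite -(dvdp_map (ratr : {rmorphism rat -> algC})) eF rmorphXn /=.
  have : {in conjugates z, forall w, root (pQtoC g) (pQtoC p).[w]}.
    move=> w wz; have rw : root (pQtoC m) w by rewrite -em prod_conjugates root_prod_XsubC.
    have : root (pQtoC (g \Po p)) z.
      by rewrite map_comp_poly /root horner_comp -/(root _ _) gz.
    rewrite mz => /dvdpP[k ek].
    rewrite /root -horner_comp -map_comp_poly ek rmorphM hornerM.
    by rewrite (rootP rw) mulr0.
  elim: (conjugates z) => [|w s IHs] hs; first by rewrite big_nil dvd1p.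
  rewrite big_cons exprS dvdp_mul ?IHs // ?dvdp_XsubCl.
    by apply: hs; rewrite mem_head.
  by move=> x xs; apply: hs; rewrite inE xs orbT.
move=> /(dvdp_irreducible_exp ig)[r]; rewrite eqp_monic ?monic_exp // => /eqP ->.
by exists r; rewrite rmorphXn.
Qed.

(** * Algebraic integers among products of roots *)

Lemma Aint_integral x : x \in Aint <-> integralOver (intr : int -> algC) x.
Proof.
split=> [/floorpP[p ep]|[p mp rp]].
  have := minCpoly_monic x; have := root_minCpoly x; rewrite ep => rp mp.
  exists p => //; apply/monicP/(@intr_inj algC).
  by rewrite -(lead_coef_map_inj (@intr_inj algC)) // (monicP mp).
apply: (root_monic_Aint rp); first exact: monic_map.
by apply/polyOverP => i; rewrite coef_map /= intr_int.
Qed.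

Lemma Aint_root_monic (f : {poly algC}) x :
  f \is monic -> f \is a polyOver Aint -> root f x -> x \in Aint.
Proof.
move=> mf /polyOverP hf rf; apply/Aint_integral.
apply: integral_root_monic rf _ => //; apply/integral_poly => i.
exact/Aint_integral.
Qed.

Lemma Aint_lead_root (f : {poly algC}) x :
  f \is a polyOver Aint -> root f x -> f != 0 -> lead_coef f * x \in Aint.
Proof.
move=> /polyOverP hf rf f0; pose c := lead_coef f; pose d := (size f).-1.
have sf : size f = d.+1 by rewrite /d prednK // size_poly_gt0.
have d0 : (0 < d)%N by have := root_size_gt1 f0 rf; rewrite sf.
pose h1 := \poly_(i < d) (f`_i * c ^+ (d.-1 - i)).
have sh : (size h1 < size ('X^d : {poly algC}))%N.
  by rewrite size_polyXn ltnS size_poly.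
apply: (@Aint_root_monic ('X^d + h1)).
- by rewrite monicE lead_coefDl // lead_coefXn.
- rewrite rpredD ?polyOverXn //; apply/polyOverP => i; rewrite coef_poly.
  by case: ifP => // _; rewrite rpredM ?rpredX ?hf //; apply: hf.
rewrite /root /h1 hornerD hornerXn horner_poly.
have e : \sum_(i < d) f`_i * c ^+ (d.-1 - i) * (c * x) ^+ i = c ^+ d.-1 * \sum_(i < d) f`_i * x ^+ i.
  rewrite mulr_sumr; apply: eq_bigr => i _.
  have di : (d.-1 = d.-1 - i + i)%N.
    by rewrite subnK // -ltnS prednK // ltn_ord.
  by rewrite {2}di exprD exprMn; ring.
have ed : c ^+ d = c ^+ d.-1 * c by rewrite -exprSr prednK.
rewrite e exprMn ed -mulrA -mulrDr.
have := rootP rf; rewrite horner_coef sf big_ord_recr /= addrC.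
by rewrite -[f`_d]/(f`_((size f).-1)) -lead_coefE => ->; rewrite mulr0.
Qed.

(** The leading coefficient times [x] is integral by [Aint_lead_root]; removing the leading term of
    [g] therefore preserves the hypothesis, and induction applies. *)
Lemma Aint_scale_quotient (g : {poly algC}) x :
  ('X - x%:P) * g \is a polyOver Aint -> x *: g \is a polyOver Aint.
Proof.
move: {2}(size g).+1 (ltnSn (size g)) => k.
elim: k => // k IHk in g * => sg hf.
have [->|g0] := eqVneq g 0; first by rewrite scaler0 rpred0.
pose c := lead_coef g; pose m := (size g).-1; pose g1 := g - c *: 'X^m.
have lf : lead_coef (('X - x%:P) * g) = c by rewrite mulrC lead_coef_Mmonic ?monicXsubC.
have cA : c \in Aint by rewrite -lf lead_coefE; apply: (polyOverP hf).
have cxA : c * x \in Aint.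
  rewrite -lf; apply: Aint_lead_root => //; first by rewrite rootM root_XsubC eqxx.
  by rewrite mulf_neq0 // polyXsubC_eq0.
have -> : x *: g = x *: g1 + (c * x) *: 'X^m.
  by rewrite /g1 scalerBr scalerA [x * c]mulrC subrK.
suff xg1 : x *: g1 \is a polyOver Aint.
  by apply: rpredD => //; rewrite polyOverZ ?polyOverXn.
apply: IHk.
  apply: (@leq_trans (size g)); last by rewrite -ltnS.
  rewrite -size_poly_gt0 in g0.
  rewrite -[size g in X in (_ < X)%N](prednK g0) ltnS; apply/leq_sizeP => j.
  rewrite leq_eqVlt => /orP[/eqP <-|hj].
    by rewrite coefB coefZ coefXn eqxx mulr1 subrr.
  rewrite coefB coefZ coefXn (gtn_eqF hj) mulr0 subr0 nth_default //.
  by rewrite -(prednK g0).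
have -> : ('X - x%:P) * g1 = ('X - x%:P) * g - c *: ('X * 'X^m) + (c * x) *: 'X^m.
  by rewrite /g1 -!mul_polyC !polyCM; ring.
by rewrite -exprS rpredD ?rpredB ?polyOverZ ?polyOverXn.
Qed.

(* Kronecker: dividing out one root at a time, the quotient [g] and the product
   of [g] by the removed root both keep integral coefficients. *)
Lemma Aint_lead_prod (I : Type) (s : seq I) (P : pred I) (x : I -> algC) a :
  a *: \prod_(i <- s) ('X - (x i)%:P) \is a polyOver Aint ->
  a * \prod_(i <- s | P i) x i \in Aint.
Proof.
elim: s a => [|i s IHs] a; rewrite ?big_nil ?big_cons.
  by rewrite mulr1 -[a%:A]mul_polyC mulr1 polyOverC.
rewrite scalerAr; move=> hf; have xg := Aint_scale_quotient hf.
case: (P i); first by rewrite mulrA [a * _]mulrC IHs // -scalerA.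
apply: IHs; set g := (a *: _) in hf xg *.
apply/polyOverP => k; have /polyOverP /(_ k.+1) := hf; have /polyOverP /(_ k.+1) := xg.
rewrite coefZ mulrBl coefB coefXM coefCM /= => h1 h2.
by rewrite -[g`_k](subrK (x i * g`_k.+1)) rpredD.
Qed.

Lemma conjugate_root z w (p : {poly rat}) : w \in conjugates z ->
  root (pQtoC p) w = root (pQtoC p) z.
Proof.
move=> wz; have [p1 [e1 mon1 irr1] min1] := minCpoly_irreducible z.
have [p2 [e2 mon2 irr2] min2] := minCpoly_irreducible w.
rewrite min1 min2; suff e : p2 %= p1 by rewrite (eqp_dvdl _ e).
apply: irr1; first by case: irr2; case: size => [|[]].
by rewrite -min2 -e1 prod_conjugates root_prod_XsubC.
Qed.

Definition normC1 (w : algC) : algC := if 1 <= `|w| then `|w| else 1.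

Lemma normC1_ge1 w : 1 <= normC1 w.
Proof. by rewrite /normC1; case: ifP. Qed.

Lemma normC1_ge0 w : 0 <= normC1 w.
Proof. exact: le_trans ler01 (normC1_ge1 w). Qed.

Lemma le_normC1 w : `|w| <= normC1 w.
Proof.
rewrite /normC1; case: ifP => // /negbT; rewrite -real_ltNge ?real1 ?normr_real //.
exact: ltW.
Qed.

Definition mahlerC z : algC :=
  (lead_coef (int_minpoly z))%:~R * \prod_(w <- conjugates z) normC1 w.

Lemma mahlerC_ge1 z : 1 <= mahlerC z.
Proof.
rewrite -[1]mulr1 /mahlerC ler_pM ?ler01 //.
  rewrite -[1]/(1%:~R) ler_int; exact: lead_int_minpoly_gt0.
by elim/big_rec: _ => // w x _ x1; rewrite -[1]mulr1 ler_pM ?ler01 ?normC1_ge1.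
Qed.

(** Measures of several numbers become comparable: a power of each is a product over the conjugates
    of the same [z]. *)
Lemma conjugates_image_int z (p : {poly rat}) : let x := (pQtoC p).[z] in
  exists r, [/\ (0 < r)%N, (alg_degree x * r)%N = alg_degree z,
    pZtoC (int_minpoly x ^+ r) = (lead_coef (int_minpoly x))%:~R ^+ r *:
      \prod_(w <- conjugates z) ('X - ((pQtoC p).[w])%:P)
  & mahlerC x ^+ r = (lead_coef (int_minpoly x))%:~R ^+ r *
      \prod_(w <- conjugates z) normC1 (pQtoC p).[w]].
Proof.
move=> x; have [r er] := conjugates_image z p; rewrite -/x in er.
have deg : (alg_degree x * r)%N = alg_degree z.
  have := congr1 (fun q : {poly algC} => (size q).-1) er.
  by rewrite size_exp size_prod_XsubC size_conjugates => <-.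
exists r; split=> //.
- by have := alg_degree_gt0 z; rewrite -deg; case: (r) => //; rewrite muln0.
- by rewrite er rmorphXn /= map_int_minpoly exprZn.
have pow (S : comNzRingType) (G : algC -> S) :
    \prod_(w <- flatten (nseq r (conjugates x))) G w = (\prod_(w <- conjugates x) G w) ^+ r.
  by rewrite big_flatten big_nseq iter_mulr_1.
have : perm_eq [seq (pQtoC p).[w] | w <- conjugates z] (flatten (nseq r (conjugates x))).
  by apply: prod_XsubC_eq; rewrite big_map er pow -prod_conjugates.
by rewrite /mahlerC exprMn -pow => /(perm_big _) <-; rewrite big_map.
Qed.

(* The top term dominates: for [1 <= `|b|] divide the relation by
   [b ^+ (e k0).-1]. *)
Lemma relation_bound (J : finType) (c : J -> algC) (e : J -> nat) k0 b :
  (forall j, j != k0 -> (e j < e k0)%N) -> c k0 != 0 ->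
  \sum_j c j * b ^+ e j = 0 -> `|c k0| * normC1 b <= \sum_j `|c j|.
Proof.
move=> he c0; rewrite (bigD1 k0) //= => /eqP; rewrite addr_eq0 => /eqP hb.
rewrite /normC1; case: ifP => b1; last first.
  by rewrite mulr1 (bigD1 k0) //= lerDl sumr_ge0.
have b0 : 0 < `|b| by apply: lt_le_trans b1.
case: (posnP (e k0)) => [e0|e0].
  move: hb; rewrite e0 mulr1 big1 => [cc|j /he]; last by rewrite e0.
  by rewrite cc oppr0 eqxx in c0.
rewrite (bigD1 k0) //= ler_wpDl //.
rewrite -(ler_pM2r (exprn_gt0 (e k0).-1 b0)) -mulrA -exprS prednK //.
rewrite -normrX -normrM hb normrN (le_trans (ler_norm_sum _ _ _)) // mulr_suml.
apply: ler_sum => j /he hj; rewrite normrM normrX ler_wpM2l // ler_weXn2l //.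
by rewrite -ltnS prednK.
Qed.

Lemma sum_le_prod_normC1 (J : finType) (c : J -> algC) :
  \sum_j `|c j| <= #|J|%:R * \prod_j normC1 (c j).
Proof.
rewrite mulr_natl -sumr_const; apply: ler_sum => j _.
rewrite (bigD1 j) //= -[leLHS]mulr1 ler_pM // ?ler01 ?le_normC1 //.
by elim/big_rec: _ => // i x _ x1; rewrite -[1]mulr1 ler_pM ?ler01 ?normC1_ge1.
Qed.

(** Expand the product over all choices of an index for each conjugate. In every term, [a j] absorbs
    the chosen values of [p j] by [Aint_lead_prod]; finally, rational algebraic integers are
    integers. *)
Lemma norm_integral (J : finType) (p : J -> {poly rat}) (e : J -> nat)
    (a : J -> int) z :
  (forall j, (a j)%:~R *: \prod_(w <- conjugates z) ('X - ((pQtoC (p j)).[w])%:P)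
     \is a polyOver Aint) ->
  exists F : {poly int}, pZtoC F = (\prod_j (a j)%:~R) *:
    \prod_(w <- conjugates z) \sum_j (pQtoC (p j)).[w] *: 'X^(e j).
Proof.
move=> ha; have [F0 eF0] := conjugates_norm p e z.
have [F eF] : exists F, pQtoC F = (\prod_j (a j)%:~R) *:
    \prod_(w <- conjugates z) \sum_j (pQtoC (p j)).[w] *: 'X^(e j).
  exists ((\prod_j (a j)%:~R) *: F0); rewrite map_polyZ eF0 rmorph_prod; congr (_ *: _).
  by apply: eq_bigr => j _; rewrite /= ratr_int.
suff /floorpP[G eG] : pQtoC F \is a polyOver Num.int by exists G; rewrite -eG eF.
suff /polyOverP hF : pQtoC F \is a polyOver Aint.
  apply/polyOverP => i; apply: Cint_rat_Aint; last by have := hF i.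
  by rewrite coef_map /= Crat_rat.
rewrite eF [X in _ *: X]big_tnth bigA_distr_bigA scaler_sumr rpred_sum // => f _.
pose v i j := (pQtoC (p j)).[tnth (in_tuple (conjugates z)) i].
rewrite (eq_bigr (fun i => v i (f i) *: 'X^(e (f i)))) // scaler_prod scalerA polyOverZ //; last first.
  by rewrite rpred_prod // => i _; rewrite polyOverXn.
rewrite (partition_big f predT) //= -big_split /= rpred_prod // => j _.
have := ha j; rewrite big_tnth => /(@Aint_lead_prod _ _ (fun i => f i == j)).
by rewrite (eq_bigr (fun i => v i (f i))) // => i /eqP <-.
Qed.

Lemma poly_int_lead_dvd (p q : {poly int}) : zprimitive p = p -> q != 0 ->
  pZtoC p %| pZtoC q -> `|lead_coef p| <= `|lead_coef q|.
Proof.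
move=> pp q0; rewrite -!map_polyQZ dvdp_map dvdp_rat_int => /dvdpP_int[r er].
rewrite er lead_coefM normrM pp ler_peMr // -gtz0_ge1 normr_gt0 lead_coef_eq0.
by apply: contraNneq q0 => r0; rewrite er r0 mulr0.
Qed.

(* With all the numbers written as polynomials in a primitive element [z], the
   product over the conjugates of [z] of the polynomial [\sum_j c j *: 'X^(e j)],
   scaled by leading coefficients of minimal polynomials, lies in Z[X] and is
   divisible by a power of the minimal polynomial of [b]. This bounds the
   leading coefficient of the latter; the conjugates are bounded one by one. *)
Lemma mahlerC_root (J : finType) (c : J -> algC) (e : J -> nat) k0 b t :
  (forall j, j != k0 -> (e j < e k0)%N) -> c k0 != 0 ->
  \sum_j c j * b ^+ e j = 0 ->
  (forall j, mahlerC (c j) <= t.+1%:R ^+ alg_degree (c j)) ->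
  mahlerC b <= (#|J|%:R * t.+1%:R ^+ #|J|) ^+ alg_degree b.
Proof.
move=> he c0 hb hc.
have [z _ [ps eps]] := algC_PET (b :: map c (enum J)).
have [q [p [eb ec]]] : exists q p, b = (pQtoC q).[z] /\ forall j, c j = (pQtoC (p j)).[z].
  case: ps eps => // q ps [-> eps]; exists q, (fun j => nth 0 ps (index j (enum J))).
  split=> // j; have sj : (index j (enum J) < size (enum J))%N by rewrite index_mem mem_enum.
  have szs : size ps = size (enum J) by have := congr1 size eps; rewrite !size_map.
  have := congr1 (fun s => nth 0 s (index j (enum J))) eps.
  rewrite (nth_map j) // (nth_map 0) ?szs // => <-.
  by rewrite nth_index ?mem_enum.
pose s := conjugates z.
have rel : {in s, forall w, \sum_j (pQtoC (p j)).[w] * (pQtoC q).[w] ^+ e j = 0}.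
  move=> w ws; pose h := \sum_j p j * q ^+ e j.
  have hE x : (pQtoC h).[x] = \sum_j (pQtoC (p j)).[x] * (pQtoC q).[x] ^+ e j.
    rewrite rmorph_sum horner_sum; apply: eq_bigr => j _.
    by rewrite rmorphM rmorphXn /= hornerM horner_exp.
  rewrite -hE; apply/rootP; rewrite (conjugate_root _ ws); apply/rootP.
  by rewrite hE -eb -[RHS]hb; apply: eq_bigr => j _; rewrite -ec.
have nz : {in s, forall w, (pQtoC (p k0)).[w] != 0}.
  move=> w ws; rewrite -[_ == 0]/(root _ _) (conjugate_root _ ws).
  by rewrite /root -ec.
have [r [r0 degb eP mb]] := conjugates_image_int z q; rewrite -eb in degb eP mb.
have /fin_all_exists[rj hrj] j := conjugates_image_int z (p j).
pose a j := lead_coef (int_minpoly (c j)) ^+ rj j.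
have a0 j : 0 < a j by rewrite exprn_gt0 ?lead_int_minpoly_gt0.
have [F eF] : exists F : {poly int}, pZtoC F = (\prod_j (a j)%:~R) *:
    \prod_(w <- s) \sum_j (pQtoC (p j)).[w] *: 'X^(e j).
  apply: norm_integral => j; have [_ _ eQ _] := hrj j.
  rewrite /a rmorphXn /= ec -eQ; apply/polyOverP => i.
  by rewrite coef_map /= Aint_int.
have lw w : w \in s -> lead_coef (\sum_j (pQtoC (p j)).[w] *: 'X^(e j)) = (pQtoC (p k0)).[w].
  move=> ws; rewrite (bigD1 k0) //= lead_coefDl.
    by rewrite lead_coefZ lead_coefXn mulr1.
  rewrite size_scale ?nz // size_polyXn ltnS; apply: (leq_trans (size_sum _ _ _)).
  apply/bigmax_leqP => j /he hj; apply: leq_trans (size_scale_leq _ _) _.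
  by rewrite size_polyXn.
have lF : (lead_coef F)%:~R = (\prod_j (a j)%:~R) * \prod_(w <- s) (pQtoC (p k0)).[w].
  rewrite -(lead_coef_map_inj (@intr_inj algC)) // eF lead_coefZ lead_coef_prod.
  by congr (_ * _); rewrite !big_seq; apply: eq_bigr => w /lw.
have F0 : F != 0.
  rewrite -lead_coef_eq0 -(intr_eq0 algC) lF mulf_neq0 //.
    by apply/prodf_neq0 => j _; rewrite intr_eq0 gt_eqF.
  by rewrite prodf_seq_neq0; apply/allP => w /nz.
have dvd : pZtoC (int_minpoly b ^+ r) %| pZtoC F.
  rewrite eP eF dvdpZl ?expf_neq0 ?intr_eq0 ?gt_eqF ?lead_int_minpoly_gt0 //.
  rewrite dvdpZr; last by apply/prodf_neq0 => j _; rewrite intr_eq0 gt_eqF.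
  rewrite 2!big_seq; elim/big_rec2: _ => [|w x y ws xy]; first exact: dvdpp.
  rewrite dvdp_mul // dvdp_XsubCl; apply/rootP; rewrite horner_sum -[RHS](rel w ws).
  by apply: eq_bigr => j _; rewrite hornerZ hornerXn.
have zpX k : zprimitive (int_minpoly b ^+ k) = int_minpoly b ^+ k.
  elim: k => [|k IHk]; first by rewrite zprimitive_monic ?monic1.
  by rewrite exprS zprimitiveM IHk zprimitive_int_minpoly.
(* By primitivity the leading coefficient of [F] bounds that of [int_minpoly b ^+ r]. It contains
   the factors [(pQtoC (p k0)).[w]], exactly those needed on the left of [relation_bound]. *)
have := poly_int_lead_dvd (zpX r) F0 dvd.
rewrite lead_coef_exp normrX (gtr0_norm (lead_int_minpoly_gt0 b)).
rewrite -(ler_int algC) intr_norm lF normrM -rmorph_prod /= -intr_norm.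
rewrite gtr0_norm ?prodr_gt0 // rmorphXn rmorph_prod /= normr_prod => hlead.
have pa0 : 0 <= \prod_j ((a j)%:~R : algC) by rewrite prodr_ge0 // => j _; rewrite ler0z ltW.
rewrite -(ler_pXn2r r0) ?nnegrE; last 2 first.
- exact: le_trans ler01 (mahlerC_ge1 b).
- by rewrite exprn_ge0 // mulr_ge0 ?exprn_ge0.
rewrite -exprM degb mb.
apply: le_trans (ler_wpM2r _ hlead) _; first by rewrite prodr_ge0 // => w _; rewrite normC1_ge0.
rewrite -mulrA -big_split /=.
pose X w := #|J|%:R * \prod_j normC1 (pQtoC (p j)).[w].
apply: (@le_trans _ _ (\prod_j (a j)%:~R * \prod_(w <- s) X w)).
  rewrite ler_wpM2l // [leLHS]big_seq [leRHS]big_seq ler_prod // => w ws.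
  rewrite mulr_ge0 ?normC1_ge0 //=.
  apply: le_trans (relation_bound he _ (rel w ws)) (sum_le_prod_normC1 _).
  exact: nz.
rewrite /X big_split /= big_const_seq count_predT iter_mulr_1 -/s size_conjugates mulrCA exprMn.
rewrite ler_wpM2l ?exprn_ge0 // exchange_big -big_split /= -prodr_const -prodrXl.
rewrite ler_prod // => j _; have [_ degj _ mj] := hrj j.
rewrite /a rmorphXn /= ec -mj exprn_ge0 /= ?(le_trans ler01 (mahlerC_ge1 _)) //.
rewrite -degj exprM lerXn2r ?nnegrE ?exprn_ge0 ?(le_trans ler01 (mahlerC_ge1 _)) //.
by rewrite -ec.
Qed.

(* [t.+1] bounds the exponential of the height, without leaving [algC]. *)
Definition mahler_level (t : nat) (z : algC) : Prop :=
  mahlerC z <= t.+1%:R ^+ alg_degree z.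

Lemma mahler_level_le t t' z : (t <= t')%N -> mahler_level t z -> mahler_level t' z.
Proof.
move=> tt /le_trans; apply; rewrite lerXn2r ?nnegrE ?ler0n // ler_nat; exact: tt.
Qed.

Lemma mahler_level_exists z : exists t, mahler_level t z.
Proof.
have m0 := le_trans ler01 (mahlerC_ge1 z).
exists (Num.bound (mahlerC z)); rewrite /mahler_level.
apply: le_trans (ltW (archi_boundP m0)) _.
apply: (@le_trans _ _ (Num.bound (mahlerC z)).+1%:R); first by rewrite ler_nat.
by rewrite ler_eXnr ?alg_degree_gt0 // ler1n.
Qed.

Lemma mahler_level_root m t : exists t', forall (J : finType) (c : J -> algC) e k0 b,
  (#|J| <= m)%N -> (forall j, j != k0 -> (e j < e k0)%N) -> c k0 != 0 ->
  \sum_j c j * b ^+ e j = 0 -> (forall j, mahler_level t (c j)) -> mahler_level t' b.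
Proof.
exists (m * t.+1 ^ m)%N => J c e k0 b mJ he c0 hb hc.
apply: le_trans (mahlerC_root he c0 hb hc) _.
rewrite -natrX -natrM lerXn2r ?nnegrE ?ler0n // ler_nat.
by rewrite ltnW // ltnS leq_mul // leq_pexp2l.
Qed.

(** Each operation is a root extraction: [- x] is the root of [X + x], [x^-1] of [x X - 1], [x + y]
    of [X - x - y], and [x y] of [x^-1 X - y]. For the sum, [- x] and [- y] stay separate terms of
    exponent 0, as no level of their sum is known yet. *)
Lemma mahler_level_structure : level_structure mahler_level.
Proof.
have [t0 [h0 h1 hN1]] : exists t0, [/\ mahler_level t0 0, mahler_level t0 1 & mahler_level t0 (-1)].
  have [a ha] := mahler_level_exists 0; have [b hb] := mahler_level_exists 1.
  have [c hc] := mahler_level_exists (-1); exists (a + b + c)%N.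
  by split; [move: ha | move: hb | move: hc]; apply: mahler_level_le; lia.
have raise t x : mahler_level t x -> mahler_level (t + t0) x.
  by apply: mahler_level_le; rewrite leq_addr.
have raise0 t x : mahler_level t0 x -> mahler_level (t + t0) x.
  by apply: mahler_level_le; rewrite leq_addl.
have opp t : exists t', forall x, mahler_level t x -> mahler_level t' (- x).
  have [t' ht] := mahler_level_root 2 (t + t0); exists t' => x hx.
  apply: (ht bool (fun j => if j then 1 else x) (fun j => j : nat) true).
  - by rewrite card_bool.
  - by case.
  - exact: oner_neq0.
  - by rewrite big_bool /= expr1 expr0 mul1r mulr1 addNr.
  - by case; [exact: raise0 | exact: raise].
have inv t : exists t', forall x, mahler_level t x -> mahler_level t' x^-1.
  have [t' ht] := mahler_level_root 2 (t + t0); exists (t' + t0)%N => x hx.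
  have [->|x0] := eqVneq x 0; first by rewrite invr0; exact: raise0.
  apply: (raise _ _).
  apply: (ht bool (fun j => if j then x else -1) (fun j => j : nat) true) => //.
  - by rewrite card_bool.
  - by case.
  - by rewrite big_bool /= expr1 expr0 mulr1 mulfV // subrr.
  - by case; [exact: raise | exact: raise0].
split.
- exact: mahler_level_le.
- by move=> k; exact: mahler_level_exists.
- move=> t; have [t1 ht1] := opp t.
  have [t' ht] := mahler_level_root 3 (t1 + t0); exists t' => x y hx hy.
  apply: (ht (option bool) (fun j => if j is Some i then if i then - x else - y else 1)
    (fun j => (j == None) : nat) None).
  - by rewrite card_option card_bool.
  - by case.
  - exact: oner_neq0.
  - rewrite (bigD1 None) //= (bigD1 (Some true)) //= (bigD1 (Some false)) //= big1 => [|[[]|] //].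
    by rewrite expr1 expr0; ring.
  - by case=> [[]|]; [apply: raise; exact: ht1 | apply: raise; exact: ht1 | exact: raise0].
- move=> t; have [t1 ht1] := opp t; have [t2 ht2] := inv t.
  have [t' ht] := mahler_level_root 2 (t1 + t2); exists (t' + t0)%N => x y hx hy.
  have [->|x0] := eqVneq x 0; first by rewrite mul0r; exact: raise0.
  apply: (raise _ _).
  apply: (ht bool (fun j => if j then x^-1 else - y) (fun j => j : nat) true).
  - by rewrite card_bool.
  - by case.
  - by rewrite invr_eq0.
  - by rewrite big_bool /= expr1 expr0 mulr1 mulKf // subrr.
  - case; [move: (ht2 _ hx)|move: (ht1 _ hy)]; apply: mahler_level_le; lia.
- exact: opp.
- exact: inv.
move=> t d; have [t' ht] := mahler_level_root d t; exists t' => p p0 sp hp x px.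
have s0 : (0 < size p)%N by rewrite size_poly_gt0.
have s1 : ((size p).-1 < size p)%N by rewrite prednK.
apply: (ht 'I_(size p) (fun j => p`_j) (fun j => j : nat) (Ordinal s1)).
- by rewrite card_ord.
- move=> j; rewrite -val_eqE /= => hj; by rewrite ltn_neqAle hj -ltnS prednK ?ltn_ord.
- by rewrite /= -lead_coefE lead_coef_eq0.
- by rewrite -horner_coef; exact/rootP.
- by move=> j.
Qed.

(** * Levels and heights *)

Section Heights.
Variable R : realType.

Let normR1 (w : algC) : R := if 1 <= `|w| then algC_abs R w else 1.

Lemma algC_abs_nat (w : algC) (k : nat) : k%:R <= `|w| -> `|w| < k.+1%:R ->
  k%:R <= algC_abs R w <= k.+1%:R.
Proof.
move=> kw wk; pose S := [set ratr q | q in [set q : rat | ratr q <= `|w|]]%classic : set R.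
have Sk : S k%:R by exists k%:R => //=; rewrite ratr_nat.
have ubS : ubound S k.+1%:R.
  move=> _ [q /= qw <-]; rewrite -(ratr_nat R) ler_rat ltW //.
  by rewrite -(ltr_rat algC) ratr_nat; apply: le_lt_trans wk.
apply/andP; split; first by apply: ub_le_sup => //; exists k.+1%:R.
by apply: ge_sup => //; exists k%:R.
Qed.

(* Integer parts compare absolute values in [algC] and in [R] within a factor
   2, which costs only [ln 2] on the height. *)
Lemma normC1_nat (w : algC) : exists f : nat, [/\ (0 < f)%N,
  f%:R <= normC1 w <= (2 * f)%:R & f%:R <= normR1 w <= (2 * f)%:R].
Proof.
rewrite /normC1 /normR1; case: ifP => [w1|_]; last first.
  by exists 1%N; split; rewrite ?lexx ?ler1n.
pose f := Num.truncn `|w|; have /andP[fw wf] := truncn_itv (normr_ge0 w).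
have f0 : (0 < f)%N.
  by rewrite lt0n; apply: contraL wf => /eqP; rewrite -/f => ->; rewrite -real_leNgt ?real1 ?normr_real.
have f2 : (f.+1 <= 2 * f)%N by lia.
exists f; split=> //; rewrite ?fw /=.
  by apply: le_trans (ltW wf) _; rewrite ler_nat.
have /andP[-> h] := algC_abs_nat fw wf.
by apply: le_trans h _; rewrite ler_nat.
Qed.

(** One natural number approximates both measures, so passing between [algC] and [R] only compares
    natural numbers. *)
Lemma mahler_nat z : exists F : nat, [/\ (0 < F)%N,
  F%:R <= mahlerC z <= (2 ^ alg_degree z * F)%:R
  & F%:R <= mahler R z <= (2 ^ alg_degree z * F)%:R].
Proof.
have [f hf] := boolp.choice normC1_nat.
pose L := `|lead_coef (int_minpoly z)|%N.
have eL (S : pzRingType) : (lead_coef (int_minpoly z))%:~R = L%:R :> S.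
  by rewrite -{1}(gtz0_abs (lead_int_minpoly_gt0 z)).
exists (L * \prod_(w <- conjugates z) f w)%N.
have bnd (S : numDomainType) (g : algC -> S) :
    (forall w, (f w)%:R <= g w <= (2 * f w)%:R) ->
    (L * \prod_(w <- conjugates z) f w)%:R <= L%:R * \prod_(w <- conjugates z) g w
      <= (2 ^ alg_degree z * (L * \prod_(w <- conjugates z) f w))%:R.
  have -> : (2 ^ alg_degree z * (L * \prod_(w <- conjugates z) f w) =
      L * \prod_(w <- conjugates z) (2 * f w))%N.
    by rewrite big_split /= big_const_seq count_predT iter_muln_1 size_conjugates mulnCA.
  move=> hg; rewrite !natrM !ler_wpM2l ?ler0n // natr_prod ler_prod // => w _.
    by have /andP[f1 ->] := hg w; rewrite (le_trans _ f1) ?ler0n.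
  by have /andP[-> _] := hg w; rewrite ler0n.
split.
- rewrite muln_gt0 prodn_gt0 ?andbT; last by move=> w; have [] := hf w.
  by rewrite absz_gt0 gt_eqF ?lead_int_minpoly_gt0.
- by rewrite /mahlerC eL; apply: (bnd _ normC1) => w; have [] := hf w.
rewrite /mahler gtr0_norm ?lead_int_minpoly_gt0 // eL [X in _ <= _ * X <= _]big_mkcond.
by apply: (bnd _ normR1) => w; have [] := hf w.
Qed.

Lemma height_level (H : R) : exists c, forall z, height R z <= H -> mahler_level c z.
Proof.
have e0 : 0 <= expR H by rewrite expR_ge0.
pose T := Num.bound (expR H).
exists (2 * T)%N => z hz; have [F [F0 /andP[_ FC] /andP[FR _]]] := mahler_nat z.
have d0 := alg_degree_gt0 z.
have m0 : 0 < mahler R z by apply: lt_le_trans FR; rewrite ltr0n.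
have hF : (F <= T ^ alg_degree z)%N.
  rewrite -(ler_nat R); apply: le_trans FR _.
  move: hz; rewrite /height ler_pdivrMr ?ltr0n // -ler_expR lnK // => /le_trans; apply.
  by rewrite expRM_natr natrX lerXn2r ?nnegrE ?ler0n // ltW // archi_boundP.
apply: le_trans FC _; rewrite -natrX ler_nat.
apply: (@leq_trans ((2 * T) ^ alg_degree z)); last by rewrite leq_exp2r.
by rewrite expnMn leq_mul.
Qed.

Lemma level_height c : exists C : R, 0 < C /\
  forall z, mahler_level c z -> height R z < C.
Proof.
have l0 : 0 <= ln (2 * c.+1)%:R :> R by rewrite ln_ge0 // ler1n.
(* The added 1 gives strictness and positivity; the latter covers the default value 0 in
   [mpheight]. *)
exists (ln (2 * c.+1)%:R + 1); split=> [|z hz]; first by rewrite ltr_wpDl.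
have [F [F0 /andP[FC _] /andP[FR1 FR]]] := mahler_nat z.
have d0 := alg_degree_gt0 z.
have m0 : 0 < mahler R z by apply: lt_le_trans FR1; rewrite ltr0n.
rewrite (@le_lt_trans _ _ (ln (2 * c.+1)%:R)) ?ltrDl //.
rewrite /height ler_pdivrMr ?ltr0n // mulr_natr -lnXn ?ltr0n //.
rewrite ler_ln ?posrE ?exprn_gt0 ?ltr0n //; apply: le_trans FR _.
rewrite -natrX ler_nat expnMn leq_mul // -(ler_nat algC) natrX.
exact: le_trans FC hz.
Qed.

End Heights.

(** Generators are selected inside [S] to keep their heights. The zero padding is a separate
    alternative because for negative [H] the zero polynomial has height above [H]. *)
Lemma finite_generators (R : realType) n D : exists t, forall (H : R) I,
  @DH_type R n D H I -> exists g : 'I_t -> {mpoly algC[n]},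
  [/\ forall l, (msize (g l) <= D.+1)%N,
      forall l, g l = 0 \/ mpheight R (g l) <= H &
      forall p, p \in I <-> mem_ideal g p].
Proof.
have [t ht] := bounded_span algC n unit D.+1; exists t => H I [S [hS hI]].
have bS p : S p -> (msize p <= D.+1)%N.
  by case/hS; rewrite /totdeg; lia.
have [|W [W1 W2]] := ht (fun v => S (v tt)); first by move=> v Sv []; exact: bS.
exists (fun l => W l tt); split=> [l|l|p].
- by case: (W1 l) => [/bS|->] //; rewrite mmeasure0.
- by case: (W1 l) => [/hS[_]|->]; [right|left].
have idg := mem_ideal_is_ideal (fun l => W l tt).
rewrite hI; split=> [[s [sS ->]]|[h ->]].
  rewrite big_seq; apply: (ideal_sum idg) => c /sS Sc; apply: (idealMl idg).
  have [a ea] := W2 (fun=> c.2) Sc; rewrite (ea tt).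
  by apply: (ideal_sum idg) => l _; rewrite -mul_mpolyC; apply: (idealMl idg); apply: mem_ideal_gen.
exists [seq (h l, W l tt) | l <- enum 'I_t & `[< S (W l tt) >]]; split.
  by move=> c /mapP[l]; rewrite mem_filter => /andP[/asboolP Sl _] ->.
rewrite big_map big_filter big_enum_cond /= [RHS]big_mkcond; apply: eq_bigr => l _.
case: asboolP => // nS; case: (W1 l) => // ->; exact: mulr0.
Qed.

Lemma mpheight_coef (R : realType) n (p : {mpoly algC[n]}) mu (H : R) :
  mpheight R p <= H -> mu \in msupp p -> height R p@_mu <= H.
Proof.
move=> pH mup; apply: le_trans pH; exact: (@le_bigmax_seq _ _ _ _ _ mu xpredT).
Qed.

(** A failure of the degree test is traded for one of bounded height, which the hypothesis excludes.
    [B] is produced before [H]. *)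
Lemma exists_bounds (R : realType) n D : exists B, forall H : R, exists C : R,
  forall I : {pred {mpoly algC[n]}}, DH_type D H I ->
  (prime_ideal I <->
   (1 \notin I /\
    forall f g : {mpoly algC[n]},
      (totdeg f < B)%N -> (totdeg g < B)%N ->
      mpheight R f < C -> mpheight R g < C ->
      f * g \in I -> f \in I \/ g \in I)).
Proof.
have [t ht] := finite_generators R n D.
have [B hB] := prime_bound algC n 'I_t D.+1.
(* [prime_test B] concerns [msize <= B], which implies [totdeg < B.+1] even for the zero
   polynomial. *)
exists B.+1 => H; have [c hc] := height_level H.
(* The height hypothesis reaches only coefficients in the support; the zero coefficients need a
   level of their own. *)
have [c0 h0] := mahler_level_exists 0.
have [c' hc'] := small_witness mahler_level_structure n 'I_t D.+1 B (c + c0).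
have [C [C0 hC]] := level_height R c'.
exists C => I DHI; have [g [gD gH Ig]] := ht H I DHI.
have idg := mem_ideal_is_ideal g.
split=> [[[I0 I1 Iadd] pI]|[I1 hI]].
  split=> // f h _ _ _ _ fhI; apply/orP; exact: pI.
have nI1 : ~ mem_ideal g 1 by move/Ig; apply/negP.
have test : prime_test B (mem_ideal g).
  move=> f h fB hB' fh; apply: contrapT => /not_orP[nf nh].
  have [|f' [h' [f'B h'B [f'c h'c] [fh' nf' nh']]]] := hc' g gD _ f h fB hB' fh nf nh.
    move=> l mu; case: (boolP (mu \in msupp (g l))) => [ml|/memN_msupp_eq0->]; last first.
      by apply: mahler_level_le h0; rewrite leq_addl.
    apply: mahler_level_le (leq_addr _ _) (hc _ _).
    case: (gH l) => [gl0|]; first by rewrite gl0 msupp0 in ml.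
    by move/mpheight_coef; apply.
  have small p : (msize p <= B)%N -> (totdeg p < B.+1)%N.
    by rewrite /totdeg ltnS; apply: leq_trans (leq_pred _).
  have low p : (forall mu, mahler_level c' p@_mu) -> mpheight R p < C.
    by move=> pc; apply: bigmax_lt => // mu _; apply: hC.
  by case: (hI f' h') => //; rewrite ?Ig; auto.
have prime := hB g gD nI1 test.
split; first split=> //.
- by apply/Ig; apply: ideal0.
- by move=> a u v /Ig Iu /Ig Iv; apply/Ig; apply: (idealD idg) => //; apply: idealMl.
by move=> u v /Ig /prime[/Ig ->|/Ig ->]; rewrite ?orbT.
Qed.

Theorem theoremB (R : realType) :
  exists (B : nat -> nat -> nat) (C : nat -> nat -> R -> R),
  forall (n D : nat) (H : R) (I : {pred {mpoly algC[n]}}),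
    DH_type D H I ->
    (prime_ideal I <->
     (1 \notin I /\
      forall f g : {mpoly algC[n]},
        (totdeg f < B n D)%N -> (totdeg g < B n D)%N ->
        mpheight R f < C n D H -> mpheight R g < C n D H ->
        f * g \in I -> f \in I \/ g \in I)).
Proof.
have [B hB] := boolp.choice (fun nD : nat * nat => exists_bounds R nD.1 nD.2).
have [C hC] := boolp.choice (fun x : nat * nat * R => hB x.1 x.2).
by exists (fun n D => B (n, D)), (fun n D H => C (n, D, H)) => n D H; exact: hC (n, D, H).
Qed.
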